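(* Let $(Y_t)_{t\ge 0}$ be a continuous nonnegative local submartingale on $(\Omega,\mathcal{F},(\mathcal{F}_t)_{t\ge 0},\mathbb{P})$ such that $Y_0=0$, with Doob-Meyer decomposition $Y_t=m_t+\ell_t$. Then $(Y_t)_{t\ge 0}$ admits the multiplicative decomposition $$Y_t=M_tC_t-1,$$ where $(M_t)_{t\ge 0}$ is a continuous, strictly positive local martingale with $M_0=1$, and $(C_t)_{t\ge 0}$ is an increasing, continuous and adapted process with $C_0=1$. This decomposition is unique, and the processes $C$ and $M$ are given by $$C_t=\exp\left(\int_0^t\frac{d\ell_s}{1+Y_s}\right)$$ and $$M_t=(Y_t+1)\exp\left(-\int_0^t\frac{d\ell_s}{1+Y_s}\right)=\exp\left(\int_0^t\frac{dm_s}{1+Y_s}-\frac12\int_0^t\frac{d\langle m\rangle_s}{(1+Y_s)^2}\right).$$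
   Context: $(\Omega,\mathcal{F},(\mathcal{F}_t)_{t\ge 0},\mathbb{P})$ is a filtered probability space satisfying the usual assumptions. In the Doob-Meyer decomposition $Y=m+\ell$ of a continuous local submartingale with $Y_0=0$, $m$ is a continuous local martingale with $m_0=0$ and $\ell$ is a continuous adapted increasing process with $\ell_0=0$. ''Increasing'' means nondecreasing, and uniqueness of processes is up to indistinguishability. *)

(* Defs.v *)
From HB Require Import structures.
From mathcomp Require Import all_boot all_order all_algebra.
From mathcomp Require Import all_classical all_reals all_analysis.

Set Implicit Arguments.
Unset Strict Implicit.
Unset Printing Implicit Defensive.

Import Order.TTheory GRing.Theory Num.Theory.
Import numFieldNormedType.Exports.

Local Open Scope classical_set_scope.
Local Open Scope ring_scope.

(* Time is the half-line [0, +oo[ of R: processes are indexed by the whole of R,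
   but their values at negative times, and those of filtrations, are never
   constrained. As usual under the usual conditions, properties of sample paths
   are required almost surely. *)

Section Processes.
Context {d : measure_display} {T : measurableType d} {R : realType}.
Variable P : probability T R.

Implicit Types (F : R -> set (set T)) (G : set (set T)).
Implicit Types (X Y N M C A H I m ell qv : R -> T -> R).

Definition filtration F :=
  (forall t, 0 <= t -> sigma_algebra setT (F t) /\ F t `<=` measurable) /\
  (forall s t, 0 <= s -> s <= t -> F s `<=` F t).

(* P.-negligible sets need not be measurable a priori, so the second clause also
   says that the underlying probability space is complete. *)
Definition usual_conditions F :=
  [/\ filtration F,
      P.-negligible `<=` F 0 &
      forall t, 0 <= t -> \bigcap_(s in [set s | t < s]) F s `<=` F t].

Definition measurable_wrt G (Z : T -> R) :=
  forall B : set R, measurable B -> G (Z @^-1` B).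

Definition adapted F X := forall t, 0 <= t -> measurable_wrt (F t) (X t).

Definition path_continuous X :=
  {ae P, forall w, {within `[0, +oo[, continuous (fun t => X t w)}}.

Definition path_nondecreasing X :=
  {ae P, forall w, forall s t, 0 <= s -> s <= t -> X s w <= X t w}.

Definition starts_at (x : R) X := {ae P, forall w, X 0 w = x}.

Definition indistinguishable X Y :=
  {ae P, forall w, forall t, 0 <= t -> X t w = Y t w}.

(* Z is a version of E[V | G]. *)
Definition cond_exp G (V Z : T -> R) :=
  [/\ P.-integrable setT (EFin \o V), P.-integrable setT (EFin \o Z),
      measurable_wrt G Z &
      forall B, G B ->
        (\int[P]_(w in B) (Z w)%:E = \int[P]_(w in B) (V w)%:E)%E].

Definition martingale F X :=
  forall s t, 0 <= s -> s <= t -> cond_exp (F s) (X t) (X s).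

Definition submartingale F X :=
  adapted F X /\
  forall s t, 0 <= s -> s <= t ->
    exists Z, cond_exp (F s) (X t) Z /\
      P.-integrable setT (EFin \o X s) /\ {ae P, forall w, X s w <= Z w}.

Definition stopping_time F (tau : T -> \bar R) :=
  (forall w, (0 <= tau w)%E) /\
  (forall t, 0 <= t -> F t [set w | (tau w <= t%:E)%E]).

Definition stopped X (tau : T -> \bar R) : R -> T -> R :=
  fun t w => X (fine (Order.min t%:E (tau w))) w.

(* Subtracting X_0 is the usual convention that allows a local martingale to
   have a non-integrable initial value. *)
Definition locally F (K : (R -> T -> R) -> Prop) X :=
  adapted F X /\
  exists tau : nat -> T -> \bar R,
    [/\ forall n, stopping_time F (tau n),
        {ae P, forall w, nondecreasing_seq (fun n => tau n w) /\
                         (fun n => tau n w) @ \oo --> +oo%E} &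
        forall n, K (fun t w => stopped X (tau n) t w - X 0 w)].

Definition local_martingale F := locally F (martingale F).

Definition local_submartingale F := locally F (submartingale F).

Definition continuous_local_martingale F X :=
  path_continuous X /\ local_martingale F X.

Definition continuous_increasing F A :=
  [/\ adapted F A, path_continuous A & path_nondecreasing A].

Definition doob_meyer F Y m ell :=
  [/\ continuous_local_martingale F m, starts_at 0 m,
      continuous_increasing F ell, starts_at 0 ell &
      indistinguishable Y (fun t w => m t w + ell t w)].

(* The cumulative function extending a : [0, +oo[ -> R by the constant a 0; it
   exists when a is nondecreasing and right-continuous on [0, +oo[, and idfun is
   a dummy value otherwise. *)
Definition cumulative_of (a : R -> R) : cumulative R R :=
  match pselect (exists f : cumulative R R,
                   forall s, f s = a (Num.max 0 s)) with
  | left h => projT1 (cid h)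
  | right _ => idfun
  end.

(* The pathwise Lebesgue-Stieltjes integral \int_0^t H_s dA_s of a process H
   against an increasing process A. *)
Definition stieltjes_integral H A : R -> T -> R := fun t w =>
  Rintegral (lebesgue_stieltjes_measure (cumulative_of (fun s => A s w)))
    [set` `]0, t]] (fun s => H s w).

(* qv = <m> for a continuous local martingale m with m_0 = 0. *)
Definition quadratic_variation F m qv :=
  [/\ continuous_increasing F qv, starts_at 0 qv &
      local_martingale F (fun t w => m t w ^+ 2 - qv t w)].

(* A1 - A2 = <X, N>. The bracket is a process of finite variation, given here as
   a difference of two continuous increasing processes. *)
Definition bracket F X N A1 A2 :=
  [/\ continuous_increasing F A1 /\ starts_at 0 A1,
      continuous_increasing F A2 /\ starts_at 0 A2 &
      local_martingale F (fun t w => X t w * N t w - (A1 t w - A2 t w))].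

(* I = \int_0^. H_s dm_s, for m a continuous local martingale with m_0 = 0 and H
   continuous and adapted: I is the continuous local martingale null at 0 such
   that <I, N> = \int_0^. H_s d<m, N>_s for every continuous local martingale N
   (Revuz and Yor, Continuous Martingales and Brownian Motion, chapter IV). *)
Definition stochastic_integral F H m I :=
  [/\ continuous_local_martingale F I, starts_at 0 I &
      forall N A1 A2, continuous_local_martingale F N ->
        bracket F m N A1 A2 ->
        local_martingale F (fun t w => I t w * N t w -
          (stieltjes_integral H A1 t w - stieltjes_integral H A2 t w))].

Definition multiplicative_decomposition F Y M C :=
  [/\ [/\ continuous_local_martingale F M, starts_at 1 M &
          {ae P, forall w, forall t, 0 <= t -> 0 < M t w}],
      continuous_increasing F C, starts_at 1 C &
      indistinguishable Y (fun t w => M t w * C t w - 1)].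

End Processes.

(* Main.v *)
(** The processes are handled through their stopped versions at the hitting
times of a continuous process that dominates all of them, so that only bounded
martingales occur.

No stochastic integral is ever constructed. A bounded adapted process [Z] is a
martingale as soon as its increment over [[s, t]] equals, up to a term of zero
conditional expectation given [F_s], an error that is [o((X_t - X_s)^2 + v_t -
v_s)] along every path, for a bounded martingale [X] and a bounded increasing
[v]: summing over finer and finer partitions, the errors vanish because the
sums of squared increments of [X] are bounded in [L^2]. This gives:
- [M = (1 + Y) exp(-L)] is a local martingale, since [dM = exp(-L) dm + o(dl)];
- with [I = ln M + 1/2 \int H^2 d<m>], where [H = 1 / (1 + Y)], Taylor's
  formula shows that [I] is a local martingale and that [I N - \int H d<m, N>]
  is one whenever [N] is; hence [I = \int H dm], and [M = exp(I - 1/2 \int H^2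
  d<m>)] by the definition of [I];
- uniqueness: if [(M', C')] is another decomposition and [Q = exp(L) / C'],
  then [M' = M Q], and [M Q^2] is again a local martingale because [Q] has
  finite variation; so [E[M (Q - 1)^2] = E[M Q^2] - 2 E[M'] + E[M]] keeps its
  initial value [0] along the stopped processes, and [Q = 1]. *)
Require Import Defs.
From HB Require Import structures.
From mathcomp Require Import all_boot all_order all_algebra.
From mathcomp Require Import all_classical all_reals all_analysis.
From mathcomp Require Import measurable_realfun ring lra.
Import Order.TTheory GRing.Theory Num.Theory.
Import numFieldNormedType.Exports.
Set Implicit Arguments.
Unset Strict Implicit.
Unset Printing Implicit Defensive.
Local Open Scope classical_set_scope.
Local Open Scope ring_scope.

(** * Continuous paths and Stieltjes integrals *)

(** The error of a one-step expansion is small path by path, at a mesh that depends on the path, so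
    it does not pass to expectations directly. The total error [A] along a grid is therefore written
    [g * U], with [U] the total clock: [g] is bounded by a constant and tends to 0 on every path,
    hence [g ^+ 2] tends to 0 in mean, while [U] stays bounded in [L^2] uniformly in the grid. This
    is why each error must be both dominated with a uniform constant and negligible pathwise. Some
    terms, such as [dm ^+ 2 - dq], have the exact order of the clock. They are not small, but up to
    a multiple of [dm] known at the left endpoint they are increments of the local martingale
    [m ^+ 2 - q], hence have conditional expectation 0 after stopping. Regularity is only almost
    sure, so the work is done on a set [Om] of good paths, which lies in [F 0] because negligible
    sets do. No single [Om] suffices: the competitors [(M', C')] and the test processes [N] are
    universally quantified, and each brings its own exceptional set. *)

Section Paths.
Variable R : realType.
Implicit Types (x y a h : R -> R) (s t : R).

(** A modulus of continuity on ordered pairs, one for each horizon [U]: the form that sums of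
    increments over a fine grid consume. *)
Definition uniformly_continuous_path x := forall U e, 0 < e ->
  exists2 del, 0 < del & forall s t, 0 <= s -> s <= t -> t <= U ->
    t - s < del -> `|x t - x s| <= e.

Local Notation upath := uniformly_continuous_path.

Lemma within_ray_continuousP x :
  {within `[0, +oo[, continuous x} <->
  forall t e, 0 <= t -> 0 < e -> exists2 del, 0 < del &
    forall s, 0 <= s -> `|t - s| < del -> `|x t - x s| < e.
Proof.
split.
  move=> /subspace_continuousP cx t e t0 e0.
  have /cx : `[0, +oo[%classic t by rewrite /= in_itv/= t0.
  move=> /cvgrPdist_lt/(_ e e0); rewrite near_withinE near_simpl.
  move=> /nbhs_ballP[del/= del0 H]; exists del => // s s0 ts.
  by apply: H => //=; rewrite in_itv/= s0.
move=> H; apply/subspace_continuousP => t /=; rewrite in_itv/= andbT => t0.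
apply/cvgrPdist_lt => e e0; have [del del0 K] := H _ _ t0 e0.
rewrite near_withinE near_simpl; apply/nbhs_ballP; exists del => //= s ts.
by rewrite in_itv/= andbT => s0; apply: K.
Qed.

(** Heine-Cantor on each segment [[0, U]], by compactness in its near-covering form. *)
Lemma upathP x : {within `[0, +oo[, continuous x} <-> upath x.
Proof.
rewrite within_ray_continuousP; split; last first.
  move=> ux t e t0 e0.
  have [|del del0 H] := ux (t + 1) (e / 2); first by rewrite divr_gt0.
  have e2e : e / 2 < e by rewrite ltr_pdivrMr// ltr_pMr// ltr1n.
  exists (Num.min del 1); first by rewrite lt_min del0/=.
  move=> s s0; rewrite lt_min => /andP[sd s1].
  apply: le_lt_trans e2e.
  have [st|/ltW ts] := leP s t.
    by apply: H => //; [rewrite lerDl|move: sd; rewrite ger0_norm// subr_ge0].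
  move: s1 sd; rewrite distrC ger0_norm ?subr_ge0// => s1 sd.
  by rewrite distrC; apply: H => //; lra.
move=> cx U e e0.
have /compact_near_coveringP cU := @segment_compact R 0 U.
pose P (del t : R) :=
  forall s, 0 <= s -> 0 <= t -> `|t - s| < del -> `|x t - x s| <= e.
have H : \forall del \near 0^'+, `[0, U]%classic `<=` P del.
  apply: cU => t /=; rewrite in_itv/= => /andP[t0 tU].
  have [|r r0 H] := cx t (e / 2) t0; first by rewrite divr_gt0.
  (* Half the radius: if [u] is within [r / 2] of [t] and [s] within [del < r / 2] of [u], then both
     lie within [r] of [t]. *)
  exists ([set s | `|t - s| < r / 2], [set del | del < r / 2]).
    split.
      by apply/nbhs_ballP; exists (r / 2) => //=; rewrite divr_gt0.
    by near=> del; near: del; apply: nbhs_right_lt; rewrite divr_gt0.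
  move=> [u del]/= [tu dr] s s0 u0 us.
  have -> : x u - x s = (x t - x s) - (x t - x u) by ring.
  have tsr : `|t - s| < r.
    have -> : t - s = (t - u) + (u - s) by ring.
    by apply: le_lt_trans (ler_normD _ _) _; lra.
  have := H _ s0 tsr; have := H _ u0 (lt_trans tu (_ : r / 2 < r)).
  have := ler_normB (x t - x s) (x t - x u).
  by move=> n1 /(_ ltac:(lra)) n2 n3; lra.
have [del [/= del0 K]] := filter_ex (filterI (nbhs_right_gt 0) H).
exists del => // s t s0 st tU ts.
apply: K => //=; rewrite ?in_itv/=; [|lra|]; first by rewrite tU (le_trans s0 st).
by rewrite ger0_norm ?subr_ge0.
Unshelve. all: by end_near. Qed.

Lemma upath_cst c : upath (fun=> c).
Proof. by move=> U e e0; exists 1 => // s t *; rewrite subrr normr0 ltW. Qed.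

Lemma upath_norm x : upath x -> upath (fun t => `|x t|).
Proof.
move=> ux U e e0; have [d d0 H] := ux U e e0; exists d => // s t s0 st tU ts.
exact: le_trans (ler_dist_dist _ _) (H _ _ s0 st tU ts).
Qed.

Lemma upath_within x U : upath x -> {within `[0, U], continuous x}.
Proof.
move=> /upathP; apply: continuous_subspaceW => t /=.
by rewrite !in_itv/= => /andP[->].
Qed.

Lemma upath_bounded x U : upath x ->
  exists K, forall t, 0 <= t -> t <= U -> `|x t| <= K.
Proof.
move=> ux; have [U0|U0] := leP 0 U; last first.
  by exists 0 => t t0 tU; exfalso; lra.
have cxU := upath_within (U := U) (upath_norm ux).
have [c _ H] := EVT_max U0 cxU.
by exists `|x c| => t t0 tU; apply: H; rewrite in_itv/= t0.
Qed.

Section Ops.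
Variables x y : R -> R.
Hypotheses (ux : upath x) (uy : upath y).

Lemma upathN : upath (fun t => - x t).
Proof.
move=> U e e0; have [d d0 H] := ux U e0; exists d => // s t s0 st tU ts.
by rewrite -opprD normrN H.
Qed.

Lemma upathD : upath (fun t => x t + y t).
Proof.
move=> U e e0; have e20 : 0 < e / 2 by rewrite divr_gt0.
have [d1 d10 H1] := ux U e20; have [d2 d20 H2] := uy U e20.
exists (Num.min d1 d2); first by rewrite lt_min d10.
move=> s t s0 st tU; rewrite lt_min => /andP[ts1 ts2].
have -> : x t + y t - (x s + y s) = (x t - x s) + (y t - y s) by ring.
apply: le_trans (ler_normD _ _) _; have := H1 _ _ s0 st tU ts1.
by have := H2 _ _ s0 st tU ts2; lra.
Qed.

Lemma upath_comp g (I : set R) : (forall t, 0 <= t -> I (x t)) ->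
  {in I, continuous g} -> upath (fun t => g (x t)).
Proof.
move=> Ix cg; apply/upathP; apply/subspace_continuousP => t /= t0.
have /subspace_continuousP/(_ t t0) := (upathP x).2 ux.
move: t0; rewrite in_itv/= andbT => t0 xt.
by apply: (cvg_comp _ _ xt); apply: cg; rewrite inE; exact: Ix.
Qed.

Lemma upathM : upath (fun t => x t * y t).
Proof.
have cx := (upathP x).2 ux; have cy := (upathP y).2 uy.
apply/upathP => t.
exact: (@cvgM _ _ (nbhs (t : subspace `[0, +oo[%classic)) _ x y _ _ (cx t) (cy t)).
Qed.

End Ops.

Lemma upathX x n : upath x -> upath (fun t => x t ^+ n).
Proof.
move=> ux; elim: n => [|n ih]; first exact: upath_cst.
under eq_fun do rewrite exprS; exact: upathM.
Qed.

Lemma upathB x y : upath x -> upath y -> upath (fun t => x t - y t).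
Proof. by move=> ux uy; apply: upathD => //; apply: upathN. Qed.

Lemma eq_upath x y : (forall t, 0 <= t -> x t = y t) -> upath x -> upath y.
Proof.
move=> xy ux U e e0; have [d d0 H] := ux U e e0; exists d => // s t s0 st tU ts.
by rewrite -!xy// ?(le_trans s0)// H.
Qed.

(** Meant for [f t = min t r], which stops the path at [r]. *)
Lemma upath_time_change x (f : R -> R) : upath x ->
  (forall t, 0 <= t -> 0 <= f t <= t) ->
  (forall s t, 0 <= s -> s <= t -> 0 <= f t - f s <= t - s) ->
  upath (fun t => x (f t)).
Proof.
move=> ux f0 fL U e e0; have [d d0 H] := ux U e e0.
exists d => // s t s0 st tU ts.
have /andP[fs0 fss] := f0 _ s0; have /andP[ft0 ftt] := f0 _ (le_trans s0 st).
have /andP[f1 f2] := fL _ _ s0 st.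
by apply: H => //; lra.
Qed.

Lemma upath_cvg x (u : R^nat) t : upath x -> (forall n, 0 <= u n) -> 0 <= t ->
  u n @[n --> \oo] --> t -> x (u n) @[n --> \oo] --> x t.
Proof.
move=> ux u0 t0 ut; apply/cvgrPdist_lt => e e0.
have /upathP/within_ray_continuousP/(_ t e t0 e0)[d d0 H] := ux.
move/cvgrPdist_lt: ut => /(_ d d0) ut.
by near=> n; apply: H => //; near: n.
Unshelve. all: by end_near. Qed.

End Paths.

(** * Lebesgue-Stieltjes integrals along one path *)

Section Stieltjes.
Variable R : realType.
Implicit Types (a h : R -> R) (s t : R).
Local Notation upath := uniformly_continuous_path.

Definition ray_nondecreasing a := forall s t, 0 <= s -> s <= t -> a s <= a t.

(** Extended to the left by its value at 0, [a] is nondecreasing and right-continuous on the whole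
    line, so [cumulative_of] takes its first branch. *)
Lemma cumulative_ofE a : upath a -> ray_nondecreasing a ->
  forall s, cumulative_of a s = a (Num.max 0 s).
Proof.
move=> ua nda; rewrite /cumulative_of; case: pselect => [h|h].
  by move=> s; rewrite (projT2 (cid h)).
exfalso; apply: h.
pose f s := a (Num.max 0 s).
have max_ge0 (s : R) : 0 <= Num.max 0 s by rewrite le_max lexx.
have f_nd : {homo f : s t / s <= t}.
  by move=> s t st; apply: nda => //; rewrite ge_max max_ge0 le_max st orbT.
have f_rc : right_continuous f.
  apply: right_continuousW => t; apply/cvgrPdist_lt => e e0.
  have /upathP/within_ray_continuousP/(_ (Num.max 0 t) e (max_ge0 t) e0) := ua.
  move=> [d d0 H]; apply/nbhs_ballP; exists d => //= x ts; apply: H => //.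
  apply: le_lt_trans ts.
  have [t0|t0] := leP 0 t; have [x0|x0] := leP 0 x => //.
  - by rewrite subr0 !ger0_norm//; lra.
  - by rewrite sub0r normrN ger0_norm// ltr0_norm; lra.
  - by rewrite subrr normr0.
pose c : cumulative R R := HB.pack f (isCumulative.Build R _ R f f_nd f_rc).
by exists c.
Qed.

Definition path_integral a h t :=
  Rintegral (lebesgue_stieltjes_measure (cumulative_of a)) [set` `]0, t]] h.

Section Bounds.
Variables a h : R -> R.
Hypotheses (ua : upath a) (nda : ray_nondecreasing a) (uh : upath h).
Local Notation mu := (lebesgue_stieltjes_measure (cumulative_of a)).

Let mu_itv s t : 0 <= s -> s <= t ->
  (mu `]s, t] = (a t - a s)%:E)%classic.
Proof.
move=> s0 st; rewrite /lebesgue_stieltjes_measure/= /measure_extension/=.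
rewrite measurable_mu_extE/=; last exact: is_ocitv.
rewrite wlength_itv_bnd// !cumulative_ofE//.
by rewrite !max_r// (le_trans s0).
Qed.

Let integrable_itv g s t : upath g -> 0 <= s -> s <= t ->
  mu.-integrable `]s, t] (EFin \o g).
Proof.
move=> ug s0 st; have [K hK] := upath_bounded t ug.
apply: measurable_bounded_integrable.
- exact: measurable_itv.
- by rewrite [X in (X < _)%E](mu_itv s0 st) ltry.
- apply: (@measurable_funS _ _ _ _ `[0, t]%classic) => //.
  + by move=> u /=; rewrite !in_itv/= => /andP[su ->]; rewrite (le_trans s0 (ltW su)).
  + apply: subspace_continuous_measurable_fun => //.
    exact: upath_within.
- exists K; split; first by rewrite num_real.
  move=> M KM u /=; rewrite in_itv/= => /andP[su ut].
  by apply: le_trans (ltW KM); apply: hK => //; rewrite (le_trans s0 (ltW su)).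
Qed.

(** Apart from the value 0 at time 0, every later property of the integral (continuity,
    monotonicity, first-order expansion, Riemann sums) is deduced from this two-sided bound. *)
Lemma path_integral_bounds s t lo hi : 0 <= s -> s <= t ->
  (forall u, s <= u -> u <= t -> lo <= h u <= hi) ->
  lo * (a t - a s) <= path_integral a h t - path_integral a h s
    <= hi * (a t - a s).
Proof.
move=> s0 st lohi.
have disj : [disjoint `]0%R, s]%classic & `]s, t]%classic].
  apply/disj_setPS => u [] /=; rewrite !in_itv/= => /andP[_ us] /andP[su _].
  by move: (lt_le_trans su us); rewrite ltxx.
have U : `]0, t]%classic = `]0, s]%classic `|` `]s, t]%classic.
  apply/seteqP; split=> u /=; rewrite !in_itv/=.
    by move=> /andP[u0 ut]; case: (leP u s) => us; [left|right]; rewrite ?u0 ?us.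
  by case=> /andP[u1 u2]; rewrite ?u1 ?u2 ?(le_trans u2)// (le_lt_trans s0).
rewrite /path_integral U Rintegral_setU//; last first.
  by rewrite -U; apply: integrable_itv => //; rewrite (le_trans s0).
rewrite addrAC subrr add0r.
have cstE c : c * (a t - a s) = \int[mu]_(u in `]s, t]) c.
  rewrite Rintegral_cst//; congr (_ * _).
  by rewrite [X in fine X](mu_itv s0 st).
rewrite !cstE; apply/andP; split; apply: le_Rintegral => //.
- by apply: integrable_itv => //; exact: upath_cst.
- exact: integrable_itv.
- by move=> u /=; rewrite in_itv/= => /andP[/ltW su ut]; have /andP[] := lohi _ su ut.
- exact: integrable_itv.
- by apply: integrable_itv => //; exact: upath_cst.
- by move=> u /=; rewrite in_itv/= => /andP[/ltW su ut]; have /andP[] := lohi _ su ut.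
Qed.

End Bounds.

End Stieltjes.

(** * Expectation and martingales *)

Section Expectation.
Context {d : measure_display} {T : measurableType d} {R : realType}.
Variable P : probability T R.
Implicit Types (f g : T -> R) (A B : set T) (G : set (set T)).

Definition integrable_rv f := P.-integrable setT (EFin \o f).
Definition expect f := Rintegral P setT f.
Local Notation integ := integrable_rv.
Local Notation "''E' f" := (expect f) (at level 10, f at level 8).

Lemma integ_measurable f : integ f -> measurable_fun setT f.
Proof. by move/measurable_int/measurable_EFinP. Qed.

Lemma bounded_set_range f K : (forall w, `|f w| <= K) -> [bounded f w | w in [set: T]].
Proof.
move=> fK; exists K; split; first by rewrite num_real.
by move=> M KM w _ /=; apply: le_trans (ltW KM).
Qed.

Lemma integ_bounded K f : measurable_fun setT f -> (forall w, `|f w| <= K) -> integ f.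
Proof.
move=> mf fK; apply: measurable_bounded_integrable => //.
  by rewrite [X in (X < _)%E]probability_setT ltry.
exact: bounded_set_range fK.
Qed.

Lemma integ_cst c : integ (fun=> c).
Proof. by apply: (@integ_bounded `|c|). Qed.

Lemma integD f g : integ f -> integ g -> integ (fun w => f w + g w).
Proof.
move=> If Ig; rewrite /integrable_rv.
by apply: eq_integrable (integrableD measurableT If Ig) => // w _ /=; rewrite EFinD.
Qed.

Lemma integB f g : integ f -> integ g -> integ (fun w => f w - g w).
Proof.
move=> If Ig; rewrite /integrable_rv.
by apply: eq_integrable (integrableB measurableT If Ig) => // w _ /=; rewrite EFinB.
Qed.

Lemma integM K f g : measurable_fun setT f -> (forall w, `|f w| <= K) -> integ g ->
  integ (fun w => f w * g w).
Proof.
move=> mf fK Ig; rewrite /integrable_rv.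
have := integrableMr measurableT mf (bounded_set_range fK) Ig.
by apply: eq_integrable => // w _ /=; rewrite EFinM.
Qed.

Lemma integ_norm f : integ f -> integ (fun w => `|f w|).
Proof. by move=> If; apply: eq_integrable (integrable_norm If). Qed.

Lemma integ_sum (I : Type) (r : seq I) (p : pred I) (f : I -> T -> R) :
  (forall i, integ (f i)) -> integ (fun w => \sum_(i <- r | p i) f i w).
Proof.
move=> If; elim: r => [|i r ih].
  by under eq_fun do rewrite big_nil; exact: integ_cst.
under eq_fun do rewrite big_cons.
by case: (p i) => //; exact: integD.
Qed.

Lemma indicM_le1 A w : `|\1_A w : R| <= 1.
Proof. by rewrite indicE; case: (_ \in _); rewrite ?normr1// normr0. Qed.

Lemma integ_indic f A : integ f -> measurable A -> integ (fun w => f w * \1_A w).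
Proof.
move=> If mA; under eq_fun do rewrite mulrC.
by apply: integM If => //; exact: indicM_le1.
Qed.

Lemma eq_expect f g : (forall w, f w = g w) -> 'E f = 'E g.
Proof. by move=> fg; rewrite (_ : f = g)//; apply/funext. Qed.

Lemma expectD f g : integ f -> integ g -> 'E (fun w => f w + g w) = 'E f + 'E g.
Proof. by move=> *; exact: RintegralD. Qed.

Lemma expectB f g : integ f -> integ g -> 'E (fun w => f w - g w) = 'E f - 'E g.
Proof. by move=> *; exact: RintegralB. Qed.

Lemma expectZ f c : integ f -> 'E (fun w => c * f w) = c * 'E f.
Proof. by move=> *; exact: RintegralZl. Qed.

Lemma expect_cst c : 'E (fun=> c) = c.
Proof.
by rewrite /expect Rintegral_cst// [X in fine X]probability_setT mulr1.
Qed.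

Lemma expect_sum (I : Type) (r : seq I) (p : pred I) (f : I -> T -> R) :
  (forall i, integ (f i)) ->
  'E (fun w => \sum_(i <- r | p i) f i w) = \sum_(i <- r | p i) 'E (f i).
Proof.
move=> If; elim: r => [|i r ih].
  by rewrite big_nil -[RHS](expect_cst 0); apply: eq_expect => w; rewrite big_nil.
rewrite big_cons -ih; case: ifP => pi; last first.
  by apply: eq_expect => w; rewrite big_cons pi.
rewrite -expectD//; last exact: integ_sum.
by apply: eq_expect => w; rewrite big_cons pi.
Qed.

Lemma le_expect f g : integ f -> integ g -> (forall w, f w <= g w) -> 'E f <= 'E g.
Proof. by move=> If Ig fg; apply: le_Rintegral => // w _; exact: fg. Qed.

Lemma le_norm_expect f : integ f -> `|'E f| <= 'E (fun w => `|f w|).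
Proof. by move=> If; exact: le_normr_Rintegral. Qed.

Lemma expect_dct_ae (f : nat -> T -> R) f0 g :
  (forall n, measurable_fun setT (f n)) -> measurable_fun setT f0 -> integ g ->
  (forall n w, `|f n w| <= g w) ->
  {ae P, forall w, f n w @[n --> \oo] --> f0 w} ->
  integ f0 /\ 'E (f n) @[n --> \oo] --> 'E f0.
Proof.
move=> mf mf0 Ig fg ff.
have [|||||I0 _ H] := @dominated_convergence _ T R P setT measurableT
    (fun n => EFin \o f n) (EFin \o f0) (EFin \o g).
- by move=> n; exact/measurable_EFinP.
- exact/measurable_EFinP.
- by apply: filterS ff => w /= ffw _; apply: cvg_EFin; [exact: nearW|exact: ffw].
- exact: Ig.
- by apply: aeW => w /= k _; rewrite lee_fin.
split=> //; apply: fine_cvg; rewrite fineK//.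
exact: (integrable_fin_num measurableT I0).
Qed.

Lemma expect_dct (f : nat -> T -> R) f0 g :
  (forall n, measurable_fun setT (f n)) -> integ g ->
  (forall n w, `|f n w| <= g w) -> (forall w, f n w @[n --> \oo] --> f0 w) ->
  integ f0 /\ 'E (f n) @[n --> \oo] --> 'E f0.
Proof.
move=> mf Ig fg ff; apply: expect_dct_ae fg _ => //; last by apply: aeW.
by apply: (measurable_fun_cvg mf) => w _; exact: ff.
Qed.

Lemma ae_eq_expect f g : integ f -> integ g -> {ae P, forall w, f w = g w} ->
  'E f = 'E g.
Proof.
move=> If Ig fg; congr fine; apply: ae_eq_integral => //.
- by move/measurable_int : If.
- by move/measurable_int : Ig.
- by apply: filterS fg => w /= ->.
Qed.

Lemma expect_eq0_ae f : integ f -> (forall w, 0 <= f w) -> 'E f = 0 ->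
  {ae P, forall w, f w = 0}.
Proof.
move=> If f0 Ef; have mf := measurable_int _ If.
have fin := integrable_fin_num measurableT If.
have : (\int[P]_w `|(EFin \o f) w| = 0)%E.
  under eq_integral do rewrite /= ger0_norm//.
  by rewrite -[LHS]fineK// -/(Rintegral P setT f) -/(expect f) Ef.
move/(ae_eq_integral_abs P measurableT mf).
by apply: filterS => w /(_ I)[].
Qed.

Lemma integral_expect f B : integ f -> measurable B ->
  (\int[P]_(w in B) (f w)%:E = ('E (fun w => f w * \1_B w))%:E)%E.
Proof.
move=> If mB; rewrite /expect /Rintegral fineK; last first.
  exact: (integrable_fin_num measurableT (integ_indic If mB)).
rewrite [LHS]integral_mkcond; apply: eq_integral => w _ /=.
rewrite patchE indicE; case: ifPn => wB; first by rewrite mulr1.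
by rewrite mulr0.
Qed.

Section SubSigmaAlgebra.
Variable G : set (set T).
Hypothesis sG : sigma_algebra setT G.
Local Notation GT := (g_sigma_algebraType G).

(** Reading [G] as the measurable sets of the type [GT] makes the closure properties of measurable
    sets and functions available for [G]. *)
Lemma sub_measurableE A : G A = (measurable (A : set GT)).
Proof. by rewrite measurable_g_measurableTypeE. Qed.

Lemma measurable_wrtP f :
  measurable_wrt G f <-> measurable_fun setT (f : GT -> R).
Proof.
split=> [mf _ B mB|mf B mB].
  by rewrite setTI -sub_measurableE; exact: mf.
by rewrite sub_measurableE -[X in measurable X]setTI; exact: mf.
Qed.

Lemma measurable_wrt_cst (c : R) : measurable_wrt G (fun=> c).
Proof. by apply/measurable_wrtP. Qed.

Lemma measurable_wrtD f g : measurable_wrt G f -> measurable_wrt G g ->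
  measurable_wrt G (fun w => f w + g w).
Proof.
move=> /measurable_wrtP mf /measurable_wrtP mg; apply/measurable_wrtP.
exact: measurable_funD.
Qed.

Lemma measurable_wrtM f g : measurable_wrt G f -> measurable_wrt G g ->
  measurable_wrt G (fun w => f w * g w).
Proof.
move=> /measurable_wrtP mf /measurable_wrtP mg; apply/measurable_wrtP.
exact: measurable_funM.
Qed.

Lemma measurable_wrt_comp (k : R -> R) f : measurable_fun setT k -> measurable_wrt G f ->
  measurable_wrt G (fun w => k (f w)).
Proof.
move=> mk /measurable_wrtP mf; apply/measurable_wrtP.
exact: measurableT_comp.
Qed.

Lemma measurable_wrtN f : measurable_wrt G f -> measurable_wrt G (fun w => - f w).
Proof. by apply: (measurable_wrt_comp (k := fun x => - x)); exact: oppr_measurable. Qed.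

Lemma measurable_wrtB f g : measurable_wrt G f -> measurable_wrt G g ->
  measurable_wrt G (fun w => f w - g w).
Proof. by move=> mf mg; apply: measurable_wrtD => //; exact: measurable_wrtN. Qed.

Lemma measurable_wrtX f n : measurable_wrt G f -> measurable_wrt G (fun w => f w ^+ n).
Proof.
by move=> mf; apply: (measurable_wrt_comp (k := fun x => x ^+ n)) => //; exact: exprn_measurable.
Qed.

Lemma measurable_wrt_sum (I : Type) (r : seq I) (p : pred I) (f : I -> T -> R) :
  (forall i, p i -> measurable_wrt G (f i)) ->
  measurable_wrt G (fun w => \sum_(i <- r | p i) f i w).
Proof.
move=> If; elim: r => [|i r ih].
  by under eq_fun do rewrite big_nil; exact: measurable_wrt_cst.
under eq_fun do rewrite big_cons.
by case: (boolP (p i)) => // pi; apply: measurable_wrtD => //; exact: If.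
Qed.

Lemma measurable_wrt_indic A : G A -> measurable_wrt G (\1_A : T -> R).
Proof. by rewrite sub_measurableE => mA; apply/measurable_wrtP. Qed.

Lemma measurable_wrt_cvg (f : nat -> T -> R) g : (forall n, measurable_wrt G (f n)) ->
  (forall w, f n w @[n --> \oo] --> g w) -> measurable_wrt G g.
Proof.
move=> mf fg; apply/measurable_wrtP.
apply: (@measurable_fun_cvg _ GT R setT f) => [n|w _]; last exact: fg.
exact/measurable_wrtP.
Qed.

Lemma sigma_ler f g : measurable_wrt G f -> measurable_wrt G g ->
  G [set w | f w <= g w].
Proof.
move=> /measurable_wrtP mf /measurable_wrtP mg.
rewrite sub_measurableE; have := measurable_fun_ler mf mg.
by move=> /(_ measurableT [set true] I); rewrite setTI.
Qed.

Lemma sigma_setI A B : G A -> G B -> G (A `&` B).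
Proof. by rewrite !sub_measurableE; exact: measurableI. Qed.

Lemma sigma_setC A : G A -> G (~` A).
Proof. by rewrite !sub_measurableE; exact: measurableC. Qed.

Lemma sigma_bigcup (A : nat -> set T) : (forall n, G (A n)) -> G (\bigcup_n A n).
Proof. by move=> GA; rewrite sub_measurableE; apply: bigcup_measurable => n _; rewrite -sub_measurableE. Qed.

Lemma sigma_bigcap (A : nat -> set T) : (forall n, G (A n)) -> G (\bigcap_n A n).
Proof. by move=> GA; rewrite sub_measurableE; apply: bigcap_measurable => // n _; rewrite -sub_measurableE. Qed.

Lemma sigma_setT : G setT.
Proof. by rewrite sub_measurableE. Qed.

Lemma measurable_wrt_measurable f : G `<=` measurable -> measurable_wrt G f -> measurable_fun setT f.
Proof. by move=> GM mf _ B mB; rewrite setTI; apply: GM; exact: mf. Qed.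

End SubSigmaAlgebra.
End Expectation.

(** * Martingales and variables of zero conditional expectation *)

Section Martingales.
Context {d : measure_display} {T : measurableType d} {R : realType}.
Variable P : probability T R.
Variable F : R -> set (set T).
Hypothesis filtF : filtration F.
Local Notation integ := (integrable_rv P).
Local Notation "''E' f" := (expect P f) (at level 10, f at level 8).

Lemma filt_sigma t : 0 <= t -> sigma_algebra setT (F t).
Proof. by move=> t0; have [/(_ t t0)[]] := filtF. Qed.

Lemma filt_measurable t : 0 <= t -> F t `<=` measurable.
Proof. by move=> t0; have [/(_ t t0)[]] := filtF. Qed.

Lemma filt_sub s t : 0 <= s -> s <= t -> F s `<=` F t.
Proof. by move=> s0 st; have [_] := filtF; exact. Qed.

Lemma adapted_later X s t : adapted F X -> 0 <= s -> s <= t -> measurable_wrt (F t) (X s).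
Proof. by move=> aX s0 st B mB; apply: (filt_sub s0 st); exact: aX. Qed.

Lemma adapted_measurable X t : adapted F X -> 0 <= t -> measurable_fun setT (X t).
Proof. by move=> aX t0; apply: (measurable_wrt_measurable (filt_measurable t0)); exact: aX. Qed.

(** Expectations against indicators replace conditional expectations: limits and stopping are
    handled in this form. *)
Lemma martingaleP X : martingale P F X <->
  [/\ forall t, 0 <= t -> integ (X t), adapted F X &
      forall s t B, 0 <= s -> s <= t -> F s B ->
        'E (fun w => X s w * \1_B w) = 'E (fun w => X t w * \1_B w)].
Proof.
split=> [mX|[IX aX EX] s t s0 st].
  have IX t : 0 <= t -> integ (X t) by move=> t0; have [] := mX t t t0 (lexx _).
  split=> // [t t0|s t B s0 st FB]; first by have [] := mX t t t0 (lexx _).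
  have t0 := le_trans s0 st.
  have [_ _ _ /(_ B FB)] := mX s t s0 st.
  by rewrite !integral_expect//; try exact: IX; try exact: filt_measurable FB; case.
have t0 := le_trans s0 st.
split; [exact: IX|exact: IX|exact: aX|move=> B FB].
have mB : measurable B by exact: filt_measurable FB.
rewrite (integral_expect (IX _ s0) mB) (integral_expect (IX _ t0) mB).
by rewrite (EX _ _ _ s0 st FB).
Qed.

(** This is [E[f | G] = 0]; [f] itself is in general not [G]-measurable. *)
Definition centered (G : set (set T)) (f : T -> R) :=
  integ f /\ forall B, G B -> 'E (fun w => f w * \1_B w) = 0.

Section Centered.
Variable G : set (set T).
Hypotheses (sG : sigma_algebra setT G) (GM : G `<=` measurable).

Lemma centeredD f g : centered G f -> centered G g -> centered G (fun w => f w + g w).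
Proof.
move=> [If Hf] [Ig Hg]; split; first exact: integD.
move=> B GB; have mB := GM GB.
under eq_fun do rewrite mulrDl.
by rewrite expectD ?Hf ?Hg ?addr0//; exact: integ_indic.
Qed.

Lemma centeredZ c f : centered G f -> centered G (fun w => c * f w).
Proof.
move=> [If Hf]; split.
  by apply: (@integM _ _ _ _ `|c|).
move=> B GB; have mB := GM GB.
under eq_fun do rewrite -mulrA.
by rewrite expectZ ?Hf ?mulr0//; exact: integ_indic.
Qed.

(** The sum counts the integer levels between 1 and [n] below [y], that is, the minimum of [n] and
    the integer part of [y]. *)
Lemma level_count (y : R) n : 0 <= y ->
  let S := \sum_(j < n) (j.+1%:R <= y)%R%:R : R in
  (n%:R <= y /\ S = n%:R) \/ (y < n%:R /\ S <= y /\ y < S + 1).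
Proof.
move=> y0 /=; elim: n => [|n ih]; first by left; rewrite big_ord0.
rewrite big_ord_recr/=; have [ny|yn] := leP n.+1%:R y.
  left; split=> //; case: ih => [[_ ->]|[yn _]]; first by rewrite -natr1.
  by move: (ny); rewrite -natr1 => ny'; exfalso; lra.
right; split=> //; rewrite /= addr0.
by case: ih => [[nle ->]|[_ //]]; split=> //; rewrite natr1.
Qed.

(** Layer-cake approximation: [V] is within [n.+1%:R^-1], uniformly, of the average of the
    indicators of its level sets [L n j]. These sets are in [G], so multiplying [f] by their
    indicators keeps its expectation over [B] equal to 0. *)
Let centeredM01 V f : measurable_wrt G V -> (forall w, 0 <= V w <= 1) ->
  centered G f -> centered G (fun w => V w * f w).
Proof.
move=> mV V01 [If Hf].
have V1 w : `|V w| <= 1 by have /andP[V0 V1] := V01 w; rewrite ger0_norm.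
have mVT := measurable_wrt_measurable GM mV.
split; first exact: (integM mVT V1).
move=> B GB; have mB := GM GB.
have If1 := integ_indic If mB.
pose L n j := [set w | (j.+1%:R / n.+1%:R : R) <= V w].
have GL n j : G (L n j) by apply: (sigma_ler sG) => //; exact: (measurable_wrt_cst sG).
pose Vn n w := n.+1%:R^-1 * \sum_(j < n.+1) \1_(L n j) w : R.
have VVn n w : `|V w - Vn n w| <= n.+1%:R^-1.
  have /andP[V0 V1'] := V01 w.
  have nV0 : 0 <= n.+1%:R * V w by rewrite mulr_ge0.
  have n0 : 0 < n.+1%:R :> R by [].
  have SE : \sum_(j < n.+1) \1_(L n j) w = \sum_(j < n.+1) (j.+1%:R <= n.+1%:R * V w)%R%:R :> R.
    apply: eq_bigr => j _; rewrite indicE; congr (nat_of_bool _)%:R.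
    by apply/idP/idP; rewrite inE /L/= ler_pdivrMr// mulrC.
  have -> : V w - Vn n w = n.+1%:R^-1 * (n.+1%:R * V w - \sum_(j < n.+1) \1_(L n j) w).
    by rewrite /Vn mulrBr mulKf// gt_eqF.
  rewrite normrM ger0_norm ?invr_ge0// ler_piMr ?invr_ge0// SE.
  have nV1 : n.+1%:R * V w <= n.+1%:R by rewrite ler_piMr.
  have [[h1 ->]|[_ [h1 h2]]] := level_count n.+1 nV0.
    by rewrite ler_norml; apply/andP; split; lra.
  by rewrite ler_norml; apply/andP; split; lra.
have mVn n : measurable_wrt G (Vn n).
  by apply: (measurable_wrtM sG); [exact: (measurable_wrt_cst sG)|apply: (measurable_wrt_sum sG) => j _; exact: (measurable_wrt_indic sG)].
have EVn n : 'E (fun w => Vn n w * f w * \1_B w) = 0.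
  have E1 j : 'E (fun w => f w * \1_B w * \1_(L n j) w) = 0.
    rewrite -[RHS](Hf (B `&` L n j)); last exact: (sigma_setI sG).
    by apply: eq_expect => w; rewrite indicI/= mulrA.
  transitivity ('E (fun w => n.+1%:R^-1 * \sum_(j < n.+1) (f w * \1_B w * \1_(L n j) w))).
    apply: eq_expect => w; rewrite /Vn -!mulrA; congr (_ * _).
    by rewrite mulrC mulr_sumr.
  rewrite expectZ; last by apply: integ_sum => j; apply: integ_indic => //; exact: GM.
  rewrite expect_sum; last by move=> j; apply: integ_indic => //; exact: GM.
  by rewrite big1 ?mulr0// => j _.
have bound n : `|'E (fun w => V w * f w * \1_B w)| <= n.+1%:R^-1 * 'E (fun w => `|f w|).
  have IV : integ (fun w => V w * f w * \1_B w).
    by apply: integ_indic => //; exact: integM mVT V1 If.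
  have IVn : integ (fun w => Vn n w * f w * \1_B w).
    apply: integ_indic => //; apply: (@integM _ _ _ _ 2) => //.
      exact: measurable_wrt_measurable (mVn n).
    move=> w; have -> : Vn n w = V w - (V w - Vn n w) by ring.
    apply: le_trans (ler_normB _ _) _; rewrite -[leRHS]/(1 + 1).
    by rewrite lerD ?V1// (le_trans (VVn n w))// invf_le1// ler1n.
  rewrite -[X in `|X|]subr0 -(EVn n) -expectB//.
  apply: le_trans (le_norm_expect (integB IV IVn)) _.
  rewrite -expectZ; last exact: integ_norm.
  apply: le_expect; first exact/integ_norm/integB.
    by apply: (@integM _ _ _ _ `|n.+1%:R^-1|) => //; exact: integ_norm.
  move=> w; rewrite -!mulrBl -mulrA normrM ler_pM// normrM.
  by rewrite ler_piMr// indicM_le1.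
apply/normr0_eq0/eqP; rewrite eq_le normr_ge0 andbT.
apply/ler_addgt0Pl => e e0; rewrite addr0.
pose EF := 'E (fun w => `|f w|).
have EF0 : 0 <= EF by apply: Rintegral_ge0.
(* For this index [n.+1%:R > EF / e], so the bound [EF / n.+1%:R] is at most [e]. *)
apply: le_trans (bound (Num.truncn (EF / e))) _.
rewrite ler_pdivrMl// -ler_pdivrMr//.
by rewrite ltW// truncnS_gt.
Qed.

(** Affine reduction to values in [[0, 1]]: [V = 2 C' W - C']. *)
Lemma centeredM C V f : measurable_wrt G V -> (forall w, `|V w| <= C) ->
  centered G f -> centered G (fun w => V w * f w).
Proof.
move=> mV VC cf.
(* The added 1 keeps the divisor [2 * C'] positive when [C = 0]. *)
pose C' := C + 1; have C'0 w : `|V w| < C' by rewrite (le_lt_trans (VC w))// ltrDl.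
have Cp : 0 < C' by apply: le_lt_trans (C'0 point).
pose W w := (V w + C') / (2 * C').
have C2 : 0 < 2 * C' by rewrite mulr_gt0.
have mW : measurable_wrt G W.
  by apply: (measurable_wrtM sG); [apply: (measurable_wrtD sG) => //|]; exact: (measurable_wrt_cst sG).
have W01 w : 0 <= W w <= 1.
  have := C'0 w; rewrite ltr_norml => /andP[h1 h2].
  by rewrite /W divr_ge0 ?ler_pdivrMr//=; lra.
have := centeredD (centeredZ (2 * C') (centeredM01 mW W01 cf)) (centeredZ (- C') cf).
congr (centered _ _); apply/funext => w; rewrite /W.
by field; rewrite gt_eqF.
Qed.

End Centered.

Lemma centered_increment X s t : martingale P F X -> 0 <= s -> s <= t ->
  centered (F s) (fun w => X t w - X s w).
Proof.
move=> /martingaleP[IX aX EX] s0 st; have t0 := le_trans s0 st.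
split; first by apply: integB; exact: IX.
move=> B FB; have mB := filt_measurable s0 FB.
under eq_fun do rewrite mulrBl.
by rewrite expectB ?(EX s t)// ?subrr//; apply: integ_indic => //; exact: IX.
Qed.

End Martingales.

Lemma ler_sqr_norm (R : realType) (a c : R) : `|a| <= c -> a ^+ 2 <= c ^+ 2.
Proof.
move=> ac; rewrite -real_normK ?num_real// ler_sqr ?nnegrE//.
exact: le_trans ac.
Qed.

(** * Second moment of the sum of squared increments of a bounded martingale *)

Section Criterion.
Context {d : measure_display} {T : measurableType d} {R : realType}.
Variable P : probability T R.
Variable F : R -> set (set T).
Hypothesis filtF : filtration F.
Local Notation integ := (integrable_rv P).
Local Notation "''E' f" := (expect P f) (at level 10, f at level 8).

Definition square_sum (X : R -> T -> R) (u : nat -> R) n w : R :=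
  \sum_(i < n) (X (u i.+1) w - X (u i) w) ^+ 2.

Section SquareSum.
Variables (X : R -> T -> R) (K : R).
Hypotheses (mX : martingale P F X) (XK : forall t w, 0 <= t -> `|X t w| <= K).
Variable u : nat -> R.
Hypotheses (u0 : forall i, 0 <= u i) (u_nd : forall i, u i <= u i.+1).
Local Notation S := (square_sum X u).

Let aX : adapted F X. Proof. by have /(martingaleP P filtF)[] := mX. Qed.

Let u_mono i j : (i <= j)%N -> u i <= u j.
Proof.
move=> ij; rewrite -(subnK ij) addnC; elim: (j - i)%N => [|k ih]; first by rewrite addn0.
by rewrite addnS (le_trans ih).
Qed.

Let K0 : 0 <= K. Proof. by apply: le_trans (XK point (u0 0)). Qed.

Lemma square_sum_ge0 n w : 0 <= S n w.
Proof. by apply: sumr_ge0 => i _; exact: sqr_ge0. Qed.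

Lemma square_sum_mw n t : u n <= t -> measurable_wrt (F t) (S n).
Proof.
move=> unt; have sF := filt_sigma filtF (le_trans (u0 n) unt).
apply: (measurable_wrt_sum sF) => i _; apply: (measurable_wrtX sF); apply: (measurable_wrtB sF).
  by apply: (adapted_later filtF) => //; rewrite (le_trans _ unt)// u_mono.
by apply: (adapted_later filtF) => //; rewrite (le_trans _ unt)// u_mono// ltnW.
Qed.

Let increment_sqr i w : (X (u i.+1) w - X (u i) w) ^+ 2 <= 4 * K ^+ 2.
Proof.
have := XK w (u0 i.+1); have := XK w (u0 i).
rewrite !ler_norml => /andP[a b] /andP[a' b'].
have -> : 4 * K ^+ 2 = (2 * K) ^+ 2 by ring.
by apply: ler_sqr_norm; rewrite ler_norml; apply/andP; split; lra.
Qed.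

Lemma square_sum_bounded n w : `|S n w| <= n%:R * (4 * K ^+ 2).
Proof.
rewrite ger0_norm ?square_sum_ge0//; apply: le_trans.
  by apply: ler_sum => i _; exact: increment_sqr.
by rewrite sumr_const card_ord [leRHS]mulr_natl.
Qed.

(* The expectation of phi n does not increase with n, while
   2 phi n >= S n ^+ 2 - 36 K ^+ 4. *)
Let phi n w := S n w ^+ 2 - 2 * S n w * X (u n) w ^+ 2 - 4 * K ^+ 2 * S n w.

Let bounded_integ f C t : 0 <= t -> measurable_wrt (F t) f ->
  (forall w, `|f w| <= C) -> integ f.
Proof.
move=> t0 mf; apply: integ_bounded.
exact: (measurable_wrt_measurable (filt_measurable filtF t0) mf).
Qed.

Let Xsqr i w : X (u i) w ^+ 2 <= K ^+ 2.
Proof. by apply: ler_sqr_norm; exact: XK. Qed.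

Let phi_integ n : integ (phi n).
Proof.
have sF := filt_sigma filtF (u0 n).
have mS := square_sum_mw (lexx (u n)).
have mXu := aX (u0 n).
pose C := n%:R * (4 * K ^+ 2).
apply: (@bounded_integ _ (C ^+ 2 + 2 * C * K ^+ 2 + 4 * K ^+ 2 * C) (u n)) => //.
  apply: (measurable_wrtB sF); last by apply: (measurable_wrtM sF) => //; exact: (measurable_wrt_cst sF).
  apply: (measurable_wrtB sF); first exact: (measurable_wrtX sF).
  apply: (measurable_wrtM sF); last exact: (measurable_wrtX sF).
  by apply: (measurable_wrtM sF) => //; exact: (measurable_wrt_cst sF).
move=> w; have S0 := square_sum_ge0 n w.
have := square_sum_bounded n w; rewrite ger0_norm// -/C => SC.
have C0 : 0 <= C by apply: le_trans SC.
rewrite /phi; move: (Xsqr n w) (sqr_ge0 (X (u n) w)) (sqr_ge0 K).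
move: S0 SC; rewrite -/(S n w).
move: (X (u n) w ^+ 2) (K ^+ 2) (S n w) => q k r S0 SC qk q0 k0.
apply: le_trans (ler_normB _ _) _; apply: lerD.
  apply: le_trans (ler_normB _ _) _; apply: lerD.
    by rewrite ger0_norm ?sqr_ge0// ler_sqr ?nnegrE.
  rewrite ger0_norm ?mulr_ge0//.
  by apply: ler_pM => //; rewrite ?mulr_ge0// ler_pM2l.
rewrite ger0_norm ?mulr_ge0//; apply: ler_wpM2l => //.
by rewrite mulr_ge0.
Qed.

(** Pathwise, [phi n.+1 <= phi n - 4 V D], where [D] is the next increment of [X]: the difference of
    the two sides is [D^2 (4 K^2 - D^2) + 2 D^2 X^2], with [X] taken at [u n.+1], and [|D| <= 2 K].
    The factor [V] is known at time [u n], so [V D] has expectation 0. *)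
Let phi_step n : 'E (phi n.+1) <= 'E (phi n).
Proof.
have sF := filt_sigma filtF (u0 n).
have FM := filt_measurable filtF (u0 n).
pose D w := X (u n.+1) w - X (u n) w.
pose V w := S n w * X (u n) w.
have [IV EV] : centered P (F (u n)) (fun w => V w * D w).
  apply: (@centeredM _ _ _ _ _ sF FM (n%:R * (4 * K ^+ 2) * K)).
  - apply: (measurable_wrtM sF); first exact: square_sum_mw.
    exact: aX.
  - move=> w; rewrite normrM ler_pM//; first exact: square_sum_bounded.
    exact: XK.
  - exact: (centered_increment filtF mX).
have {}EV : 'E (fun w => V w * D w) = 0.
  rewrite -[RHS](EV setT); last exact: (sigma_setT sF).
  by apply: eq_expect => w; rewrite indicT mulr1.
have I4 : integ (fun w => (- 4) * (V w * D w)).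
  by apply: (@integM _ _ _ _ `|- 4|).
have : 'E (phi n.+1) <= 'E (fun w => phi n w + (- 4) * (V w * D w)).
  apply: le_expect => //; first exact: integD.
  move=> w; rewrite /phi /square_sum big_ord_recr/= -/(square_sum X u n w) /V /D.
  have := increment_sqr n w; have := sqr_ge0 (X (u n.+1) w).
  have := sqr_ge0 (X (u n.+1) w - X (u n) w).
  set s := square_sum _ _ _ _; set x := X (u n) w; set x' := X (u n.+1) w.
  move=> h0 h1 h2.
  rewrite -subr_ge0.
  have -> : s ^+ 2 - 2 * s * x ^+ 2 - 4 * K ^+ 2 * s + - 4 * (s * x * (x' - x)) -
     ((s + (x' - x) ^+ 2) ^+ 2 - 2 * (s + (x' - x) ^+ 2) * x' ^+ 2 -
      4 * K ^+ 2 * (s + (x' - x) ^+ 2)) =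
    (x' - x) ^+ 2 * (4 * K ^+ 2 - (x' - x) ^+ 2) + 2 * ((x' - x) ^+ 2 * x' ^+ 2) by ring.
  apply: addr_ge0; first by apply: mulr_ge0 => //; rewrite subr_ge0.
  by apply: mulr_ge0 => //; exact: mulr_ge0.
have /= -> := expectD (phi_integ n) I4.
by have /= -> := expectZ (- 4) IV; rewrite EV mulr0 addr0.
Qed.

(** The bound depends neither on [n] nor on the partition. Since [X^2 <= K^2],
    [2 phi n >= 2 S^2 - 12 K^2 S], and completing the square in [S^2 - 12 K^2 S] costs
    [(6 K^2)^2]. *)
Lemma expect_square_sum_sqr n : 'E (fun w => S n w ^+ 2) <= 36 * K ^+ 4.
Proof.
have phi_le0 : 'E (phi n) <= 0.
  elim: n => [|n ih]; last exact: le_trans (phi_step n) ih.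
  rewrite -[leRHS](expect_cst P 0) (@eq_expect _ _ _ _ (phi 0%N) (fun=> 0))// => w.
  by rewrite /phi /square_sum big_ord0; ring.
have IS : integ (fun w => S n w ^+ 2).
  apply: (@bounded_integ _ ((n%:R * (4 * K ^+ 2)) ^+ 2) (u n)) => //.
    exact: (measurable_wrtX (filt_sigma filtF (u0 n)) _ (square_sum_mw (lexx _))).
  by move=> w; rewrite normrX ler_sqr ?nnegrE ?mulr_ge0 ?sqr_ge0// square_sum_bounded.
apply: (@le_trans _ _ ('E (fun w => 2 * phi n w + 36 * K ^+ 4))).
  apply: le_expect => //.
    apply: integD; last exact: integ_cst.
    by apply: (@integM _ _ _ _ `|2|).
  move=> w; rewrite /phi; have := Xsqr n w; have := square_sum_ge0 n w.
  set s := square_sum _ _ _ _; set x := X (u n) w => s0 xK.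
  rewrite -subr_ge0.
  have -> : 2 * (s ^+ 2 - 2 * s * x ^+ 2 - 4 * K ^+ 2 * s) + 36 * K ^+ 4 - s ^+ 2 =
    (s - 6 * K ^+ 2) ^+ 2 + 4 * (s * (K ^+ 2 - x ^+ 2)) by ring.
  apply: addr_ge0; first exact: sqr_ge0.
  by apply: mulr_ge0 => //; apply: mulr_ge0 => //; rewrite subr_ge0.
rewrite expectD; [|by apply: (@integM _ _ _ _ `|2|)|exact: integ_cst].
by rewrite (expectZ 2 (phi_integ n)) expect_cst gerDr pmulr_rle0.
Qed.
End SquareSum.
End Criterion.

(** * A criterion for the martingale property *)

Definition dominated_by {R : realType} (K : R) (g e : R -> R -> R) :=
  forall s t, 0 <= s -> s <= t -> `|e s t| <= K * g s t.

(** [e = o(g)] as the mesh tends to 0, locally uniformly in time, on a single path; on a family of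
    paths [del] may vary with the path. *)
Definition negligible_to {R : realType} (g e : R -> R -> R) :=
  forall U eps, 0 < eps -> exists2 del, 0 < del & forall s t,
    0 <= s -> s <= t -> t <= U -> t - s < del -> `|e s t| <= eps * g s t.

Definition clock {T} {R : realType} (X v : R -> T -> R) w s t : R :=
  (X t w - X s w) ^+ 2 + (v t w - v s w).

Section MartingaleCriterion.
Context {d : measure_display} {T : measurableType d} {R : realType}.
Variable P : probability T R.
Variable F : R -> set (set T).
Hypothesis filtF : filtration F.
Local Notation integ := (integrable_rv P).
Local Notation "''E' f" := (expect P f) (at level 10, f at level 8).

Variables (K : R) (X Z v : R -> T -> R) (e : R -> R -> T -> R).
Hypotheses (mX : martingale P F X) (XK : forall t w, 0 <= t -> `|X t w| <= K).
Hypotheses (aZ : adapted F Z) (ZK : forall t w, 0 <= t -> `|Z t w| <= K).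
Hypotheses (av : adapted F v) (vK : forall t w, 0 <= t -> `|v t w| <= K).
Hypothesis v_nd : forall w, ray_nondecreasing (v ^~ w).
Hypothesis Ze : forall s t, 0 <= s -> s <= t ->
  centered P (F s) (fun w => Z t w - Z s w - e s t w).
Hypothesis eK : forall w, dominated_by K (clock X v w) (fun s t => e s t w).
Hypothesis e_small : forall w, negligible_to (clock X v w) (fun s t => e s t w).

Let K0 : 0 <= K. Proof. by apply: le_trans (XK point (lexx 0)). Qed.

Let IZ t : 0 <= t -> integ (Z t).
Proof.
move=> t0; apply: (@integ_bounded _ _ _ _ K); first exact: (adapted_measurable filtF).
by move=> w; exact: ZK.
Qed.

Let Ie s t : 0 <= s -> s <= t -> integ (e s t).
Proof.
move=> s0 st; have [I _] := Ze s0 st.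
have := integB (integB (IZ (le_trans s0 st)) (IZ s0)) I.
by congr (integrable_rv _ _); apply/funext => w /=; ring.
Qed.

Section Grid.
Variables s t : R.
Hypotheses (s0 : 0 <= s) (st : s <= t).

Let grid n i := s + (t - s) * i%:R / n.+1%:R.

Let grid0 n : grid n 0 = s. Proof. by rewrite /grid mulr0 mul0r addr0. Qed.

Let gridn n : grid n n.+1 = t.
Proof. by rewrite /grid mulfK ?pnatr_eq0// addrC subrK. Qed.

Let grid_step n i : grid n i.+1 - grid n i = (t - s) / n.+1%:R.
Proof.
rewrite /grid; have -> : i.+1%:R = i%:R + 1 :> R by rewrite natr1.
by field; rewrite gt_eqF.
Qed.

Let grid_nd n i : grid n i <= grid n i.+1.
Proof. by rewrite -subr_ge0 grid_step divr_ge0// subr_ge0. Qed.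

Let grid_ge n i : s <= grid n i.
Proof. by elim: i => [|i ih]; [rewrite grid0|exact: le_trans (grid_nd n i)]. Qed.

Let grid_ge0 n i : 0 <= grid n i.
Proof. exact: le_trans (grid_ge n i). Qed.

Let grid_le n i : (i <= n.+1)%N -> grid n i <= t.
Proof.
move=> inn; rewrite /grid -lerBrDl -mulrA ler_piMr ?subr_ge0//.
by rewrite ler_pdivrMr// mul1r ler_nat.
Qed.

Let A n w := \sum_(i < n.+1) `|e (grid n i) (grid n i.+1) w|.
Let U n w := square_sum X (grid n) n.+1 w + (v t w - v s w).
(* The quotient A / U in a form that is visibly measurable; ln 0 = 0 makes it A,
   hence 0, when U = 0. *)
Let g n w := A n w * expR (- ln (U n w)).

Let sum_clock n w : \sum_(i < n.+1) clock X v w (grid n i) (grid n i.+1) = U n w.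
Proof.
rewrite /clock big_split/= /U; congr (_ + _).
rewrite -[in RHS](gridn n) -[in RHS](grid0 n).
by rewrite -(telescope_sumr (fun i => v (grid n i) w))// big_mkord.
Qed.

Let U_ge0 n w : 0 <= U n w.
Proof. by rewrite addr_ge0 ?square_sum_ge0// subr_ge0 v_nd. Qed.

Let A_ge0 n w : 0 <= A n w.
Proof. by apply: sumr_ge0 => i _. Qed.

Let A_le n w c : (forall i, (i < n.+1)%N -> `|e (grid n i) (grid n i.+1) w| <=
  c * clock X v w (grid n i) (grid n i.+1)) -> A n w <= c * U n w.
Proof. by move=> H; rewrite -sum_clock mulr_sumr; apply: ler_sum => i _; exact: H. Qed.

Let AK n w : A n w <= K * U n w.
Proof. by apply: A_le => i _; apply: eK; [exact: grid_ge0|exact: grid_nd]. Qed.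

Let gE n w : 0 < U n w -> g n w = A n w / U n w.
Proof. by move=> U0; rewrite /g expRN lnK. Qed.

Let U0_A0 n w : U n w = 0 -> A n w = 0.
Proof.
by move=> U0; apply/eqP; rewrite eq_le A_ge0 andbT; have := AK n w; rewrite U0 mulr0.
Qed.

Let AgU n w : A n w = g n w * U n w.
Proof.
have := U_ge0 n w; rewrite le_eqVlt => /predU1P[U0|U0].
  by rewrite -U0 mulr0 U0_A0.
by rewrite gE// divfK ?gt_eqF.
Qed.

Let g_ge0 n w : 0 <= g n w. Proof. by rewrite mulr_ge0// expR_ge0. Qed.

Let g_le n w c : 0 <= c -> A n w <= c * U n w -> g n w <= c.
Proof.
move=> c0 H; have := U_ge0 n w; rewrite le_eqVlt => /predU1P[U0|U0].
  by rewrite /g U0_A0 ?mul0r.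
by rewrite gE// ler_pdivrMr.
Qed.

(** Once the mesh is below the [del] of this path, every error is at most [eps] times its clock
    increment, so [A n <= eps * U n]. *)
Let g_cvg w : g n w @[n --> \oo] --> (0 : R).
Proof.
apply/cvgrPdist_le => eps eps0; have [del del0 H] := e_small w t eps0.
have lim : (t - s) / n.+1%:R @[n --> \oo] --> (0 : R).
  rewrite -[X in _ --> X](mulr0 (t - s)); apply: cvgM; first exact: cvg_cst.
  exact: cvg_harmonic.
move/cvgrPdist_lt: lim => /(_ _ del0) lim.
near=> n; rewrite sub0r normrN ger0_norm//; apply: g_le; first exact: ltW.
apply: A_le => i inn; apply: H => //; first exact: grid_le.
rewrite grid_step; have : `|0 - (t - s) / n.+1%:R| < del by near: n.
by rewrite sub0r normrN ger0_norm// divr_ge0// subr_ge0.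
Unshelve. all: by end_near. Qed.

Let mA n : measurable_fun setT (A n).
Proof.
apply: integ_measurable; apply: (integ_sum (P := P)) => i.
by apply: integ_norm; apply: Ie.
Qed.

Let mU n : measurable_fun setT (U n).
Proof.
have t0 := le_trans s0 st.
have sF := filt_sigma filtF t0.
apply: (measurable_wrt_measurable (filt_measurable filtF t0)); apply: (measurable_wrtD sF).
  by apply: (square_sum_mw filtF mX) => //; rewrite gridn.
apply: (measurable_wrtB sF); first exact: av.
exact: (adapted_later filtF).
Qed.

Let mg n : measurable_fun setT (g n).
Proof.
apply: measurable_funM => //; apply: measurableT_comp => //.
by apply: measurableT_comp => //; apply: measurableT_comp.
Qed.

Let gK n w : `|g n w| <= K.
Proof. by rewrite ger0_norm// g_le. Qed.

(** From [(a + b)^2 <= 2 a^2 + 2 b^2]: the squared sum of squares has mean at most [36 K^4], and the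
    increment of [v] is at most [2 K] in absolute value. *)
Let M := 72 * K ^+ 4 + 8 * K ^+ 2.

Let IU2 n : integ (fun w => U n w ^+ 2).
Proof.
apply: (@integ_bounded _ _ _ _ ((n.+1%:R * (4 * K ^+ 2) + (K + K)) ^+ 2)).
  exact: measurable_funX.
move=> w; rewrite ger0_norm ?sqr_ge0//; apply: ler_sqr_norm.
apply: le_trans (ler_normD _ _) _; apply: lerD; first exact: (square_sum_bounded XK).
by apply: le_trans (ler_normB _ _) _; rewrite lerD ?vK// (le_trans s0).
Qed.

Let IS2 n : integ (fun w => square_sum X (grid n) n.+1 w ^+ 2).
Proof.
have t0 := le_trans s0 st.
apply: (@integ_bounded _ _ _ _ ((n.+1%:R * (4 * K ^+ 2)) ^+ 2)).
  apply: measurable_funX; apply: (measurable_wrt_measurable (filt_measurable filtF t0)).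
  by apply: (square_sum_mw filtF mX) => //; rewrite gridn.
move=> w; rewrite ger0_norm ?sqr_ge0//; apply: ler_sqr_norm.
exact: (square_sum_bounded XK).
Qed.

Let EU2 n : 'E (fun w => U n w ^+ 2) <= M.
Proof.
apply: (@le_trans _ _
   ('E (fun w => 2 * (square_sum X (grid n) n.+1 w ^+ 2) + 8 * K ^+ 2))).
  apply: le_expect => //.
    by apply: integD; [apply: (@integM _ _ _ _ `|2|)|exact: integ_cst].
  move=> w; rewrite /U; set a := square_sum _ _ _ _; set b := v t w - v s w.
  have b4 : b ^+ 2 <= 4 * K ^+ 2.
    have -> : 4 * K ^+ 2 = (K + K) ^+ 2 by ring.
    apply: ler_sqr_norm; apply: le_trans (ler_normB _ _) _.
    by rewrite lerD ?vK// (le_trans s0).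
  rewrite -subr_ge0.
  have -> : 2 * a ^+ 2 + 8 * K ^+ 2 - (a + b) ^+ 2 =
    (a - b) ^+ 2 + 2 * (4 * K ^+ 2 - b ^+ 2) by ring.
  by apply: addr_ge0; [exact: sqr_ge0|apply: mulr_ge0 => //; rewrite subr_ge0].
have /= -> := expectD (integM (measurable_cst (2 : R)) (fun=> lexx `|2|) (IS2 n))
                      (integ_cst P (8 * K ^+ 2)).
have /= -> := expectZ 2 (IS2 n).
rewrite expect_cst /M lerD2r.
have -> : 72 * K ^+ 4 = 2 * (36 * K ^+ 4) by ring.
by rewrite ler_pM2l//; exact: (expect_square_sum_sqr filtF mX XK).
Qed.

Let IA n : integ (A n).
Proof. by apply: integ_sum => i; apply: integ_norm; apply: Ie. Qed.

(** Young's inequality applied to [A = g U]. For fixed [a] the first term vanishes as the grid is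
    refined; a large [a] then makes the second one small. *)
Let EA_le n a : 0 < a ->
  'E (A n) <= a * 'E (fun w => g n w ^+ 2) + a^-1 * M.
Proof.
move=> a0.
have Ig2 : integ (fun w => g n w ^+ 2).
  apply: (@integ_bounded _ _ _ _ (K ^+ 2)); first exact: measurable_funX.
  by move=> w; rewrite ger0_norm ?sqr_ge0//; apply: ler_sqr_norm.
apply: (@le_trans _ _ ('E (fun w => a * (g n w ^+ 2) + a^-1 * (U n w ^+ 2)))).
  apply: le_expect => //.
    by apply: integD; [apply: (@integM _ _ _ _ `|a|)|apply: (@integM _ _ _ _ `|a^-1|)].
  move=> w; rewrite AgU; set x := g n w; set y := U n w.
  have xy0 : 0 <= x * y := mulr_ge0 (g_ge0 n w) (U_ge0 n w).
  rewrite -subr_ge0.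
  have -> : a * x ^+ 2 + a^-1 * y ^+ 2 - x * y = a^-1 * (a * x - y) ^+ 2 + x * y.
    by field; rewrite gt_eqF.
  apply: addr_ge0 => //; apply: mulr_ge0; last exact: sqr_ge0.
  by rewrite invr_ge0 ltW.
have /= -> := expectD (integM (measurable_cst a) (fun=> lexx `|a|) Ig2)
                      (integM (measurable_cst a^-1) (fun=> lexx `|a^-1|) (IU2 n)).
have /= -> := expectZ a Ig2; have /= -> := expectZ a^-1 (IU2 n).
by rewrite lerD2l ler_pM2l ?invr_gt0.
Qed.

Let Eg_cvg : 'E (fun w => g n w ^+ 2) @[n --> \oo] --> (0 : R).
Proof.
rewrite -[X in _ --> X](expect_cst P 0).
apply: (proj2 (expect_dct (g := fun=> K ^+ 2) _ _ _ _)).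
- by move=> n; exact: measurable_funX.
- exact: integ_cst.
- by move=> n w; rewrite ger0_norm ?sqr_ge0//; apply: ler_sqr_norm.
- move=> w; rewrite -[X in _ --> X](expr0n R 2).
  exact: (cvgM (g_cvg w) (g_cvg w)).
Qed.

(** Telescoping over the grid: [B] lies in every [F (grid n i)], so the centered parts integrate to
    0 over [B] and only the errors remain. Hence [|D| <= 'E (A n)] for all [n]; then [n] tends to
    infinity, and [a] after it. *)
Lemma criterion_increment B : F s B ->
  'E (fun w => Z s w * \1_B w) = 'E (fun w => Z t w * \1_B w).
Proof.
move=> FB; have t0 := le_trans s0 st.
have mB := filt_measurable filtF s0 FB.
have IZB r : 0 <= r -> integ (fun w => Z r w * \1_B w).
  by move=> r0; apply: integ_indic => //; exact: IZ.
pose D := 'E (fun w => Z t w * \1_B w) - 'E (fun w => Z s w * \1_B w).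
have DE n : `|D| <= 'E (A n).
  have IeB i : integ (fun w => e (grid n i) (grid n i.+1) w * \1_B w).
    by apply: integ_indic => //; exact: Ie.
  have -> : D = 'E (fun w => \sum_(i < n.+1) e (grid n i) (grid n i.+1) w * \1_B w).
    rewrite expect_sum// /D -[in LHS](gridn n) -[in X in _ - X](grid0 n).
    rewrite -(telescope_sumr (fun i => 'E (fun w => Z (grid n i) w * \1_B w)))//.
    rewrite big_mkord; apply: eq_bigr => i _.
    have FiB : F (grid n i) B by apply: (filt_sub filtF s0 (grid_ge n i)).
    have [IC /(_ _ FiB) EC] := Ze (grid_ge0 n i) (grid_nd n i).
    rewrite -expectB; [|exact: IZB|exact: IZB].
    apply/eqP; rewrite -subr_eq0 -expectB//; last first.
      by apply: integB; exact: IZB.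
    by apply/eqP; rewrite -[RHS]EC; apply: eq_expect => w; ring.
  apply: le_trans (le_norm_expect _) _; first exact: integ_sum.
  apply: le_expect => //; first by apply: integ_norm; exact: integ_sum.
  move=> w; apply: le_trans (ler_norm_sum _ _ _) _; apply: ler_sum => i _.
  by rewrite normrM ler_piMr// indicM_le1.
have M0 : 0 <= M.
  by apply: addr_ge0; apply: mulr_ge0 => //; rewrite ?sqr_ge0// exprn_ge0.
have D_le a : 0 < a -> `|D| <= a^-1 * M.
  move=> a0.
  have lim : (a * 'E (fun w => g n w ^+ 2) + a^-1 * M) @[n --> \oo] --> a^-1 * M.
    rewrite -[X in _ --> X](add0r) -[X in _ --> X + _](mulr0 a).
    by apply: cvgD; [apply: cvgM => //; exact: cvg_cst|exact: cvg_cst].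
  apply: (cvgr_to_ge lim).
  by apply: nearW => n; exact: le_trans (DE n) (EA_le n a0).
have : D = 0.
  apply/normr0_eq0/eqP; rewrite eq_le normr_ge0 andbT.
  apply/ler_addgt0Pl => eps eps0; rewrite addr0.
  (* [M] may be 0, whereas the choice [a = (M + 1) / eps] must be positive. *)
  have M1 : 0 < M + 1 by rewrite ltr_wpDl.
  apply: le_trans (D_le ((M + 1) / eps) _) _; first exact: divr_gt0.
  rewrite invf_div mulrAC ler_pdivrMr// ler_pM2l//.
  by rewrite lerDl.
by move/eqP; rewrite subr_eq0 => /eqP.
Qed.

End Grid.

Lemma martingale_criterion : martingale P F Z.
Proof.
apply/(martingaleP P filtF); split => // s t B s0 st FB.
exact: criterion_increment.
Qed.

End MartingaleCriterion.

(** * Stopping and localization *)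

Section HittingTime.
Context {d : measure_display} {T : measurableType d} {R : realType}.
Variable F : R -> set (set T).
Hypothesis filtF : filtration F.
Variables (Om : set T) (S : R -> T -> R).
Hypotheses (FOm : F 0 Om) (aS : adapted F S).
Hypothesis cS : forall w, Om w -> uniformly_continuous_path (S ^~ w).

(** Off [Om] the set of times is empty and the value is [+oo]: nothing is known about the path
    there, and [live] excludes it later. *)
Definition hitting_time (k : R) (w : T) : \bar R :=
  ereal_inf [set t%:E | t in [set t | [/\ 0 <= t, Om w & k <= S t w]]].

Lemma hitting_time_ge0 k w : (0 <= hitting_time k w)%E.
Proof. by apply/ereal_infP => _ [t [t0 _ _] <-]; rewrite lee_fin. Qed.

(** If the path stays strictly below [k] on [[0, t]], continuity at [t] keeps it there up to
    [t + del], so the infimum is strictly larger than [t]. *)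
Lemma hitting_time_leP k w t : Om w -> 0 <= t ->
  (hitting_time k w <= t%:E)%E <-> exists s, [/\ 0 <= s, s <= t & k <= S s w].
Proof.
move=> Omw t0; split=> [|[s [s0 st ks]]]; last first.
  apply: (@le_trans _ _ s%:E); last by rewrite lee_fin.
  by apply: ge_ereal_inf; exists s%:E => //; exists s.
apply: contraPP => /forallNP nex.
have St s : 0 <= s -> s <= t -> S s w < k.
  by move=> s0 st; rewrite ltNge; apply/negP => ks; apply: (nex s).
have Stk := St t t0 (lexx _).
have /upathP/within_ray_continuousP/(_ t (k - S t w) t0) := cS Omw.
rewrite subr_gt0 => /(_ Stk)[del del0 H].
apply/negP; rewrite -ltNge; apply: (@lt_le_trans _ _ (t + del)%:E).
  by rewrite lte_fin ltrDl.
apply/ereal_infP => _ [r [r0 _ kr] <-]; rewrite lee_fin leNgt; apply/negP => rt.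
have [rlet|tr] := leP r t; first by have := St r r0 rlet; rewrite ltNge kr.
have := H r r0; rewrite distrC ger0_norm ?subr_ge0 ?(ltW tr)// ltrBlDl => /(_ rt).
rewrite distrC => /(le_lt_trans (ler_norm _)); lra.
Qed.

Lemma lt_hitting_time k w s : Om w -> 0 <= s -> (s%:E < hitting_time k w)%E -> S s w < k.
Proof.
move=> Omw s0 sk; rewrite ltNge; apply/negP => ks.
by move: sk; rewrite ltNge => /negP; apply; apply/hitting_time_leP => //; exists s.
Qed.

(** At the hitting time itself the bound follows by continuity from the left; a positive hitting
    time rules out a path that starts above [k]. *)
Lemma le_hitting_time k w s : Om w -> (0 < hitting_time k w)%E -> 0 <= s ->
  (s%:E <= hitting_time k w)%E -> S s w <= k.
Proof.
move=> Omw k0 s0; rewrite le_eqVlt => /predU1P[sE|]; last first.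
  by move=> /(lt_hitting_time Omw s0)/ltW.
move: k0; rewrite -sE lte_fin => s_gt0.
rewrite leNgt; apply/negP => kS.
have /upathP/within_ray_continuousP/(_ s (S s w - k) s0) := cS Omw.
rewrite subr_gt0 => /(_ kS)[del del0 H].
(* A nonnegative time strictly before [s] and closer to it than [del]. *)
pose r := Num.max (s - del / 2) (s / 2).
have r0 : 0 <= r by rewrite le_max; apply/orP; right; rewrite divr_ge0.
have rs : r < s by rewrite gt_max; apply/andP; split; lra.
have sr : s - del / 2 <= r by rewrite le_max lexx.
have : (r%:E < hitting_time k w)%E by rewrite -sE lte_fin.
move=> /(lt_hitting_time Omw r0) Srk.
have := H r r0; rewrite ger0_norm ?subr_ge0 ?(ltW rs)//.
have -> : s - r < del by lra.
by move=> /(_ isT)/(le_lt_trans (ler_norm _)); lra.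
Qed.

Lemma grid_approx (s t del : R) : 0 <= s -> s <= t -> 0 < del ->
  exists j i : nat, (i <= j.+1)%N /\ `|s - t * i%:R / j.+1%:R| < del.
Proof.
move=> s0 st del0; have := le_trans s0 st; rewrite le_eqVlt => /predU1P[t0|t0].
  exists 0, 0; split=> //; rewrite mulr0 mul0r subr0 ger0_norm//.
  by apply: le_lt_trans del0; rewrite (le_trans st)// -t0.
pose j := Num.truncn (t / del); exists j.
have j0 : 0 < j.+1%:R :> R by [].
have tj : t / j.+1%:R < del.
  have := truncnS_gt (t / del); rewrite ltr_pdivrMr// -/j => tj.
  by rewrite ltr_pdivrMr// mulrC.
have q0 : 0 <= s * j.+1%:R / t by apply: divr_ge0; [apply: mulr_ge0|apply: ltW].
exists (Num.truncn (s * j.+1%:R / t)).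
have /andP[i1 i2] := truncn_itv q0.
set i := Num.truncn _ in i1 i2 *; split.
  rewrite -(ler_nat R); apply: le_trans i1 _.
  by rewrite ler_pdivrMr// mulrC ler_pM2l.
have a1 : t * i%:R / j.+1%:R <= s.
  by rewrite ler_pdivrMr// mulrC -ler_pdivlMr.
rewrite ger0_norm ?subr_ge0//; apply: le_lt_trans tj.
rewrite lerBlDl -mulrDl ler_pdivlMr// -[X in _ + X]mulr1 -mulrDr natr1.
by move: i2; rewrite ltr_pdivrMr// => /ltW; rewrite [leRHS]mulrC.
Qed.

(** Countable operations replace the union over all of [[0, t]]: the maximum over [[0, t]] reaches
    [k] iff, for each [n], some point of the dense family [u j i] has a value at least
    [k - n.+1%:R^-1]. *)
Lemma hitting_time_stopping k : stopping_time F (hitting_time k).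
Proof.
split=> [w|t t0]; first exact: hitting_time_ge0.
have sF := filt_sigma filtF t0.
(* [minn] keeps every point in [[0, t]], so the unions may run over all indices. *)
pose u (j i : nat) := t * (minn i j.+1)%:R / j.+1%:R.
have u0 j i : 0 <= u j i by rewrite divr_ge0// mulr_ge0.
have ut j i : u j i <= t.
  by rewrite /u ler_pdivrMr// ler_wpM2l// ler_nat geq_minr.
have -> : [set w | (hitting_time k w <= t%:E)%E] = Om `&`
    \bigcap_n \bigcup_j \bigcup_i [set w | k - n.+1%:R^-1 <= S (u j i) w].
  apply/seteqP; split=> w /=.
    move=> hk; have Omw : Om w.
      apply: contrapT => nOm; move: hk.
      suff -> : hitting_time k w = +oo%E by [].
      rewrite /hitting_time -ereal_inf0; congr ereal_inf.
      by apply/seteqP; split=> // y [r [_ ? _] _].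
    split=> // n _; have /(hitting_time_leP k Omw t0)[s [s0 st ks]] := hk.
    have /upathP/within_ray_continuousP/(_ s (n.+1%:R^-1) s0) := cS Omw.
    rewrite invr_gt0 ltr0n => /(_ isT)[del del0 H].
    have [j [i [ij sij]]] := grid_approx s0 st del0.
    exists j => //; exists i => //=.
    have uE : u j i = t * i%:R / j.+1%:R by rewrite /u (minn_idPl ij).
    have := H _ (u0 j i); rewrite uE => /(_ sij)/(le_lt_trans (ler_norm _)).
    by move: ks; set x := n.+1%:R^-1; lra.
  move=> [Omw H]; apply/hitting_time_leP => //.
  have [c] := EVT_max t0 (upath_within (U := t) (cS Omw)).
  rewrite in_itv/= => /andP[c0 ct] cmax; exists c; split=> //.
  rewrite leNgt; apply/negP => ck.
  have ck0 : 0 < k - S c w by rewrite subr_gt0.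
  pose n := Num.truncn (k - S c w)^-1.
  have nk : n.+1%:R^-1 < k - S c w.
    by rewrite invf_plt ?posrE//; exact: truncnS_gt.
  have [j _ [i _ /=]] := H n I.
  have := cmax (u j i); rewrite in_itv/= u0 ut => /(_ isT).
  by move: nk; set x := n.+1%:R^-1; lra.
apply: (sigma_setI sF); first exact: filt_sub FOm.
apply: (sigma_bigcap sF) => n; apply: (sigma_bigcup sF) => j; apply: (sigma_bigcup sF) => i.
apply: (sigma_ler sF); first exact: (measurable_wrt_cst sF).
exact: (adapted_later filtF).
Qed.

Lemma hitting_time_nd k k' w : k <= k' -> (hitting_time k w <= hitting_time k' w)%E.
Proof.
move=> kk'; apply: ereal_inf_le_tmp => _ [t [t0 Omw kS] <-].
by exists t => //; split=> //; apply: le_trans kS.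
Qed.

Lemma hitting_time_cvg w :
  hitting_time n%:R w @[n --> \oo] --> +oo%E.
Proof.
apply/cvgeyPge => A.
have [Omw|nOm] := pselect (Om w); last first.
  apply: nearW => n; suff -> : hitting_time n%:R w = +oo%E by rewrite leey.
  rewrite /hitting_time -ereal_inf0; congr ereal_inf.
  by apply/seteqP; split=> // y [r [_ ? _] _].
have [K HK] := upath_bounded (Num.max 0 A) (cS Omw).
near=> n; apply: (@le_trans _ _ (Num.max 0 A)%:E).
  by rewrite lee_fin le_max lexx orbT.
rewrite ltW// ltNge; apply/negP => /hitting_time_leP -/(_ Omw).
rewrite le_max lexx => /(_ isT)[s [s0 sA nS]].
have : K < n%:R by near: n; exact: nbhs_infty_gtr.
apply/negP; rewrite -leNgt; apply: le_trans nS _.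
by apply: le_trans (ler_norm _) _; exact: HK.
Unshelve. all: by end_near. Qed.

End HittingTime.

(** * The time at which a stopped process is read *)

Section Clamp.
Context {R : realType}.
Implicit Types (s t : R) (r : \bar R).

(** The time argument inside [stopped], isolated because it is a 1-Lipschitz time change in [t]:
    continuity and smallness of errors survive stopping for this reason alone. *)
Definition clamp t r : R := fine (Order.min t%:E r).

Lemma clamp_id t r : (t%:E <= r)%E -> clamp t r = t.
Proof. by rewrite /clamp => /min_idPl ->. Qed.

Lemma clamp_fin t (x : R) : clamp t x%:E = Num.min t x.
Proof. by rewrite /clamp -EFin_min. Qed.

Lemma clampP t r : 0 <= t -> (0 <= r)%E ->
  [/\ 0 <= clamp t r, clamp t r <= t & ((clamp t r)%:E <= r)%E].
Proof.
move=> t0; case: r => [x| |]//.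
- rewrite lee_fin => x0; rewrite clamp_fin lee_fin.
  by split; rewrite ?le_min ?t0// ge_min lexx// orbT.
- by rewrite clamp_id ?leey.
Qed.

Lemma clamp_lip s t r : 0 <= s -> s <= t -> (0 <= r)%E ->
  0 <= clamp t r - clamp s r <= t - s.
Proof.
move=> s0 st; case: r => [x| |]//; last by rewrite !clamp_id ?leey// subr_ge0 st lexx.
rewrite lee_fin => x0; rewrite !clamp_fin.
by have [?|?] := leP t x; have [?|?] := leP s x; apply/andP; split; lra.
Qed.

Lemma clamp_le_hit t r : (r <= t%:E)%E -> (0 <= r)%E -> (clamp t r)%:E = r.
Proof.
by case: r => // x; rewrite !lee_fin => xt _; rewrite clamp_fin min_r.
Qed.

Lemma clamp0 r : (0 <= r)%E -> clamp 0 r = 0.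
Proof. by move=> r0; rewrite clamp_id. Qed.

Lemma clamp_eq s t r : s <= t -> (r <= s%:E)%E -> clamp t r = clamp s r.
Proof.
move=> st; case: r => [x| |]//; rewrite ?lee_fin => xs.
by rewrite !clamp_fin !min_r// (le_trans xs).
Qed.

End Clamp.

Lemma ae_integ {d : measure_display} {T : measurableType d} {R : realType}
    (P : probability T R) (f g : T -> R) :
  integrable_rv P f -> measurable_fun setT g -> {ae P, forall w, f w = g w} ->
  integrable_rv P g.
Proof.
move=> If mg fg.
have mf := integ_measurable If.
(* Dominated convergence along the constant sequence [f] yields the integrability of its limit
   [g]. *)
have [|||||//] := @dominated_convergence _ T R P setT measurableT
    (fun _ => EFin \o f) (EFin \o g) (EFin \o (fun w => `|f w|)).
- by move=> _; exact/measurable_EFinP.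
- exact/measurable_EFinP.
- by apply: filterS fg => w fgw _ /=; rewrite fgw; exact: cvg_cst.
- exact: integ_norm.
- by apply: aeW => w /= _ _; rewrite lexx.
Qed.

(** * Almost sure modifications under the usual conditions *)

Section AlmostSure.
Context {d : measure_display} {T : measurableType d} {R : realType}.
Variable P : probability T R.
Variable F : R -> set (set T).
Hypothesis usualF : usual_conditions P F.
Let filtF : filtration F. Proof. by have [] := usualF. Qed.

(** The set where [f] and [g] differ and all its subsets are negligible, hence belong to [F 0]. *)
Lemma measurable_wrt_ae (f g : T -> R) t : 0 <= t -> measurable_wrt (F t) f ->
  {ae P, forall w, f w = g w} -> measurable_wrt (F t) g.
Proof.
move=> t0 mf fg B mB; have sF := filt_sigma filtF t0.
have negF A : P.-negligible A -> F t A.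
  by have [_ nF _] := usualF; move=> /nF; exact: (filt_sub filtF).
set N := ~` [set w | f w = g w]; have nN : P.-negligible N by exact: fg.
have -> : g @^-1` B = (f @^-1` B `&` ~` N) `|` (g @^-1` B `&` N).
  apply/seteqP; split=> w /=.
    by move=> Bg; have [fgw|nfgw] := pselect (f w = g w);
      [left; split; [rewrite fgw|exact]|right].
  by case=> [[Bf /contrapT <-]|[]].
rewrite -[X in F t X]setCK setCU; apply: (sigma_setC sF); apply: (sigma_setI sF).
  apply: (sigma_setC sF); apply: (sigma_setI sF); first exact: mf.
  by apply: (sigma_setC sF); exact: negF.
by apply: (sigma_setC sF); apply: negF; apply: negligibleS nN => w [].
Qed.

Lemma martingale_ae X X' : martingale P F X ->
  (forall t, 0 <= t -> {ae P, forall w, X t w = X' t w}) -> martingale P F X'.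
Proof.
move=> /(martingaleP P filtF)[IX aX EX] XX'.
have aX' : adapted F X' by move=> t t0; apply: (measurable_wrt_ae t0 (aX t t0)); exact: XX'.
have IX' t : 0 <= t -> integrable_rv P (X' t).
  move=> t0; apply: (ae_integ (IX t t0)); last exact: XX'.
  exact: (adapted_measurable filtF).
have EXX' t B : 0 <= t -> measurable B -> expect P (fun w => X' t w * \1_B w) =
    expect P (fun w => X t w * \1_B w).
  move=> t0 mB; apply: ae_eq_expect; [| |].
  - by apply: integ_indic => //; exact: IX'.
  - by apply: integ_indic => //; exact: IX.
  - by apply: filterS (XX' t t0) => w ->.
apply/(martingaleP P filtF); split=> // s t B s0 st FB.
have mB := filt_measurable filtF s0 FB.
by rewrite !EXX' ?(le_trans s0)//; exact: EX.
Qed.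
End AlmostSure.

(** * Optional stopping *)

Section Stopping.
Context {d : measure_display} {T : measurableType d} {R : realType}.
Variable P : probability T R.
Variable F : R -> set (set T).
Hypothesis filtF : filtration F.
Variables (Om : set T) (rho : T -> \bar R).
Hypotheses (FOm : F 0 Om) (rho_st : stopping_time F rho).
Local Notation integ := (integrable_rv P).
Local Notation "''E' f" := (expect P f) (at level 10, f at level 8).
Local Notation upath := uniformly_continuous_path.

Let rho0 w : (0 <= rho w)%E. Proof. by case: rho_st. Qed.

Definition live : set T := Om `&` [set w | (0 < rho w)%E].

(* The indicator makes the stopped process bounded when X_0 is not. *)
Definition hat (X : R -> T -> R) t w : R := \1_live w * stopped X rho t w.

Lemma rho_leF s t : 0 <= s -> s <= t -> F t [set w | (rho w <= s%:E)%E].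
Proof. by move=> s0 st; apply: (filt_sub filtF s0 st); case: rho_st => _; exact. Qed.

Lemma rho_gtF s t : 0 <= s -> s <= t -> F t [set w | (s%:E < rho w)%E].
Proof.
move=> s0 st; have sF := filt_sigma filtF (le_trans s0 st).
rewrite (_ : mkset _ = ~` [set w | (rho w <= s%:E)%E]).
  by apply: (sigma_setC sF); exact: rho_leF.
by apply/seteqP; split=> w /=; rewrite ltNge => /negP.
Qed.

Lemma live_F t : 0 <= t -> F t live.
Proof.
move=> t0; apply: (sigma_setI (filt_sigma filtF t0)); first exact: (filt_sub filtF (lexx _) t0).
exact: rho_gtF.
Qed.

Section Grid.
Variables s t : R.
Hypotheses (s0 : 0 <= s) (st : s <= t).
Let t0 : 0 <= t. Proof. exact: le_trans st. Qed.

Let grid n i := s + (t - s) * i%:R / n.+1%:R.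

Let grid0 n : grid n 0 = s. Proof. by rewrite /grid mulr0 mul0r addr0. Qed.

Let gridn n : grid n n.+1 = t.
Proof. by rewrite /grid mulfK ?pnatr_eq0// addrC subrK. Qed.

Let grid_step n i : grid n i.+1 - grid n i = (t - s) / n.+1%:R.
Proof.
rewrite /grid; have -> : i.+1%:R = i%:R + 1 :> R by rewrite natr1.
by field; rewrite gt_eqF.
Qed.

Let grid_nd n i : grid n i <= grid n i.+1.
Proof. by rewrite -subr_ge0 grid_step divr_ge0// subr_ge0. Qed.

Let grid_mono n i j : (i <= j)%N -> grid n i <= grid n j.
Proof.
move=> ij; rewrite -(subnK ij) addnC; elim: (j - i)%N => [|k ih]; first by rewrite addn0.
by rewrite addnS (le_trans ih).
Qed.

Let grid_ge n i : s <= grid n i. Proof. by rewrite -(grid0 n) grid_mono. Qed.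
Let grid_ge0 n i : 0 <= grid n i. Proof. exact: le_trans (grid_ge n i). Qed.
Let grid_le n i : (i <= n.+1)%N -> grid n i <= t.
Proof. by move=> ?; rewrite -[leRHS](gridn n) grid_mono. Qed.

(* The first grid point after rho, capped at t. *)
Let J n w := find (fun i => rho w <= (grid n i)%:E)%E (iota 0 n.+1).

Let J_le n w : (J n w <= n.+1)%N.
Proof. by rewrite -[leqRHS](size_iota 0) find_size. Qed.

Let J_before n w i : (i < J n w)%N -> ((grid n i)%:E < rho w)%E.
Proof.
move=> iJ; have := before_find 0 iJ; rewrite nth_iota ?(leq_trans iJ)// add0n.
by move=> /negbT; rewrite -ltNge.
Qed.

Let J_after n w : (J n w < n.+1)%N -> (rho w <= (grid n (J n w))%:E)%E.
Proof.
move=> Jn.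
have : has (fun i => rho w <= (grid n i)%:E)%E (iota 0 n.+1).
  by rewrite has_find size_iota.
by move=> /(nth_find 0); rewrite nth_iota.
Qed.

Let J_F n j : (j <= n.+1)%N -> F (grid n j) [set w | J n w = j].
Proof.
move=> jn; have sF := filt_sigma filtF (grid_ge0 n j).
have -> : [set w | J n w = j] =
    (\bigcap_i [set w | (i < j)%N -> ((grid n i)%:E < rho w)%E]) `&`
    [set w | (j < n.+1)%N -> (rho w <= (grid n j)%:E)%E].
  apply/seteqP; split=> w /=.
    by move=> <-; split=> [i _ /=|]; [exact: J_before|exact: J_after].
  move=> [H1 H2]; apply/eqP; rewrite eqn_leq; apply/andP; split; rewrite leqNgt; apply/negP => jJ.
    have jn' : (j < n.+1)%N by apply: leq_trans jJ (J_le n w).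
    by have := J_before jJ; rewrite ltNge H2.
  have Jn : (J n w < n.+1)%N by apply: leq_trans jJ jn.
  by have := H1 (J n w) I jJ; rewrite ltNge J_after.
apply: (sigma_setI sF).
  apply: (sigma_bigcap sF) => i; have [ij|ji] := ltnP i j.
    rewrite (_ : mkset _ = [set w | ((grid n i)%:E < rho w)%E]).
      by apply: rho_gtF => //; apply: grid_mono; exact: ltnW.
    by apply/seteqP; split=> w /=; [apply|move=> ? _].
  rewrite (_ : mkset _ = setT); first exact: (sigma_setT sF).
  by apply/seteqP; split=> w //= _.
have [jn'|nj] := ltnP j n.+1.
  rewrite (_ : mkset _ = [set w | (rho w <= (grid n j)%:E)%E]); first exact: rho_leF.
  by apply/seteqP; split=> w /=; [apply|move=> ? _].
rewrite (_ : mkset _ = setT); first exact: (sigma_setT sF).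
by apply/seteqP; split=> w //= _.
Qed.

(** The stopped time lies between the grid points of index [J - 1] and [J]; when [J = 0], both it
    and the grid point equal [s]. *)
Let J_near n w : (s%:E <= rho w)%E -> `|clamp t (rho w) - grid n (J n w)| <= (t - s) / n.+1%:R.
Proof.
move=> sr.
have st0 : 0 <= (t - s) / n.+1%:R by rewrite divr_ge0// subr_ge0.
have [JE|J0] := posnP (J n w).
  have := @J_after n w; rewrite JE grid0 => /(_ isT) rs.
  rewrite (@clamp_eq _ s t)// clamp_id// subrr normr0//.
have Jp : ((grid n (J n w).-1)%:E < rho w)%E by apply: J_before; rewrite prednK.
have step : grid n (J n w) - grid n (J n w).-1 = (t - s) / n.+1%:R.
  by rewrite -(grid_step n (J n w).-1) prednK.
have [c0 ct cr] := clampP t0 (rho0 w).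
have pc : grid n (J n w).-1 <= clamp t (rho w).
  have [tr|rt] := leP t%:E (rho w).
    by rewrite clamp_id// grid_le// (leq_trans (leq_pred _)).
  rewrite -lee_fin clamp_le_hit; [exact: ltW Jp|exact: ltW rt|exact: rho0].
have cJ : clamp t (rho w) <= grid n (J n w).
  have := J_le n w; rewrite leq_eqVlt => /predU1P[->|Jn]; first by rewrite gridn.
  by rewrite -lee_fin (le_trans cr)// J_after.
by rewrite distrC ger0_norm ?subr_ge0// -step lerD2l lerN2.
Qed.

Let grid_cvg w : (s%:E <= rho w)%E -> grid n (J n w) @[n --> \oo] --> clamp t (rho w).
Proof.
move=> sr; have lim : (t - s) / n.+1%:R @[n --> \oo] --> (0 : R).
  rewrite -[X in _ --> X](mulr0 (t - s)); apply: cvgM; first exact: cvg_cst.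
  exact: cvg_harmonic.
apply/cvgrPdist_lt => eps eps0.
move/cvgrPdist_lt: lim => /(_ _ eps0) lim.
near=> n; apply: le_lt_trans (J_near n sr) _.
have : `|0 - (t - s) / n.+1%:R| < eps by near: n.
by rewrite sub0r normrN ger0_norm// divr_ge0// subr_ge0.
Unshelve. all: by end_near. Qed.

Let sum_J (g : nat -> R) n w :
  \sum_(j < n.+2) g j * \1_[set w | J n w = j] w = g (J n w).
Proof.
have Jn : (J n w < n.+2)%N by rewrite ltnS J_le.
rewrite (bigD1 (Ordinal Jn))//= indicE mem_set//= mulr1 big1 ?addr0// => j jJ.
rewrite indicE memNset ?mulr0//= => Jj; move: jJ; apply/negP; rewrite negbK.
by apply/eqP/val_inj; rewrite /= Jj.
Qed.

Section Process.
Variable X : R -> T -> R.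
Hypotheses (aX : adapted F X) (cX : forall w, Om w -> upath (X ^~ w)).

Let X_cvg w : live w -> (s%:E <= rho w)%E ->
  X (grid n (J n w)) w @[n --> \oo] --> stopped X rho t w.
Proof.
move=> [Omw _] sr; rewrite /stopped -/(clamp t (rho w)).
have [c0 _ _] := clampP t0 (rho0 w).
by apply: (upath_cvg (x := X ^~ w) (cX Omw)) => //; exact: grid_cvg.
Qed.

(** By continuity the stopped value is the limit of the values at the grid points [J], each a finite
    sum of [F t]-measurable terms. Used with [s = 0]. *)
Lemma hat_mw_grid : (forall w, live w -> (s%:E <= rho w)%E) -> measurable_wrt (F t) (hat X t).
Proof.
move=> live_s; have sF := filt_sigma filtF t0.
pose f n w := \1_live w * \sum_(j < n.+2) X (grid n j) w * \1_[set w | J n w = j] w.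
apply: (@measurable_wrt_cvg _ _ _ _ sF f).
  move=> n; apply: (measurable_wrtM sF); first by apply: (measurable_wrt_indic sF); exact: live_F.
  apply: (measurable_wrt_sum sF) => j _; have jn : (j <= n.+1)%N by rewrite -ltnS.
  apply: (measurable_wrtM sF); first by apply: (adapted_later filtF) => //; exact: grid_le.
  apply: (measurable_wrt_indic sF); apply: (filt_sub filtF (grid_ge0 n j)); first exact: grid_le.
  exact: J_F.
move=> w; rewrite /hat /f indicE; case: (boolP (w \in live)) => [|_].
  rewrite inE => lw; rewrite mul1r; under eq_fun do rewrite mul1r (sum_J (fun j => X (grid _ j) w)).
  by apply: X_cvg => //; exact: live_s.
by rewrite mul0r; under eq_fun do rewrite mul0r; exact: cvg_cst.
Qed.

Hypothesis mX : martingale P F X.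
Variable K : R.
Hypothesis hatK : forall w, `|hat X t w| <= K.

Let IX u : 0 <= u -> integ (X u). Proof. by have /(martingaleP P filtF)[IX _ _] := mX; exact: IX. Qed.

(** Optional stopping by discretization: the event [J = j] is known at time [grid n j], so on it the
    value of [X] there may be replaced by [X t] in expectation; then the grid is refined. *)
Lemma stopping_grid B : F s B ->
  'E (fun w => hat X t w * \1_(B `&` (live `&` [set w | (s%:E < rho w)%E])) w) =
  'E (fun w => X t w * \1_(B `&` (live `&` [set w | (s%:E < rho w)%E])) w).
Proof.
move=> FB; set C := _ `&` _.
have FC : F s C.
  apply: (sigma_setI (filt_sigma filtF s0)) => //; apply: (sigma_setI (filt_sigma filtF s0)).
    exact: live_F.
  exact: rho_gtF.
(* The truncation at [K + 1] bounds the discretized values, so dominated convergence applies without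
   uniform integrability. It is harmless in the limit: the stopped value is at most [K], so the
   discretized one is eventually below [K + 1]. *)
pose A n j := C `&` ([set w | J n w = j] `&` [set w | `|X (grid n j) w| <= K + 1]).
have FA n (j : 'I_n.+2) : F (grid n j) (A n j).
  have sF := filt_sigma filtF (grid_ge0 n j).
  apply: (sigma_setI sF); first exact: (filt_sub filtF s0 (grid_ge n j)).
  apply: (sigma_setI sF); first by apply: J_F; rewrite -ltnS.
  apply: (sigma_ler sF); last exact: (measurable_wrt_cst sF).
  apply: (measurable_wrt_comp sF (k := fun x => `|x|)); first exact: normr_measurable.
  exact: aX.
have mA n (j : 'I_n.+2) : measurable (A n j) by apply: (filt_measurable filtF (grid_ge0 n j)).
have mC : measurable C := filt_measurable filtF s0 FC.
pose f n w := \sum_(j < n.+2) X (grid n j) w * \1_(A n j) w.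
pose g n w := X t w * \sum_(j < n.+2) \1_(A n j) w.
have Efg n : 'E (f n) = 'E (g n).
  transitivity ('E (fun w => \sum_(j < n.+2) X t w * \1_(A n j) w)); last first.
    by apply: eq_expect => w; rewrite /g mulr_sumr.
  rewrite !expect_sum => [||j]; last 1 first.
  - by apply: integ_indic => //; exact: IX.
  - apply: eq_bigr => j _.
    have /(martingaleP P filtF)[_ _] := mX; apply=> //.
    by apply: grid_le; rewrite -ltnS.
  - by move=> j; apply: integ_indic => //; exact: IX.
pose ind n w := \1_C w * (`|X (grid n (J n w)) w| <= K + 1)%R%:R : R.
have sumA (h : nat -> R) n w : \sum_(j < n.+2) h j * \1_(A n j) w = h (J n w) * ind n w.
  rewrite -(sum_J (fun j => h j * (\1_C w * (`|X (grid n j) w| <= K + 1)%R%:R))).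
  apply: eq_bigr => j _; rewrite /A indicI/=.
  rewrite [X in _ * (_ * X)](_ : _ = \1_[set w | J n w = j] w *
      \1_[set w | `|X (grid n j) w| <= K + 1] w); last by rewrite indicI.
  rewrite -!mulrA; congr (_ * _); congr (_ * _).
  rewrite mulrC; congr (_ * _).
  by rewrite indicE; congr (nat_of_bool _)%:R; apply/idP/idP; rewrite inE.
have fE n w : f n w = X (grid n (J n w)) w * ind n w.
  exact: (sumA (fun j => X (grid n j) w)).
have gE n w : g n w = X t w * ind n w.
  rewrite /g -[X in _ = _ * X]mul1r -(sumA (fun=> 1)).
  by congr (_ * _); apply: eq_bigr => j _; rewrite mul1r.
have K0 : 0 <= K by apply: le_trans (hatK point).
have ind_cvg w : ind n w @[n --> \oo] --> (\1_C w : R).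
  have [Cw|nCw] := pselect (C w); last first.
    by rewrite /ind indicE memNset//; under eq_fun do rewrite mul0r; exact: cvg_cst.
  have [_ [lw /ltW sr]] := Cw.
  have lim : `|X (grid n (J n w)) w| @[n --> \oo] --> `|stopped X rho t w|.
    by apply: cvg_norm; exact: X_cvg.
  have hK : `|stopped X rho t w| < K + 1.
    by have := hatK w; rewrite /hat indicE mem_set// mul1r => /le_lt_trans; apply; rewrite ltrDl.
  apply: cvg_near_cst.
  have H : \forall n \near \oo, `|X (grid n (J n w)) w| < K + 1 := cvgr_lt _ lim _ hK.
  near=> n; have h : `|X (grid n (J n w)) w| <= K + 1 by apply: ltW; near: n; exact: H.
  by rewrite /ind h mulr1.
have ind1 n w : `|ind n w| <= 1.
  rewrite /ind normrM; apply: mulr_ile1 => //; first exact: indicM_le1.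
  by rewrite normr_nat -[leRHS]/(1%:R) ler_nat leq_b1.
have mf n : integ (f n) by apply: integ_sum => j; apply: integ_indic => //; exact: IX.
have limf : 'E (f n) @[n --> \oo] --> 'E (fun w => hat X t w * \1_C w).
  apply: (proj2 (expect_dct (g := fun=> K + 1) _ _ _ _)).
  - by move=> n; exact: integ_measurable.
  - exact: integ_cst.
  - move=> n w; rewrite fE /ind.
    case: (leP `|X (grid n (J n w)) w| (K + 1)) => h; last first.
      by rewrite !mulr0 normr0 addr_ge0.
    rewrite mulr1 normrM; apply: le_trans h.
    by rewrite ler_piMr// indicM_le1.
  - move=> w; under eq_fun do rewrite fE.
    have [Cw|nCw] := pselect (C w); last first.
      rewrite /ind indicE memNset// mulr0.
      by under eq_fun do rewrite mul0r mulr0; exact: cvg_cst.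
    have [_ [lw /ltW sr]] := Cw.
    apply: cvgM (ind_cvg w); rewrite /hat indicE mem_set// mul1r.
    exact: X_cvg.
have limg : 'E (f n) @[n --> \oo] --> 'E (fun w => X t w * \1_C w).
  under eq_fun do rewrite Efg.
  apply: (proj2 (expect_dct (g := fun w => `|X t w|) _ _ _ _)).
  - move=> n; apply: measurable_funM; first exact: integ_measurable (IX t0).
    apply: integ_measurable; apply: (integ_sum (P := P)) => j.
    apply: (@integ_bounded _ _ _ _ 1); last by move=> w; exact: indicM_le1.
    exact: measurable_indic.
  - by apply: integ_norm; exact: IX.
  - by move=> n w; rewrite gE normrM ler_piMr.
  - move=> w; under eq_fun do rewrite gE.
    by apply: cvgM (ind_cvg w); exact: cvg_cst.
exact: cvg_unique limf limg.
Unshelve. all: by end_near. Qed.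

End Process.
End Grid.

Section HatProcess.
Variable X : R -> T -> R.
Hypotheses (aX : adapted F X) (cX : forall w, Om w -> upath (X ^~ w)).

Lemma hat_adapted : adapted F (hat X).
Proof. by move=> t t0; apply: (@hat_mw_grid 0 t). Qed.

(** On [live] paths with [rho > s], optional stopping applies at both times; on all others the
    stopped process does not move between [s] and [t]. *)
Lemma hat_martingale K : martingale P F X ->
  (forall t w, 0 <= t -> `|hat X t w| <= K) -> martingale P F (hat X).
Proof.
move=> mX hatK; have aH := hat_adapted.
have IH t : 0 <= t -> integ (hat X t).
  move=> t0; apply: (@integ_bounded _ _ _ _ K); first exact: (adapted_measurable filtF).
  by move=> w; exact: hatK.
apply/(martingaleP P filtF); split=> // s t B s0 st FB.
have t0 := le_trans s0 st.
have mB := filt_measurable filtF s0 FB.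
pose L := live `&` [set w | (s%:E < rho w)%E].
have FL : F s L by apply: (sigma_setI (filt_sigma filtF s0)); [exact: live_F|exact: rho_gtF].
have FBL : F s (B `&` L) := sigma_setI (filt_sigma filtF s0) FB FL.
have mBL := filt_measurable filtF s0 FBL.
have ELt := @stopping_grid s t s0 st X aX cX mX K (hatK t ^~ t0) B FB.
have ELs : 'E (fun w => hat X s w * \1_(B `&` L) w) = 'E (fun w => X s w * \1_(B `&` L) w).
  apply: eq_expect => w; have [[Bw [lw sr]]|nw] := pselect ((B `&` L) w).
    by rewrite /hat indicE mem_set// mul1r /stopped -/(clamp s (rho w)) clamp_id// ltW.
  by rewrite indicE memNset// !mulr0.
have /(martingaleP P filtF)[_ _ /(_ s t _ s0 st FBL)] := mX.
rewrite -ELs -ELt => EE.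
apply/eqP; rewrite -subr_eq0 -expectB; [|by apply: integ_indic => //; exact: IH..].
apply/eqP; transitivity ('E (fun w => hat X s w * \1_(B `&` L) w - hat X t w * \1_(B `&` L) w)).
  apply: eq_expect => w; have [Lw|nLw] := pselect (L w).
    by rewrite indicI/= [\1_L w]indicE mem_set// mulr1.
  suff -> : hat X s w = hat X t w by rewrite !subrr.
  rewrite /hat; have [lw|nlw] := pselect (live w); last first.
    by rewrite indicE memNset// !mul0r.
  congr (_ * _); rewrite /stopped -/(clamp s (rho w)) -/(clamp t (rho w)).
  rewrite (@clamp_eq _ s t)// leNgt; apply/negP => sr; exact: nLw.
by rewrite expectB ?EE ?subrr//; apply: integ_indic => //; exact: IH.
Qed.

End HatProcess.
End Stopping.

(** * From local martingales to bounded martingales and back *)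

Section LocalMartingales.
Context {d : measure_display} {T : measurableType d} {R : realType}.
Variable P : probability T R.
Variable F : R -> set (set T).
Hypothesis usualF : usual_conditions P F.
Let filtF : filtration F. Proof. by have [] := usualF. Qed.
Local Notation integ := (integrable_rv P).
Local Notation "''E' f" := (expect P f) (at level 10, f at level 8).
Local Notation upath := uniformly_continuous_path.

Lemma martingale_limit K (Xn : nat -> R -> T -> R) X :
  (forall n, martingale P F (Xn n)) ->
  (forall n t w, 0 <= t -> `|Xn n t w| <= K) -> adapted F X ->
  (forall t, 0 <= t -> {ae P, forall w, Xn n t w @[n --> \oo] --> X t w}) ->
  martingale P F X.
Proof.
move=> mXn XnK aX lim.
have aXn n : adapted F (Xn n) by have /(martingaleP P filtF)[] := mXn n.
have mXnt n t : 0 <= t -> measurable_fun setT (Xn n t).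
  by move=> t0; exact: (adapted_measurable filtF (aXn n)).
have mXt t : 0 <= t -> measurable_fun setT (X t).
  by move=> t0; exact: (adapted_measurable filtF aX).
have limB t B : 0 <= t -> measurable B ->
    'E (fun w => Xn n t w * \1_B w) @[n --> \oo] --> 'E (fun w => X t w * \1_B w).
  move=> t0 mB; apply: (proj2 (expect_dct_ae (g := fun=> K) _ _ _ _ _)).
  - by move=> n; apply: measurable_funM; [exact: mXnt|exact: measurable_indic].
  - by apply: measurable_funM; [exact: mXt|exact: measurable_indic].
  - exact: integ_cst.
  - move=> n w; rewrite normrM -[leRHS]mulr1.
    by apply: ler_pM => //; [exact: XnK|exact: indicM_le1].
  - by apply: filterS (lim t t0) => w Xw; apply: cvgM => //; exact: cvg_cst.
apply/(martingaleP P filtF); split=> // [t t0|s t B s0 st FB].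
  apply: (proj1 (expect_dct_ae (g := fun=> K) _ (mXt t t0) _ _ (lim t t0))).
  - by move=> n; exact: mXnt.
  - exact: integ_cst.
  - by move=> n w; exact: XnK.
have t0 := le_trans s0 st; have mB := filt_measurable filtF s0 FB.
have := limB t B t0 mB; have := limB s B s0 mB.
have -> : (fun n => 'E (fun w => Xn n s w * \1_B w)) = (fun n => 'E (fun w => Xn n t w * \1_B w)).
  by apply/funext => n; have /(martingaleP P filtF)[_ _] := mXn n; exact.
by move=> h1 h2; exact: cvg_unique h1 h2.
Qed.

Lemma martingaleD_cst X V : martingale P F X -> measurable_wrt (F 0) V -> integ V ->
  martingale P F (fun t w => X t w + V w).
Proof.
move=> /(martingaleP P filtF)[IX aX EX] mV IV; apply/(martingaleP P filtF); split.
- by move=> t t0; apply: integD => //; exact: IX.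
- move=> t t0; apply: (measurable_wrtD (filt_sigma filtF t0)); first exact: aX.
  by move=> B mB; apply: (filt_sub filtF (lexx 0) t0); exact: mV.
- move=> s t B s0 st FB; have t0 := le_trans s0 st.
  have mB := filt_measurable filtF s0 FB.
  have split_V u : 0 <= u -> 'E (fun w => (X u w + V w) * \1_B w) =
      'E (fun w => X u w * \1_B w) + 'E (fun w => V w * \1_B w).
    move=> u0; rewrite -expectD; last exact: integ_indic.
      by apply: eq_expect => w; rewrite mulrDl.
    by apply: integ_indic => //; exact: IX.
  by rewrite !split_V// (EX s t).
Qed.

Variables (Om : set T).
Hypotheses (FOm : F 0 Om) (nOm : P.-negligible (~` Om)).

Section Hat.
Variable rho : T -> \bar R.
Hypothesis rho_st : stopping_time F rho.
Let rho0 w : (0 <= rho w)%E. Proof. by case: rho_st. Qed.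
Local Notation live := (live Om rho).
Local Notation hat := (hat Om rho).

Lemma hat_live X t w : live w -> hat X t w = X (clamp t (rho w)) w.
Proof. by move=> lw; rewrite /hat indicE mem_set// mul1r. Qed.

Lemma hat_dead X t w : ~ live w -> hat X t w = 0.
Proof. by move=> lw; rewrite /hat indicE memNset// mul0r. Qed.

Lemma upath_stopped x r : (0 <= r)%E -> upath x -> upath (fun t : R => x (clamp t r)).
Proof.
move=> r0 ux; apply: (upath_time_change (f := fun t => clamp t r)) => // [t t0|s t s0 st].
  by have [-> ->] := clampP t0 r0.
exact: clamp_lip.
Qed.

(** The unknown reducing times [tau n] are disposed of here: stopping at both [rho] and [tau n]
    gives martingales bounded by [2 K], and bounded convergence removes [tau n]. The initial value,
    bounded on [live], is added back at the end. *)
Lemma local_hat_martingale K X : local_martingale P F X ->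
  (forall w, Om w -> upath (X ^~ w)) ->
  (forall t w, 0 <= t -> `|hat X t w| <= K) -> martingale P F (hat X).
Proof.
move=> [aX [tau [tau_st tau_lim mY]]] cX hatK.
have tau0 n w : (0 <= tau n w)%E by case: (tau_st n).
pose Y n t w := stopped X (tau n) t w - X 0 w.
have aY n : adapted F (Y n) by have /(martingaleP P filtF)[] := mY n.
have cY n w : Om w -> upath (Y n ^~ w).
  move=> Omw; apply: upathB; last exact: upath_cst.
  exact: upath_stopped (tau0 n w) (cX w Omw).
have hatYE n t w : 0 <= t ->
    hat (Y n) t w = hat X (clamp (clamp t (rho w)) (tau n w)) w - hat X 0 w.
  move=> t0; have [lw|nlw] := pselect (live w); last by rewrite !hat_dead// subrr.
  rewrite !hat_live// clamp0//; congr (X _ w - _).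
  have [c0 ct cr] := clampP t0 (rho0 w).
  have [c0' ct' cr'] := clampP c0 (tau0 n w).
  rewrite -/(clamp _ _) [RHS]clamp_id//.
  by apply: le_trans cr; rewrite lee_fin.
have hatYK n t w : 0 <= t -> `|hat (Y n) t w| <= K + K.
  move=> t0; rewrite hatYE//; apply: le_trans (ler_normB _ _) _.
  have [c0 ct cr] := clampP t0 (rho0 w).
  have [c0' ct' cr'] := clampP c0 (tau0 n w).
  by rewrite lerD ?hatK.
have mhatY n : martingale P F (hat (Y n)).
  exact: (hat_martingale filtF FOm rho_st (aY n) (cY n) (mY n) (hatYK n)).
have ahX : adapted F (hat X) := hat_adapted filtF FOm rho_st aX cX.
have mhX0 : martingale P F (fun t w => hat X t w - hat X 0 w).
  apply: (martingale_limit mhatY hatYK).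
    move=> t t0; apply: (measurable_wrtB (filt_sigma filtF t0)); first exact: ahX.
    exact: (adapted_later filtF).
  move=> t t0; apply: filterS tau_lim => w [_ /cvgeyPge/(_ t) tw].
  apply: cvg_near_cst; near=> n; rewrite hatYE//; congr (_ - _).
  have tn : (t%:E <= tau n w)%E by near: n; exact: tw.
  have [c0 ct cr] := clampP t0 (rho0 w).
  rewrite [clamp (clamp _ _) _]clamp_id; last by apply: le_trans tn; rewrite lee_fin.
  have [lw|nlw] := pselect (live w); last by rewrite !hat_dead.
  by rewrite !hat_live// [clamp (clamp _ _) _]clamp_id.
have I0 : integ (hat X 0).
  apply: (@integ_bounded _ _ _ _ K); first exact: (adapted_measurable filtF).
  by move=> w; exact: hatK.
have := martingaleD_cst mhX0 (ahX 0 (lexx 0)) I0.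
by congr (martingale _ _ _); apply/funext => t; apply/funext => w; rewrite subrK.
Unshelve. all: by end_near. Qed.

End Hat.

Variable S : R -> T -> R.
Hypotheses (aS : adapted F S) (cS : forall w, Om w -> upath (S ^~ w)).
Local Notation rho k := (hitting_time Om S k).

(** The hitting times form a reducing sequence. On [Om], the increments of [hat X] from time 0 are
    those of the stopped process: on [live] by definition, elsewhere because [rho = 0] and both
    vanish. *)
Lemma hat_local_martingale X : adapted F X ->
  (forall n : nat, martingale P F (hat Om (rho n%:R) X)) -> local_martingale P F X.
Proof.
move=> aX mX; split=> //; exists (fun n => rho n%:R).
have rho_st n : stopping_time F (rho n%:R) by exact: hitting_time_stopping.
split=> // [|n].
  apply: aeW => w; split; last exact: hitting_time_cvg.
  by move=> n m nm; apply: hitting_time_nd; rewrite ler_nat.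
have /(martingaleP P filtF)[IX aX' _] := mX n.
have IN : integ (fun w => - hat Om (rho n%:R) X 0 w).
  by have := integB (integ_cst P 0) (IX 0 (lexx 0)); under eq_fun do rewrite sub0r.
have := martingaleD_cst (mX n) (measurable_wrtN (filt_sigma filtF (lexx 0)) (aX' 0 (lexx 0))) IN.
move=> /(martingale_ae usualF); apply => t t0.
have [N [mN N0 NS]] := nOm.
exists N; split=> // w /= nE; apply: NS => /= Omw; apply: nE.
have r0 : (0 <= rho n%:R w)%E by exact: hitting_time_ge0.
have [lw|nlw] := pselect (live Om (rho n%:R) w).
  by rewrite !hat_live// clamp0.
rewrite !hat_dead// oppr0 addr0 /stopped -/(clamp _ _).
suff -> : clamp t (rho n%:R w) = 0 by rewrite subrr.
have := r0; rewrite le_eqVlt => /predU1P[<-|rp]; first by rewrite clamp_fin min_r.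
by exfalso; apply: nlw; split.
Qed.

End LocalMartingales.

(** * Pathwise expansions *)

Section SmallIncrements.
Context {R : realType}.
Implicit Types (g e : R -> R -> R) (x a h : R -> R) (s t K : R).
Local Notation upath := uniformly_continuous_path.

Definition incr x s t : R := x t - x s.

Definition small K g e := dominated_by K g e /\ negligible_to g e.

Lemma le_small K g e e' : small K g e ->
  (forall s t, 0 <= s -> s <= t -> `|e' s t| <= `|e s t|) -> small K g e'.
Proof.
move=> [dom neg] le; split=> [s t s0 st|U eps eps0]; first exact: le_trans (le _ _ s0 st) (dom _ _ s0 st).
have [del del0 H] := neg U eps eps0; exists del => // s t s0 st tU ts.
exact: le_trans (le _ _ s0 st) (H _ _ s0 st tU ts).
Qed.

Lemma eq_small K g e e' : small K g e ->
  (forall s t, 0 <= s -> s <= t -> e' s t = e s t) -> small K g e'.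
Proof. by move=> sm E; apply: (le_small sm) => s t s0 st; rewrite E. Qed.

Lemma small_le K K' g g' e : small K g e -> 0 <= K -> K <= K' ->
  (forall s t, 0 <= s -> s <= t -> 0 <= g s t <= g' s t) -> small K' g' e.
Proof.
move=> [dom neg] K0 KK' gg'; split=> [s t s0 st|U eps eps0].
  have /andP[g0 gl] := gg' _ _ s0 st.
  by apply: le_trans (dom _ _ s0 st) _; apply: ler_pM.
have [del del0 H] := neg U eps eps0; exists del => // s t s0 st tU ts.
have /andP[g0 gl] := gg' _ _ s0 st.
by apply: le_trans (H _ _ s0 st tU ts) _; rewrite ler_pM2l.
Qed.

Lemma smallD K1 K2 g e1 e2 : small K1 g e1 -> small K2 g e2 ->
  small (K1 + K2) g (fun s t => e1 s t + e2 s t).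
Proof.
move=> [dom1 neg1] [dom2 neg2]; split=> [s t s0 st|U eps eps0].
  by apply: le_trans (ler_normD _ _) _; rewrite mulrDl lerD ?dom1 ?dom2.
have eps20 : 0 < eps / 2 by rewrite divr_gt0.
have [d1 d10 H1] := neg1 U _ eps20; have [d2 d20 H2] := neg2 U _ eps20.
exists (Num.min d1 d2); first by rewrite lt_min d10.
move=> s t s0 st tU; rewrite lt_min => /andP[t1 t2].
apply: le_trans (ler_normD _ _) _; rewrite [eps in leRHS]splitr mulrDl.
by rewrite lerD ?H1 ?H2.
Qed.

Lemma smallM K C g e (c : R -> R -> R) : 0 <= C -> small K g e ->
  (forall s t, 0 <= s -> s <= t -> `|c s t| <= C) ->
  small (C * K) g (fun s t => c s t * e s t).
Proof.
move=> C0 [dom neg] cC; split=> [s t s0 st|U eps eps0].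
  by rewrite normrM -mulrA ler_pM ?cC ?dom.
have C1 : 0 < C + 1 by rewrite ltr_wpDl.
have [del del0 H] := neg U (eps / (C + 1)) (divr_gt0 eps0 C1).
exists del => // s t s0 st tU ts; rewrite normrM.
have h1 := H _ _ s0 st tU ts; have c1 := cC _ _ s0 st.
apply: (@le_trans _ _ ((C + 1) * (eps / (C + 1) * g s t))).
  by apply: ler_pM => //; apply: le_trans c1 _; rewrite lerDl.
by rewrite mulrA (mulrC (C + 1)) divfK// gt_eqF.
Qed.

Lemma smallN K g e : small K g e -> small K g (fun s t => - e s t).
Proof. by move=> sm; apply: (le_small sm) => s t _ _; rewrite normrN. Qed.

(** The increment of a continuous path tends to 0 uniformly on each segment, so one such factor
    turns domination into negligibility. All second-order cross terms are discarded in this way. *)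
Lemma small_incr K C g x e : 0 < C -> upath x -> (forall t, 0 <= t -> `|x t| <= K) ->
  dominated_by C g e -> small (2 * K * C) g (fun s t => incr x s t * e s t).
Proof.
move=> C0 ux xK dom; have C0' := ltW C0; split=> [s t s0 st|U eps eps0].
  rewrite normrM -mulrA ler_pM ?dom// /incr.
  by apply: le_trans (ler_normB _ _) _; rewrite mulr_natl lerD ?xK// (le_trans s0).
have C1 : 0 < C + 1 by rewrite ltr_wpDl.
have [del del0 H] := ux U (eps / (C + 1)) (divr_gt0 eps0 C1).
exists del => // s t s0 st tU ts; rewrite normrM.
have h1 := H _ _ s0 st tU ts; have d1 := dom _ _ s0 st.
have : `|incr x s t| * `|e s t| <= eps / (C + 1) * (C * g s t) by apply: ler_pM.
move=> /le_trans; apply; rewrite -[in leRHS](divfK (lt0r_neq0 C1) eps).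
have g0 : 0 <= C * g s t by apply: le_trans d1.
rewrite -[leRHS]mulrA ler_pM2l ?divr_gt0// mulrDl mul1r lerDl.
by move: g0; rewrite pmulr_rge0.
Qed.

Lemma small_time_change K g e (f : R -> R) : small K g e ->
  (forall t, 0 <= t -> 0 <= f t <= t) ->
  (forall s t, 0 <= s -> s <= t -> 0 <= f t - f s <= t - s) ->
  small K (fun s t => g (f s) (f t)) (fun s t => e (f s) (f t)).
Proof.
move=> [dom neg] f0 fL; split=> [s t s0 st|U eps eps0].
  have /andP[fs0 _] := f0 _ s0; have /andP[f1 f2] := fL _ _ s0 st.
  by apply: dom => //; lra.
have [del del0 H] := neg U eps eps0; exists del => // s t s0 st tU ts.
have /andP[fs0 _] := f0 _ s0; have /andP[f1 f2] := fL _ _ s0 st.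
have /andP[_ ftt] := f0 _ (le_trans s0 st).
by apply: H => //; lra.
Qed.

Section PathIntegral.
Variables a h : R -> R.
Hypotheses (ua : upath a) (nda : ray_nondecreasing a) (uh : upath h).
Local Notation J := (path_integral a h).

Lemma path_integral0 : J 0 = 0.
Proof. by rewrite /path_integral set_itv_ge ?Rintegral_set0// bnd_simp ltxx. Qed.

(** On a short interval [h] stays within [eps] of its left value, and [path_integral_bounds] applies
    with [h s - eps] and [h s + eps]. *)
Lemma path_integral_negl :
  negligible_to (incr a) (fun s t => incr J s t - h s * incr a s t).
Proof.
move=> U eps eps0; have [del del0 H] := uh U eps0.
exists del => // s t s0 st tU ts; rewrite /incr.
have bd u : s <= u -> u <= t -> h s - eps <= h u <= h s + eps.
  move=> su ut; have := H s u s0 su (le_trans ut tU) ltac:(lra).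
  by rewrite ler_norml => /andP[h1 h2]; apply/andP; split; lra.
have := path_integral_bounds ua nda uh s0 st bd.
rewrite !mulrDl mulNr => /andP[b1 b2].
by rewrite ler_norml; apply/andP; split; lra.
Qed.

Lemma upath_integral : upath J.
Proof.
move=> U eps eps0; have [K hK] := upath_bounded U uh.
have K0 : 0 < `|K| + 1 by rewrite ltr_wpDl.
have [del del0 H] := ua U (divr_gt0 eps0 K0).
exists del => // s t s0 st tU ts.
have bd u : s <= u -> u <= t -> - (`|K| + 1) <= h u <= `|K| + 1.
  move=> su ut; rewrite -ler_norml; apply: le_trans (hK u _ _) _; [lra|lra|].
  by apply: le_trans (ler_norm _) _; rewrite lerDl.
have := path_integral_bounds ua nda uh s0 st bd; rewrite mulNr -ler_norml => /le_trans; apply.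
have := H s t s0 st tU ts; rewrite ger0_norm ?subr_ge0 ?nda// ler_pdivlMr//.
by rewrite mulrC.
Qed.

Lemma path_integral_nd : (forall t, 0 <= t -> 0 <= h t) -> ray_nondecreasing J.
Proof.
move=> h0 s t s0 st; have [K hK] := upath_bounded t uh.
have bd u : s <= u -> u <= t -> 0 <= h u <= K.
  by move=> su ut; rewrite h0 ?(le_trans s0)// (le_trans (ler_norm _))// hK// (le_trans s0).
have := path_integral_bounds ua nda uh s0 st bd.
by rewrite mul0r subr_ge0 => /andP[].
Qed.

Hypothesis h01 : forall t, 0 <= t -> 0 <= h t <= 1.

Lemma path_integral_incr s t : 0 <= s -> s <= t -> 0 <= incr J s t <= incr a s t.
Proof.
move=> s0 st; rewrite -[X in _ <= _ <= X]mul1r -[X in X <= _]/(0 : R) -(mul0r (incr a s t)).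
by apply: path_integral_bounds => // u su ut; apply: h01; exact: le_trans su.
Qed.

Lemma path_integral_small :
  small 1 (incr a) (fun s t => incr J s t - h s * incr a s t).
Proof.
split; last exact: path_integral_negl.
move=> s t s0 st; have /andP[b1 b2] := path_integral_incr s0 st.
have /andP[c1 c2] := h01 s0.
have a0 : 0 <= incr a s t by rewrite subr_ge0 nda.
have d1 : 0 <= h s * incr a s t by rewrite mulr_ge0.
have d2 : h s * incr a s t <= incr a s t by rewrite ler_piMl.
by rewrite mul1r ler_norml; apply/andP; split; lra.
Qed.

End PathIntegral.

(** Needed to see that a pathwise integral of adapted processes is adapted. *)
Lemma path_integral_riemann a h t : upath a -> ray_nondecreasing a -> upath h -> 0 <= t ->
  (\sum_(i < n.+1) h (t * i%:R / n.+1%:R) *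
     incr a (t * i%:R / n.+1%:R) (t * i.+1%:R / n.+1%:R)) @[n --> \oo]
  --> path_integral a h t.
Proof.
move=> ua nda uh t0.
pose u n i := t * i%:R / n.+1%:R : R.
have u0 n i : 0 <= u n i by rewrite divr_ge0// mulr_ge0.
have un n : u n n.+1 = t by rewrite /u mulfK// pnatr_eq0.
have step n i : u n i.+1 - u n i = t / n.+1%:R.
  have -> : u n i.+1 - u n i = t * (i.+1%:R - i%:R) / n.+1%:R by rewrite /u; ring.
  by rewrite -natrB// subSnn mulr1.
have u_nd n i : u n i <= u n i.+1 by rewrite -subr_ge0 step divr_ge0.
have ut n i : (i < n.+1)%N -> u n i.+1 <= t.
  by move=> inn; rewrite /u ler_pdivrMr// ler_wpM2l// ler_nat.
have at0 : 0 <= incr a 0 t by rewrite subr_ge0 nda.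
apply/cvgrPdist_le => eps eps0.
have A1 : 0 < incr a 0 t + 1 by rewrite ltr_wpDl.
have [del del0 H] := path_integral_negl ua nda uh t (divr_gt0 eps0 A1).
have lim : t / n.+1%:R @[n --> \oo] --> (0 : R).
  rewrite -[X in _ --> X](mulr0 t); apply: cvgM; first exact: cvg_cst.
  exact: cvg_harmonic.
move/cvgrPdist_lt: lim => /(_ _ del0) lim.
near=> n.
have tel (x : R -> R) : incr x 0 t = \sum_(i < n.+1) incr x (u n i) (u n i.+1).
  have := telescope_sumr (fun i => x (u n i)) (leq0n n.+1).
  rewrite big_mkord un (_ : u n 0%N = 0); last by rewrite /u mulr0 mul0r.
  by move=> E; rewrite /incr -E.
have -> : path_integral a h t = incr (path_integral a h) 0 t.
  by rewrite /incr path_integral0 subr0.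
rewrite tel -sumrB.
apply: le_trans (ler_norm_sum _ _ _) _.
apply: (@le_trans _ _ (\sum_(i < n.+1) eps / (incr a 0 t + 1) * incr a (u n i) (u n i.+1))).
  apply: ler_sum => i _; apply: H => //; first exact: ut.
  rewrite step; have : `|0 - t / n.+1%:R| < del by near: n.
  by rewrite sub0r normrN ger0_norm// divr_ge0.
rewrite -mulr_sumr -tel mulrAC ler_pdivrMr// ler_pM2l//.
by rewrite lerDl.
Unshelve. all: by end_near. Qed.

End SmallIncrements.

(** * Taylor estimates for the exponential and the logarithm *)

Section Taylor.
Context {R : realType}.

(** The exponential is squeezed between [1 - x] and [(1 + x)^-1 = 1 - x + x^2 / (1 + x)]. *)
Lemma expRN_taylor (x : R) : 0 <= x -> `|expR (- x) - 1 + x| <= x ^+ 2.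
Proof.
move=> x0; have x1 : 0 < 1 + x by rewrite ltr_wpDr.
have lo : 1 + - x <= expR (- x) := expR_ge1Dx _.
have hi : expR (- x) <= (1 + x)^-1.
  by rewrite expRN lef_pV2 ?posrE ?expR_gt0// expR_ge1Dx.
have xE : (1 + x)^-1 = 1 - x + x ^+ 2 / (1 + x) by field; rewrite gt_eqF.
have x2 : x ^+ 2 / (1 + x) <= x ^+ 2.
  by rewrite ler_pdivrMr// ler_peMr ?sqr_ge0// lerDl.
by rewrite ger0_norm; lra.
Qed.

(** The remainder vanishes at 1 and has derivative [(u - 1)^2 / u]. The mean value theorem applies,
    with an intermediate point at least [c] since both 1 and [z] are. *)
Lemma ln_taylor (c z : R) : 0 < c -> c <= 1 -> c <= z ->
  `|ln z - (z - 1) + (z - 1) ^+ 2 / 2| <= `|z - 1| ^+ 3 / c.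
Proof.
move=> c0 c1 cz; have z0 : 0 < z by apply: lt_le_trans cz.
pose f (u : R) := ln u - (u - 1) + (u - 1) ^+ 2 / 2.
pose df (u : R) := (u - 1) ^+ 2 / u.
have fder (u : R) : 0 < u -> is_derive u 1 f (df u).
  move=> u0; have dln : is_derive u 1 (@ln R) u^-1 by exact: is_derive1_ln.
  rewrite /f; apply: is_derive_eq.
  rewrite !scaler0 add0r subr0 /df /GRing.scale/=.
  by field; rewrite gt_eqF.
have f1 : f 1 = 0 by rewrite /f ln1 !subrr expr0n/= mul0r addr0.
have fcont (a b : R) : 0 < a -> {within `[a, b], continuous f}.
  move=> a0; apply: derivable_within_continuous => u; rewrite in_itv/= => /andP[au _].
  by have [] := fder u (lt_le_trans a0 au).
have bound (u : R) : c <= u -> `|u - 1| <= `|z - 1| -> `|df u| * `|z - 1| <= `|z - 1| ^+ 3 / c.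
  move=> cu uz; have u0 : 0 < u by apply: lt_le_trans cu.
  have -> : `|z - 1| ^+ 3 / c = (`|z - 1| ^+ 2 / c) * `|z - 1| by rewrite exprSr mulrAC.
  rewrite ler_wpM2r// /df normrM normrX normfV (ger0_norm (ltW u0)).
  apply: ler_pM.
  - exact: sqr_ge0.
  - by rewrite invr_ge0 ltW.
  - by rewrite ler_sqr ?nnegrE.
  - by rewrite lef_pV2 ?posrE.
have -> : ln z - (z - 1) + (z - 1) ^+ 2 / 2 = f z by [].
have [z1|z1] := leP 1 z.
  have [||v] := @MVT_segment R f df 1 z z1; last 1 first.
  - rewrite in_itv/= f1 subr0 => /andP[u1 uz] ->; rewrite normrM; apply: bound; first lra.
    by rewrite !ger0_norm; lra.
  - by move=> u; rewrite in_itv/= => /andP[u1 _]; apply: fder; lra.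
  - exact: fcont.
have [||v] := @MVT_segment R f df z 1 (ltW z1); last 1 first.
- rewrite in_itv/= f1 sub0r => /andP[zu u1] /eqP; rewrite eqr_oppLR => /eqP ->.
  rewrite normrN normrM (distrC 1); apply: bound; first lra.
  by rewrite !ler0_norm; lra.
- by move=> u; rewrite in_itv/= => /andP[u1 _]; apply: fder; lra.
- exact: fcont.
Qed.
End Taylor.

(** * Expansions along one stopped path *)

Section PathExpansions.
Context {R : realType}.
Local Notation upath := uniformly_continuous_path.

Variables (k : R) (y m l L : R -> R).
Let h t := (1 + y t)^-1.
Hypotheses (k0 : 0 <= k) (y0 : forall t, 0 <= t -> 0 <= y t)
  (yml : forall t, 0 <= t -> y t = m t + l t)
  (uy : upath y) (um : upath m) (ul : upath l) (uL : upath L)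
  (yk : forall t, 0 <= t -> `|y t| <= k) (mk : forall t, 0 <= t -> `|m t| <= k)
  (lk : forall t, 0 <= t -> `|l t| <= k) (Lk : forall t, 0 <= t -> `|L t| <= k)
  (L0 : forall t, 0 <= t -> 0 <= L t) (l_nd : ray_nondecreasing l)
  (L_incr : forall s t, 0 <= s -> s <= t -> 0 <= incr L s t <= incr l s t)
  (L_small : small 1 (incr l) (fun s t => incr L s t - h s * incr l s t)).

Let y1 t : 0 <= t -> 0 < 1 + y t.
Proof. by move=> t0; rewrite ltr_wpDr// y0. Qed.

Let h01 t : 0 <= t -> 0 <= h t <= 1.
Proof.
move=> t0; rewrite /h invr_ge0 (ltW (y1 t0))/= invf_le1 ?y1//.
by rewrite lerDl y0.
Qed.

Let h_norm t : 0 <= t -> `|h t| <= 1.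
Proof. by move=> t0; have /andP[h0 h1] := h01 t0; rewrite ger0_norm. Qed.

Let domL : dominated_by 1 (incr l) (incr L).
Proof.
move=> s t s0 st; have /andP[L1 L2] := L_incr s0 st.
by rewrite mul1r ger0_norm.
Qed.

Let oney_norm t : 0 <= t -> `|1 + y t| <= 1 + k.
Proof. by move=> t0; rewrite (le_trans (ler_normD _ _))// normr1 lerD2l yk. Qed.

Let k1 : 0 <= 1 + k. Proof. by rewrite addr_ge0. Qed.

(** With [r] the Taylor remainder of [expR] at the increment of [L], the error is [expR (- L s)]
    times the sum of [- (1 + y s) (dL - h s dl)], [- dy dL] and [(1 + y t) r]; the [dl] contained in
    [dy] cancels since [(1 + y s) * h s = 1]. The constant collects the bounds of these three
    terms. *)
Lemma exponential_expansion :
  small (1 * ((1 + k) * 1 + 2 * k * 1 + (1 + k) * (2 * k * 1))) (incr l) (fun s t =>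
    incr (fun u => (1 + y u) * expR (- L u)) s t - expR (- L s) * incr m s t).
Proof.
pose r s t := expR (- incr L s t) - 1 + incr L s t.
have r_small : small (2 * k * 1) (incr l) r.
  apply: (le_small (small_incr ltr01 uL Lk domL)) => s t s0 st.
  have /andP[L1 L2] := L_incr s0 st.
  apply: le_trans (expRN_taylor L1) _.
  by rewrite ger0_norm ?mulr_ge0.
pose c1 s t := - (1 + y s) * (incr L s t - h s * incr l s t).
have c1_small : small ((1 + k) * 1) (incr l) c1.
  by apply: (smallM k1 L_small) => s t s0 st; rewrite normrN oney_norm.
have c2_small := smallN (small_incr ltr01 uy yk domL).
have c3_small : small ((1 + k) * (2 * k * 1)) (incr l) (fun s t => (1 + y t) * r s t).
  by apply: (smallM k1 r_small) => s t s0 st; rewrite oney_norm// (le_trans s0).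
have D1 s t : 0 <= s -> s <= t -> `|expR (- L s)| <= 1.
  by move=> s0 _; rewrite ger0_norm ?expR_ge0// -expR0 ler_expR oppr_le0 L0.
have := smallM ler01 (smallD (smallD c1_small c2_small) c3_small) D1.
move=> /eq_small; apply => s t s0 st; have t0 := le_trans s0 st.
rewrite /c1 /r /incr (yml s0) (yml t0) -!(yml s0) -!(yml t0).
have -> : expR (- L t) = expR (- L s) * expR (- (L t - L s)) by rewrite -expRD; congr expR; ring.
rewrite /h (yml s0) (yml t0); field.
by rewrite -(yml s0) gt_eqF ?y1.
Qed.

Variables (q J : R -> R).
Hypotheses (q_nd : ray_nondecreasing q)
  (J_incr : forall s t, 0 <= s -> s <= t -> 0 <= incr J s t <= incr q s t)
  (J_small : small 1 (incr q) (fun s t => incr J s t - h s ^+ 2 * incr q s t)).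

Definition quadratic_clock s t : R := incr m s t ^+ 2 + (incr (fun u => l u + q u) s t).
Local Notation g := quadratic_clock.

Let l_le_g s t : 0 <= s -> s <= t -> 0 <= incr l s t <= g s t.
Proof.
move=> s0 st; have l1 := l_nd s0 st; have q1 := q_nd s0 st.
have := sqr_ge0 (incr m s t); rewrite /g /incr; move: (_ ^+ 2) => M M0.
by apply/andP; split; lra.
Qed.

Let q_le_g s t : 0 <= s -> s <= t -> 0 <= incr q s t <= g s t.
Proof.
move=> s0 st; have l1 := l_nd s0 st; have q1 := q_nd s0 st.
have := sqr_ge0 (incr m s t); rewrite /g /incr; move: (_ ^+ 2) => M M0.
by apply/andP; split; lra.
Qed.

Definition log_path t : R := ln (1 + y t) - L t + 2^-1 * J t.
Local Notation I := log_path.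

(** Heuristically [dI = h dm], but over a finite step the logarithm also produces
    [- h^2 / 2 (dm^2 - dq)]. That term has the order of the clock and is compensated in mean; this
    is what remains without it. *)
Definition log_error s t : R := incr I s t - h s * incr m s t +
  2^-1 * h s ^+ 2 * (incr m s t ^+ 2 - incr q s t).

Definition log_const : R :=
  (1 + k) * (2 * k * (2 + 4 * k)) + 1 + (1 * (2 * k * 1) + 1 * (2 * k * 1)) + 2^-1 * 1.

(** Expand [ln (1 + x)] to second order, with [x = h s dy] the relative increment of [1 + y]. The
    cubic remainder is [dy] times a square dominated by the clock; [h dl] cancels against [dL];
    [dm dl] and [dl^2] carry a continuous factor; [dJ - h^2 dq] is small by hypothesis. These groups
    are the four summands of [log_const]. *)
Lemma log_error_small : small log_const g log_error.
Proof.
(* From [(a + b)^2 <= 2 a^2 + 2 b^2] with [a = dm], [b = dl], and [b^2 <= 2 k b] because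
   [0 <= b <= 2 k]. *)
have y_sqr : dominated_by (2 + 4 * k) g (fun s t => incr y s t ^+ 2).
  move=> s t s0 st; have t0 := le_trans s0 st.
  have /andP[l1 l2] := l_le_g s0 st.
  have -> : incr y s t = incr m s t + incr l s t by rewrite /incr !yml//; ring.
  have lk2 : incr l s t <= 2 * k.
    apply: le_trans (ler_norm _) _; apply: le_trans (ler_normB _ _) _.
    by rewrite mulr_natl lerD ?lk.
  have mg : incr m s t ^+ 2 + incr l s t <= g s t.
    have q1 := q_nd s0 st.
    by rewrite /g lerD2l /incr; lra.
  move: lk2 mg l1; move: (incr m s t) (incr l s t) (g s t) => a b G b2k abG b0.
  rewrite ger0_norm ?sqr_ge0//.
  have b2 : b ^+ 2 <= 2 * k * b by rewrite expr2 ler_wpM2r.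
  have ka : 0 <= k * a ^+ 2 by rewrite mulr_ge0 ?sqr_ge0.
  have kG : (2 + 4 * k) * (a ^+ 2 + b) <= (2 + 4 * k) * G.
    by rewrite ler_wpM2l// addr_ge0// mulr_ge0.
  apply: le_trans kG; rewrite -subr_ge0.
  have -> : (2 + 4 * k) * (a ^+ 2 + b) - (a + b) ^+ 2 =
    (a - b) ^+ 2 + 4 * (k * a ^+ 2) + 2 * b + 2 * (2 * k * b - b ^+ 2) by ring.
  have := sqr_ge0 (a - b); move: ((a - b) ^+ 2) => A A0.
  by lra.
have C0 : 0 < 2 + 4 * k by rewrite ltr_wpDr// mulr_ge0.
have y3 := small_incr C0 uy yk y_sqr.
pose x s t := h s * incr y s t.
pose tl s t := ln (1 + x s t) - x s t + x s t ^+ 2 / 2.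
have xE s t : 0 <= s -> s <= t -> 1 + x s t = (1 + y t) / (1 + y s).
  move=> s0 st; rewrite /x /h /incr; field.
  by rewrite gt_eqF ?y1.
have x_norm s t : 0 <= s -> `|x s t| <= `|incr y s t|.
  by move=> s0; rewrite normrM ler_piMl// h_norm.
have tl_small : small ((1 + k) * (2 * k * (2 + 4 * k))) g tl.
  apply: (le_small (smallM k1 y3 (c := fun _ _ => 1 + k) _)) => [s t _ _|s t s0 st].
    by rewrite ger0_norm.
  have t0 := le_trans s0 st.
  have c0 : 0 < (1 + k)^-1 by rewrite invr_gt0 ltr_wpDr.
  have c1 : (1 + k)^-1 <= 1 by rewrite invf_le1 ?lerDl// ltr_wpDr.
  (* The lower bound that [ln_taylor] requires: [1 + x] is a quotient whose numerator is at least 1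
     and whose denominator is at most [1 + k]. *)
  have cx : (1 + k)^-1 <= 1 + x s t.
    rewrite xE// ler_pdivlMr ?y1// ler_pdivrMl; last by rewrite ltr_wpDr.
    have := yk s0; have := y0 s0; have := y0 t0; have := k0.
    rewrite ler_norml => a1 a2 a3 /andP[_ a4].
    have : 0 <= (1 + k) * y t by rewrite mulr_ge0.
    by rewrite mulrDr mulr1; lra.
  have := ln_taylor c0 c1 cx; rewrite [1 + x s t - 1]addrC addKr invrK => /le_trans; apply.
  rewrite [leRHS]normrM (ger0_norm k1) mulrC ler_wpM2l// exprS [leRHS]normrM normrX.
  apply: ler_pM => //; first exact: x_norm.
  by rewrite ler_sqr ?nnegrE// x_norm.
have L_small' : small 1 g (fun s t => h s * incr l s t - incr L s t).
  have := small_le L_small ler01 (lexx 1) l_le_g.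
  move=> /smallN/eq_small; apply => s t _ _; ring.
have l_dom : dominated_by 1 g (incr l).
  by move=> s t s0 st; have /andP[l1 l2] := l_le_g s0 st; rewrite mul1r ger0_norm.
have ml_small := small_incr ltr01 um mk l_dom.
have ll_small := small_incr ltr01 ul lk l_dom.
have hh_bd s t : 0 <= s -> s <= t -> `|- 2^-1 * h s ^+ 2| <= 1.
  move=> s0 st; rewrite normrM normrN normrX (@ger0_norm _ 2^-1) ?invr_ge0//.
  apply: mulr_ile1; [by rewrite invr_ge0|exact: exprn_ge0|by rewrite invf_le1 ?ler1n|].
  by rewrite exprn_ile1 ?h_norm.
have h2_bd s t : 0 <= s -> s <= t -> `|- h s ^+ 2| <= 1.
  by move=> s0 st; rewrite normrN normrX exprn_ile1// h_norm.
have mixed_small := smallD (smallM ler01 ml_small h2_bd) (smallM ler01 ll_small hh_bd).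
have J_small' : small (2^-1 * 1) g (fun s t => 2^-1 * (incr J s t - h s ^+ 2 * incr q s t)).
  apply: smallM => //; first exact: (small_le J_small ler01 (lexx 1) q_le_g).
  by move=> s t _ _; rewrite ger0_norm.
have := smallD (smallD (smallD tl_small L_small') mixed_small) J_small'.
move=> /eq_small; apply => s t s0 st; have t0 := le_trans s0 st.
rewrite /log_error /log_path /tl xE// ln_div ?posrE ?y1// /x.
have -> : incr y s t = incr m s t + incr l s t by rewrite /incr !yml//; ring.
by rewrite /incr; field.
Qed.

(** Domination only, because the compensated square is put back; it suffices once multiplied by an
    increment of the continuous [N]. *)
Lemma log_increment_dominated : dominated_by (log_const + 1) g
  (fun s t => incr I s t - h s * incr m s t).
Proof.
have [dom _] := log_error_small; move=> s t s0 st.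
have -> : incr I s t - h s * incr m s t = log_error s t -
    2^-1 * h s ^+ 2 * (incr m s t ^+ 2 - incr q s t) by rewrite /log_error; ring.
apply: le_trans (ler_normB _ _) _; rewrite mulrDl lerD ?dom// mul1r.
have l1 := l_nd s0 st; have q1 := q_nd s0 st.
have h2 : `|2^-1 * h s ^+ 2| <= 1.
  rewrite normrM normrX (@ger0_norm _ 2^-1) ?invr_ge0//.
  apply: mulr_ile1; [by rewrite invr_ge0|exact: exprn_ge0|by rewrite invf_le1 ?ler1n|].
  by rewrite exprn_ile1 ?h_norm.
rewrite normrM; apply: le_trans (ler_piMl _ h2) _ => //.
apply: le_trans (ler_normB _ _) _.
rewrite ger0_norm ?sqr_ge0// /g lerD2l ger0_norm ?subr_ge0 ?q_nd//.
by rewrite /incr; lra.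
Qed.

Variables (N A1 A2 J1 J2 : R -> R).
Hypotheses (uN : upath N) (Nk : forall t, 0 <= t -> `|N t| <= k)
  (A1_nd : ray_nondecreasing A1) (A2_nd : ray_nondecreasing A2)
  (J1_small : small 1 (incr A1) (fun s t => incr J1 s t - h s * incr A1 s t))
  (J2_small : small 1 (incr A2) (fun s t => incr J2 s t - h s * incr A2 s t)).

Definition product_clock s t : R :=
  incr m s t ^+ 2 + incr (fun u => l u + q u + A1 u + A2 u) s t.

(** The expression is the right-hand side of [product_identity] below: an increment of [N] times a
    dominated term, and the errors of two Stieltjes integrals. *)
Lemma product_expansion : small (2 * k * (log_const + 1) + 1 + 1) product_clock (fun s t =>
  incr N s t * (incr I s t - h s * incr m s t) -
  (incr J1 s t - h s * incr A1 s t) + (incr J2 s t - h s * incr A2 s t)).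
Proof.
have lc0 : 0 < log_const + 1.
  rewrite ltr_wpDl// /log_const; have := k0; have := k1.
  by move=> *; rewrite !addr_ge0 ?mulr_ge0 ?addr_ge0 ?mulr_ge0.
have le_clock s t : 0 <= s -> s <= t -> [/\ 0 <= g s t <= product_clock s t,
    0 <= incr A1 s t <= product_clock s t & 0 <= incr A2 s t <= product_clock s t].
  move=> s0 st; have := sqr_ge0 (incr m s t).
  have := l_nd s0 st; have := q_nd s0 st; have := A1_nd s0 st; have := A2_nd s0 st.
  rewrite /product_clock /quadratic_clock /incr; move: (_ ^+ 2) => *.
  by split; apply/andP; split; lra.
apply: smallD; first apply: smallD.
- apply: small_le (lexx _) _; [exact: (small_incr lc0 uN Nk log_increment_dominated)| |].
    by rewrite mulr_ge0 ?mulr_ge0// ltW.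
  by move=> s t s0 st; have [] := le_clock _ _ s0 st.
- apply: smallN; apply: small_le J1_small ler01 (lexx 1) _.
  by move=> s t s0 st; have [] := le_clock _ _ s0 st.
- apply: small_le J2_small ler01 (lexx 1) _.
  by move=> s t s0 st; have [] := le_clock _ _ s0 st.
Qed.

End PathExpansions.

(** * The quotient of two increasing processes *)

Section RatioExpansion.
Context {R : realType}.
Local Notation upath := uniformly_continuous_path.
Variables (k : R) (M E C : R -> R).
Hypotheses (k0 : 0 <= k) (uE : upath E) (uC : upath C)
  (Mk : forall t, 0 <= t -> `|M t| <= k) (Ek : forall t, 0 <= t -> `|E t| <= k)
  (E_nd : ray_nondecreasing E) (C_nd : ray_nondecreasing C)
  (C1 : forall t, 0 <= t -> 1 <= C t).
Let Q t := E t / C t.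

Lemma ratio_upath : upath Q.
Proof.
apply: upathM => //; apply: (upath_comp (g := fun x => x^-1) (I := [set x | 1 <= x]) uC) => //.
move=> x; rewrite inE /= => x1; apply: inv_continuous.
by rewrite gt_eqF// (lt_le_trans ltr01).
Qed.

Lemma ratio_bounded t : 0 <= t -> `|Q t| <= k.
Proof.
move=> t0; have c1 := C1 t0; have c0 := lt_le_trans ltr01 c1.
rewrite /Q normrM normfV ler_pdivrMr ?normr_gt0 ?gt_eqF//.
by apply: le_trans (Ek t0) _; rewrite ler_peMr// (le_trans c1)// ler_norm.
Qed.

(** [Q] has finite variation: as [C >= 1], its increments are dominated by those of [E + C]. One of
    the two factors of the square is then a continuous increment. *)
Lemma ratio_sqr_small : small (k * (2 * k * (1 + k))) (incr (fun u => E u + C u))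
  (fun s t => M t * (incr Q s t) ^+ 2).
Proof.
have dom : dominated_by (1 + k) (incr (fun u => E u + C u)) (incr Q).
  move=> s t s0 st; have t0 := le_trans s0 st.
  have c1 := C1 s0; have c1' := C1 t0.
  have c0 := lt_le_trans ltr01 c1; have c0' := lt_le_trans ltr01 c1'.
  have -> : incr Q s t = incr E s t / C t - E s * incr C s t / (C s * C t).
    by rewrite /incr /Q; field; rewrite !gt_eqF.
  have e1 := E_nd s0 st; have c2 := C_nd s0 st.
  have e0 : 0 <= incr E s t by rewrite subr_ge0.
  have ci0 : 0 <= incr C s t by rewrite subr_ge0.
  apply: (@le_trans _ _ (incr E s t + k * incr C s t)).
    apply: le_trans (ler_normB _ _) _; apply: lerD.
      rewrite normrM normfV ger0_norm// (gtr0_norm c0').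
      by rewrite ler_pdivrMr// ler_peMr.
    rewrite normrM normfV normrM (ger0_norm ci0) (@gtr0_norm _ (C s * C t)) ?mulr_gt0//.
    rewrite ler_pdivrMr ?mulr_gt0//; apply: (@le_trans _ _ (k * incr C s t)).
      by rewrite ler_wpM2r ?Ek.
    by rewrite ler_peMr ?mulr_ge0// mulr_ege1.
  have -> : incr (fun u => E u + C u) s t = incr E s t + incr C s t by rewrite /incr; ring.
  rewrite -subr_ge0.
  have -> : (1 + k) * (incr E s t + incr C s t) - (incr E s t + k * incr C s t) =
    incr C s t + k * incr E s t by ring.
  by rewrite addr_ge0// mulr_ge0.
have k1 : 0 < 1 + k by rewrite ltr_wpDr.
apply: (smallM k0 (small_incr k1 ratio_upath ratio_bounded dom)).
by move=> s t s0 st; apply: Mk; exact: le_trans st.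
Qed.

End RatioExpansion.

(** * The multiplicative decomposition *)

Section Localization.
Context {d : measure_display} {T : measurableType d} {R : realType}.
Variable P : probability T R.
Variable F : R -> set (set T).
Hypothesis usualF : usual_conditions P F.
Let filtF : filtration F. Proof. by have [] := usualF. Qed.
Local Notation upath := uniformly_continuous_path.
Variables (Om : set T).
Hypotheses (FOm : F 0 Om) (nOm : P.-negligible (~` Om)).

Definition cadapted (X : R -> T -> R) := adapted F X /\ forall w, Om w -> upath (X ^~ w).

Lemma ae_on (Q : T -> Prop) : (forall w, Om w -> Q w) -> {ae P, forall w, Q w}.
Proof. by move=> H; apply: negligibleS nOm => w /= nQ Omw; apply: nQ; exact: H. Qed.

Lemma cadaptedD X Y : cadapted X -> cadapted Y -> cadapted (fun t w => X t w + Y t w).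
Proof.
move=> [aX cX] [aY cY]; split=> [t t0|w Omw]; last by apply: upathD; [exact: cX|exact: cY].
by apply: (measurable_wrtD (filt_sigma filtF t0)); [exact: aX|exact: aY].
Qed.

Lemma cadaptedM X Y : cadapted X -> cadapted Y -> cadapted (fun t w => X t w * Y t w).
Proof.
move=> [aX cX] [aY cY]; split=> [t t0|w Omw]; last by apply: upathM; [exact: cX|exact: cY].
by apply: (measurable_wrtM (filt_sigma filtF t0)); [exact: aX|exact: aY].
Qed.

Lemma cadapted_cst c : cadapted (fun _ _ => c).
Proof.
split=> [t t0|w _]; last exact: upath_cst.
exact: (measurable_wrt_cst (filt_sigma filtF t0)).
Qed.

Lemma cadaptedN X : cadapted X -> cadapted (fun t w => - X t w).
Proof.
move=> [aX cX]; split=> [t t0|w Omw]; last by apply: upathN; exact: cX.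
by apply: (measurable_wrtN (filt_sigma filtF t0)); exact: aX.
Qed.

Lemma cadaptedB X Y : cadapted X -> cadapted Y -> cadapted (fun t w => X t w - Y t w).
Proof. by move=> nX nY; apply: cadaptedD => //; exact: cadaptedN. Qed.

Lemma cadaptedX X n : cadapted X -> cadapted (fun t w => X t w ^+ n).
Proof.
move=> [aX cX]; split=> [t t0|w Omw]; last by apply: upathX; exact: cX.
by apply: (measurable_wrtX (filt_sigma filtF t0)); exact: aX.
Qed.

Lemma cadapted_norm X : cadapted X -> cadapted (fun t w => `|X t w|).
Proof.
move=> [aX cX]; split=> [t t0|w Omw]; last by apply: upath_norm; exact: cX.
by apply: (measurable_wrt_comp (filt_sigma filtF t0) (k := fun x => `|x|)); [exact: normr_measurable|exact: aX].
Qed.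

Lemma cadapted_expR X : cadapted X -> cadapted (fun t w => expR (X t w)).
Proof.
move=> [aX cX]; split=> [t t0|w Omw].
  by apply: (measurable_wrt_comp (filt_sigma filtF t0)); [exact: measurable_expR|exact: aX].
apply: (upath_comp (g := @expR R) (I := setT) (cX w Omw)) => // x _.
exact: continuous_expR.
Qed.

Lemma cadapted_ln X : cadapted X -> (forall w t, Om w -> 0 <= t -> 0 < X t w) ->
  cadapted (fun t w => ln (X t w)).
Proof.
move=> [aX cX] X0; split=> [t t0|w Omw].
  by apply: (measurable_wrt_comp (filt_sigma filtF t0)); [exact: measurable_ln|exact: aX].
apply: (upath_comp (g := @ln R) (I := [set x | 0 < x]) (cX w Omw)) => [t t0|x].
  exact: X0.
by rewrite inE => x0; exact: continuous_ln.
Qed.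

Lemma eq_cadapted X Y : cadapted X -> (forall w t, Om w -> 0 <= t -> X t w = Y t w) -> cadapted Y.
Proof.
move=> [aX cX] XY; split=> [t t0|w Omw].
  by apply: (measurable_wrt_ae usualF t0 (aX t t0)); apply: ae_on => w Omw; exact: XY.
by apply: eq_upath (cX w Omw) => t t0; exact: XY.
Qed.

(** On [Om] the inverse is [expR (- ln X)]. *)
Lemma cadapted_inv X : cadapted X -> (forall w t, Om w -> 0 <= t -> 0 < X t w) ->
  cadapted (fun t w => (X t w)^-1).
Proof.
move=> nX X0; apply: (eq_cadapted (cadapted_expR (cadaptedN (cadapted_ln nX X0)))) => w t Omw t0.
by rewrite expRN lnK// posrE; exact: X0.
Qed.

(** Adaptedness comes from left-endpoint Riemann sums. They are known to converge on [Om] only,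
    whence the factor [\1_Om] and the passage to an almost surely equal variable. *)
Lemma cadapted_integral a h : cadapted a -> cadapted h ->
  (forall w, Om w -> ray_nondecreasing (a ^~ w)) -> cadapted (stieltjes_integral h a).
Proof.
move=> [aa ca] [ah ch] nda; split; last first.
  by move=> w Omw; apply: (upath_integral (ca w Omw) (nda w Omw) (ch w Omw)).
move=> t t0; have sF := filt_sigma filtF t0.
pose u n i : R := t * i%:R / n.+1%:R.
have u0 n i : 0 <= u n i by rewrite divr_ge0// mulr_ge0.
have ut n i : (i <= n.+1)%N -> u n i <= t.
  by move=> inn; rewrite /u ler_pdivrMr// ler_wpM2l// ler_nat.
pose f n w := \1_Om w * \sum_(i < n.+1) h (u n i) w * (a (u n i.+1) w - a (u n i) w).
have FtOm : F t Om by exact: (filt_sub filtF (lexx 0) t0).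
apply: (@measurable_wrt_ae _ _ _ _ _ usualF (fun w => \1_Om w * stieltjes_integral h a t w)) => //; last first.
  by apply: ae_on => w Omw; rewrite indicE mem_set// mul1r.
apply: (@measurable_wrt_cvg _ _ _ _ sF f) => [n|w].
  apply: (measurable_wrtM sF); first exact: (measurable_wrt_indic sF).
  apply: (measurable_wrt_sum sF) => i _; apply: (measurable_wrtM sF).
    by apply: (adapted_later filtF ah) => //; apply: ut; exact: ltnW.
  apply: (measurable_wrtB sF); first by apply: (adapted_later filtF aa) => //; exact: ut.
  by apply: (adapted_later filtF aa) => //; apply: ut; exact: ltnW.
rewrite /f indicE; case: (boolP (w \in Om)) => [|_]; last first.
  by rewrite mul0r; under eq_fun do rewrite mul0r; exact: cvg_cst.
rewrite inE => Omw; rewrite mul1r; under eq_fun do rewrite mul1r.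
exact: (path_integral_riemann (ca w Omw) (nda w Omw) (ch w Omw) t0).
Qed.

(** Outside one null set the processes agree at all nonnegative rational times, and continuity does
    the rest; [u t j] is the fraction of denominator [j.+1] just below [t]. *)
Lemma cadapted_indistinguishable X X' : cadapted X -> cadapted X' ->
  (forall t, 0 <= t -> {ae P, forall w, X t w = X' t w}) ->
  indistinguishable P X X'.
Proof.
move=> [_ cX] [_ cX'] XX'.
pose u (t : R) j := (Num.truncn (t * j.+1%:R))%:R / j.+1%:R : R.
have u_cvg t : 0 <= t -> u t j @[j --> \oo] --> t.
  move=> t0; apply/cvgrPdist_lt => eps eps0.
  have /cvgrPdist_lt/(_ _ eps0) lim := @cvg_harmonic R.
  near=> j.
  have j0 : 0 < j.+1%:R :> R by [].
  have /truncn_itv/andP[i1 i2] : 0 <= t * j.+1%:R by rewrite mulr_ge0.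
  have u1 : u t j <= t by rewrite /u ler_pdivrMr.
  have u2 : t < u t j + j.+1%:R^-1.
    by rewrite /u -[X in _ + X]mul1r -mulrDl ltr_pdivlMr// natr1.
  have : `|0 - j.+1%:R^-1| < eps :> R.
    by near: j.
  rewrite sub0r normrN (@ger0_norm _ j.+1%:R^-1) ?invr_ge0// => u3.
  by rewrite ger0_norm ?subr_ge0// ltrBlDl (lt_trans u2)// ltrD2l.
have H : {ae P, forall w, forall i j : nat, X (i%:R / j.+1%:R) w = X' (i%:R / j.+1%:R) w}.
  by apply: ae_foralln => i; apply: ae_foralln => j; apply: XX'; rewrite divr_ge0.
have HO : {ae P, forall w, Om w} by exact: ae_on.
apply: filterS2 HO H => w Omw H t t0.
have u0 j : 0 <= u t j by rewrite divr_ge0.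
have l1 := upath_cvg (cX w Omw) u0 t0 (u_cvg t t0).
have l2 := upath_cvg (cX' w Omw) u0 t0 (u_cvg t t0).
have l1' : X (u t n) w @[n --> \oo] --> X' t w by under eq_fun do rewrite H; exact: l2.
exact: cvg_unique l1 l1'.
Unshelve. all: by end_near. Qed.

Section NormSum.
Variable Xs : seq (R -> T -> R).
Let X0 : R -> T -> R := fun _ _ => 0.
Hypothesis nXs : forall i, (i < size Xs)%N -> cadapted (nth X0 Xs i).

(** The process whose hitting times localize. The list lets each application choose what must become
    bounded, integrands included. *)
Definition norm_sum t w : R := \sum_(i < size Xs) `|nth X0 Xs i t w|.

Lemma cadapted_norm_sum : cadapted norm_sum.
Proof.
suff H n : (n <= size Xs)%N -> cadapted (fun t w => \sum_(i < n) `|nth X0 Xs i t w|) by exact: H.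
elim: n => [_|n ih nX].
  by apply: (eq_cadapted (cadapted_cst 0)) => w t _ _; rewrite big_ord0.
have := cadaptedD (ih (ltnW nX)) (cadapted_norm (nXs nX)).
by move/eq_cadapted; apply => w t _ _; rewrite big_ord_recr.
Qed.

Variable n : nat.
Local Notation rho := (hitting_time Om norm_sum n%:R).

Let rho_st : stopping_time F rho.
Proof. by apply: hitting_time_stopping => //; have [] := cadapted_norm_sum. Qed.

Lemma stopped_le i w t : (i < size Xs)%N -> live Om rho w -> 0 <= t ->
  `|nth X0 Xs i (clamp t (rho w)) w| <= n%:R.
Proof.
move=> iX [Omw r0] t0; have [c0 ct cr] := clampP t0 (ltW r0).
have [_ cS] := cadapted_norm_sum.
apply: le_trans (le_hitting_time cS Omw r0 c0 cr).
rewrite /norm_sum (bigD1 (Ordinal iX))//= lerDl.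
by apply: sumr_ge0.
Qed.

Lemma hat_le i w t : (i < size Xs)%N -> 0 <= t ->
  `|hat Om rho (nth X0 Xs i) t w| <= n%:R.
Proof.
move=> iX t0; have [lw|nlw] := pselect (live Om rho w).
  by rewrite hat_live//; exact: stopped_le.
by rewrite hat_dead// normr0.
Qed.

End NormSum.
End Localization.

(** * Increments as martingale terms plus an error *)

Section Identities.
Context {R : realType}.

(** With [W = m^2 - q], [dm^2 - dq = dW - 2 m dm]; the factor [h + h^2 m] of [dm] results from
    this. *)
Lemma log_identity (i0 i1 h m0 m1 q0 q1 : R) :
  (i1 - i0) - ((h + h ^+ 2 * m0) * (m1 - m0) +
    (- 2^-1 * h ^+ 2) * ((m1 ^+ 2 - q1) - (m0 ^+ 2 - q0))) =
  i1 - i0 - h * (m1 - m0) + 2^-1 * h ^+ 2 * ((m1 - m0) ^+ 2 - (q1 - q0)).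
Proof. by field. Qed.

(** Integration by parts: in [d(I N) = I dN + N dI + dI dN] the last term is replaced by
    [h dm dN = h (d(m N) - m dN - N dm)], and [m N - (a - b)] is the compensated product. *)
Lemma product_identity (i0 i1 n0 n1 h m0 m1 a0 a1 b0 b1 j0 j1 k0 k1 : R) :
  ((i1 * n1 - (j1 - k1)) - (i0 * n0 - (j0 - k0))) -
    ((i0 - h * m0) * (n1 - n0) + n0 * (i1 - i0) + - (h * n0) * (m1 - m0) +
     h * ((m1 * n1 - (a1 - b1)) - (m0 * n0 - (a0 - b0)))) =
  (n1 - n0) * ((i1 - i0) - h * (m1 - m0)) - ((j1 - j0) - h * (a1 - a0)) +
    ((k1 - k0) - h * (b1 - b0)).
Proof. by ring. Qed.

(** Both [M] and [M Q] being martingales after stopping, [M Q^2] is expanded along these two; only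
    the squared increment of [Q] is left. *)
Lemma ratio_identity (m0 m1 n0 n1 q0 q1 : R) : n0 = m0 * q0 -> n1 = m1 * q1 ->
  (m1 * q1 ^+ 2 - m0 * q0 ^+ 2) -
    (2 * q0 * (n1 - n0) + - q0 ^+ 2 * (m1 - m0)) = m1 * (q1 - q0) ^+ 2.
Proof. by move=> -> ->; ring. Qed.

End Identities.

(** * The martingale criterion for stopped processes *)

Section HatCriterion.
Context {d : measure_display} {T : measurableType d} {R : realType}.
Variable P : probability T R.
Variable F : R -> set (set T).
Hypothesis usualF : usual_conditions P F.
Let filtF : filtration F. Proof. by have [] := usualF. Qed.
Local Notation upath := uniformly_continuous_path.
Variables (Om : set T) (rho : T -> \bar R).
Hypotheses (FOm : F 0 Om) (rho_st : stopping_time F rho).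
Local Notation hat := (hat Om rho).
Local Notation live := (live Om rho).
Let rho0 w : (0 <= rho w)%E. Proof. by case: rho_st. Qed.

(** Off [live] all the stopped processes and the error vanish, so estimates are needed on good paths
    only. A single [K] bounds the processes and dominates the error, hence instances such as
    [K := k + c]. *)
Lemma hat_criterion (K : R) (m v Z : R -> T -> R) (e : R -> R -> T -> R) :
  cadapted F Om m -> cadapted F Om v -> cadapted F Om Z -> local_martingale P F m ->
  (forall t w, 0 <= t -> `|hat m t w| <= K) ->
  (forall t w, 0 <= t -> `|hat v t w| <= K) ->
  (forall t w, 0 <= t -> `|hat Z t w| <= K) ->
  (forall w, Om w -> ray_nondecreasing (v ^~ w)) ->
  (forall s t, 0 <= s -> s <= t ->
    centered P (F s) (fun w => hat Z t w - hat Z s w - e s t w)) ->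
  (forall w, live w -> small K
    (fun s t => clock m v w (clamp s (rho w)) (clamp t (rho w)))
    (fun s t => e s t w)) ->
  (forall s t w, 0 <= s -> s <= t -> ~ live w -> e s t w = 0) ->
  martingale P F (hat Z).
Proof.
move=> [am cm] [av cv] [aZ cZ] mm mK vK ZK v_nd Ze e_small e0.
have K0 : 0 <= K by apply: le_trans (mK 0 point (lexx 0)).
have hv_nd w : ray_nondecreasing (hat v ^~ w).
  move=> s t s0 st; have [lw|nlw] := pselect (live w); last by rewrite !hat_dead.
  rewrite !hat_live//; have [Omw _] := lw; have [c0 _ _] := clampP s0 (rho0 w).
  by apply: (v_nd _ Omw) => //; have /andP[] := clamp_lip s0 st (rho0 w); rewrite subr_ge0.
have sm w : small K (clock (hat m) (hat v) w) (fun s t => e s t w).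
  have [lw|nlw] := pselect (live w).
    have [dom neg] := e_small w lw.
    split=> [s t s0 st|U eps eps0].
      by rewrite /clock !hat_live//; exact: dom.
    have [del del0 H] := neg U eps eps0; exists del => // s t s0 st tU ts.
    by rewrite /clock !hat_live//; exact: H.
  split=> [s t s0 st|U eps eps0].
    by rewrite e0// /clock !hat_dead// !subrr expr0n/= addr0 mulr0 normr0.
  exists 1 => // s t s0 st tU ts.
  by rewrite e0// /clock !hat_dead// !subrr expr0n/= addr0 mulr0 normr0.
apply: (@martingale_criterion _ _ _ P F filtF K (hat m) (hat Z) (hat v) e) => //.
- exact: (local_hat_martingale usualF FOm rho_st mm cm mK).
- exact: (hat_adapted filtF FOm rho_st aZ cZ).
- exact: (hat_adapted filtF FOm rho_st av cv).
- by move=> w; have [] := sm w.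
- by move=> w; have [] := sm w.
Qed.

Lemma centered_hat (C : R) (V : R -> T -> R) (N : R -> T -> R) (s t : R) :
  cadapted F Om V -> martingale P F (hat N) ->
  (forall w, `|hat V s w| <= C) -> 0 <= s -> s <= t ->
  centered P (F s) (fun w => hat V s w * (hat N t w - hat N s w)).
Proof.
move=> [aV cV] mN VC s0 st.
apply: (@centeredM _ _ _ P (F s) (filt_sigma filtF s0) (filt_measurable filtF s0) C) => //.
- exact: (hat_adapted filtF FOm rho_st aV cV).
- exact: (centered_increment filtF mN).
Qed.

End HatCriterion.

(** * Existence: the process [M] *)

Section BaseProcesses.
Context {d : measure_display} {T : measurableType d} {R : realType}.
Variable P : probability T R.
Variable F : R -> set (set T).
Hypothesis usualF : usual_conditions P F.
Let filtF : filtration F. Proof. by have [] := usualF. Qed.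
Local Notation upath := uniformly_continuous_path.
Variables (Om : set T).
Hypotheses (FOm : F 0 Om) (nOm : P.-negligible (~` Om)).
Local Notation cadapted := (cadapted F Om).

Variables (Y m l : R -> T -> R).
Hypotheses (nY : cadapted Y) (nm : cadapted m) (nl : cadapted l)
  (Y_ge0 : forall w t, Om w -> 0 <= t -> 0 <= Y t w)
  (Yml : forall w t, Om w -> 0 <= t -> Y t w = m t w + l t w)
  (l_nd : forall w, Om w -> ray_nondecreasing (l ^~ w))
  (mm : local_martingale P F m).

Let H t w := (1 + Y t w)^-1.
Let L := stieltjes_integral H l.
Let M t w := (Y t w + 1) * expR (- L t w).

Lemma onePlus_gt0 w t : Om w -> 0 <= t -> 0 < 1 + Y t w.
Proof. by move=> Omw t0; rewrite ltr_wpDr// Y_ge0. Qed.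

Lemma cadapted_H : cadapted H.
Proof.
apply: (cadapted_inv usualF nOm) => [|w t]; last exact: onePlus_gt0.
by apply: (cadaptedD usualF) => //; exact: (cadapted_cst usualF).
Qed.

Lemma cadapted_L : cadapted L.
Proof. by apply: (cadapted_integral usualF FOm nOm) => //; exact: cadapted_H. Qed.

Lemma H01 w t : Om w -> 0 <= t -> 0 <= H t w <= 1.
Proof.
move=> Omw t0; have y1 := onePlus_gt0 Omw t0; rewrite invr_ge0 (ltW y1)/= invf_le1//.
by rewrite lerDl Y_ge0.
Qed.

Lemma stieltjes_integral_ge0 h a w t : cadapted h -> cadapted a -> Om w -> ray_nondecreasing (a ^~ w) ->
  (forall u, 0 <= u -> 0 <= h u w) -> 0 <= t -> 0 <= stieltjes_integral h a t w.
Proof.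
move=> [ah ch] [aa ca] Omw nda h0 t0.
have := path_integral_nd (ca _ Omw) nda (ch _ Omw) h0 (lexx 0) t0.
by rewrite path_integral0.
Qed.

Lemma L_ge0 w t : Om w -> 0 <= t -> 0 <= L t w.
Proof.
move=> Omw t0; apply: stieltjes_integral_ge0 => //; [exact: cadapted_H|exact: l_nd|].
by move=> u u0; have /andP[] := H01 Omw u0.
Qed.

Lemma cadapted_M : cadapted M.
Proof.
apply: (cadaptedM usualF); last by apply: (cadapted_expR usualF); apply: (cadaptedN usualF); exact: cadapted_L.
by apply: (cadaptedD usualF) => //; exact: (cadapted_cst usualF).
Qed.

Lemma stopped_integral_small h a w (r : \bar R) : cadapted h -> cadapted a -> Om w ->
  ray_nondecreasing (a ^~ w) -> (forall t, 0 <= t -> 0 <= h t w <= 1) -> (0 <= r)%E ->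
  small 1 (incr (fun t => a (clamp t r) w))
    (fun s t => incr (fun u => stieltjes_integral h a (clamp u r) w) s t -
       h (clamp s r) w * incr (fun u => a (clamp u r) w) s t).
Proof.
move=> [_ ch] [_ ca] Omw nda h01 r0.
apply: (small_time_change (f := fun t => clamp t r)
  (path_integral_small (ca _ Omw) nda (ch _ Omw) h01)) => [t t0|s t s0 st].
  by have [-> ->] := clampP t0 r0.
exact: clamp_lip.
Qed.

Lemma stopped_integral_incr h a w (r : \bar R) : cadapted h -> cadapted a -> Om w ->
  ray_nondecreasing (a ^~ w) -> (forall t, 0 <= t -> 0 <= h t w <= 1) -> (0 <= r)%E ->
  forall s t, 0 <= s -> s <= t ->
  0 <= incr (fun u => stieltjes_integral h a (clamp u r) w) s t
    <= incr (fun t => a (clamp t r) w) s t.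
Proof.
move=> [_ ch] [_ ca] Omw nda h01 r0 s t s0 st.
have [c0 _ _] := clampP s0 r0.
apply: (path_integral_incr (ca _ Omw) nda (ch _ Omw) h01 c0).
by have /andP[] := clamp_lip s0 st r0; rewrite subr_ge0.
Qed.

Lemma stopped_nd (a : R -> R) (r : \bar R) : (0 <= r)%E -> ray_nondecreasing a ->
  ray_nondecreasing (fun t => a (clamp t r)).
Proof.
move=> r0 nda s t s0 st; have [c0 _ _] := clampP s0 r0.
by apply: nda => //; have /andP[] := clamp_lip s0 st r0; rewrite subr_ge0.
Qed.

Lemma M_local_martingale : local_martingale P F M.
Proof.
pose Xs := [:: Y; m; l; L; M].
have nXs i : (i < size Xs)%N -> cadapted (nth (fun _ _ => 0) Xs i).
  by case: i => [|[|[|[|[|]]]]]// _; [exact: cadapted_L|exact: cadapted_M].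
have nS := cadapted_norm_sum usualF nOm nXs.
apply: (hat_local_martingale usualF FOm nOm nS.1 nS.2 cadapted_M.1) => n.
set rho := hitting_time _ _ _.
have rho_st : stopping_time F rho by exact: (hitting_time_stopping filtF FOm nS.1 nS.2).
have rho0 w : (0 <= rho w)%E by case: rho_st.
have bound i w t : (i < size Xs)%N -> live Om rho w -> 0 <= t ->
    `|nth (fun _ _ => 0) Xs i (clamp t (rho w)) w| <= n%:R.
  exact: (stopped_le usualF nOm nXs).
have hat_bound i t w : (i < size Xs)%N -> 0 <= t ->
    `|hat Om rho (nth (fun _ _ => 0) Xs i) t w| <= n%:R.
  exact: (hat_le usualF nOm nXs).
pose k : R := n%:R.
have k0 : 0 <= k by [].
pose c := 1 * ((1 + k) * 1 + 2 * k * 1 + (1 + k) * (2 * k * 1)).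
have c0 : 0 <= c by rewrite mulr_ge0 ?addr_ge0 ?mulr_ge0 ?addr_ge0.
have kK : k <= k + c by rewrite lerDl.
pose D t w := expR (- L t w).
have nD : cadapted D by apply: (cadapted_expR usualF); apply: (cadaptedN usualF); exact: cadapted_L.
have mhat : martingale P F (hat Om rho m).
  apply: (local_hat_martingale usualF FOm rho_st (K := k) mm nm.2) => t w t0.
  exact: (hat_bound 1%N t w isT t0).
(* The error is defined as the increment minus its martingale part. Centering is then immediate, and
   all the analysis goes into the smallness of the error. The later uses of [hat_criterion] follow
   the same pattern. *)
apply: (hat_criterion usualF FOm rho_st (K := k + c) (m := m) (v := l)
  (e := fun s t w => (hat Om rho M t w - hat Om rho M s w) -
     hat Om rho D s w * (hat Om rho m t w - hat Om rho m s w))) => //.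
- exact: cadapted_M.
- by move=> t w t0; apply: le_trans kK; exact: (hat_bound 1%N t w isT t0).
- by move=> t w t0; apply: le_trans kK; exact: (hat_bound 2%N t w isT t0).
- by move=> t w t0; apply: le_trans kK; exact: (hat_bound 4%N t w isT t0).
- move=> s t s0 st.
  have := centered_hat usualF FOm rho_st (C := 1) (V := D) (N := m) nD mhat _ s0 st.
  have D1 w : `|hat Om rho D s w| <= 1.
    have [lw|nlw] := pselect (live Om rho w); last by rewrite hat_dead// normr0.
    have [Omw _] := lw; have [cs0 _ _] := clampP s0 (rho0 w).
    by rewrite hat_live// ger0_norm ?expR_ge0// -expR0 ler_expR oppr_le0 L_ge0.
  by move=> /(_ D1); congr (centered _ _ _); apply/funext => w; rewrite subKr.
- move=> w lw; have [Omw _] := lw; have r0 := rho0 w.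
  have cl t : 0 <= t -> 0 <= clamp t (rho w) by move=> t0; have [] := clampP t0 r0.
  have cont X : cadapted X -> upath (fun t => X (clamp t (rho w)) w).
    by move=> [_ cX]; exact: (upath_stopped r0 (cX w Omw)).
  have HH : forall t, 0 <= t -> 0 <= H t w <= 1 by move=> t t0; exact: H01.
  have := @exponential_expansion _ k (fun t => Y (clamp t (rho w)) w)
    (fun t => m (clamp t (rho w)) w) (fun t => l (clamp t (rho w)) w)
    (fun t => L (clamp t (rho w)) w) k0.
  move=> /(_ (fun t t0 => Y_ge0 Omw (cl t t0)) (fun t t0 => Yml Omw (cl t t0))
    (cont _ nY) (cont _ cadapted_L) (fun t t0 => bound 0%N w t isT lw t0)
    (fun t t0 => bound 3%N w t isT lw t0) (fun t t0 => L_ge0 Omw (cl t t0))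
    (stopped_integral_incr cadapted_H nl Omw (l_nd Omw) HH r0)
    (stopped_integral_small cadapted_H nl Omw (l_nd Omw) HH r0)).
  move=> sm; apply: (@eq_small _ _ _ _ _ (small_le sm c0 _ _)).
  + by rewrite lerDr.
  + move=> s t s0 st; rewrite /clock /incr subr_ge0.
    have -> := stopped_nd r0 (l_nd Omw) s0 st.
    by rewrite lerDr sqr_ge0.
  + move=> s t s0 st; rewrite !hat_live// /incr /M /D.
    by rewrite ![Y _ _ + 1]addrC.
- by move=> s t w s0 st nlw; rewrite !hat_dead// !subrr mulr0 subrr.
Qed.

(** * The logarithm of [M] as a stochastic integral *)

Section Logarithm.
Variable q : R -> T -> R.
Hypotheses (nq : cadapted q) (q_nd : forall w, Om w -> ray_nondecreasing (q ^~ w)).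
Let W t w := m t w ^+ 2 - q t w.
Hypothesis mW : local_martingale P F W.
Let J := stieltjes_integral (fun s w => H s w ^+ 2) q.
Let I t w := ln (1 + Y t w) - L t w + 2^-1 * J t w.

Let nH2 : cadapted (fun t w => H t w ^+ 2).
Proof. by apply: (cadaptedX usualF); exact: cadapted_H. Qed.

Lemma cadapted_I : cadapted I.
Proof.
apply: (cadaptedD usualF).
  apply: (cadaptedB usualF); last exact: cadapted_L.
  apply: (cadapted_ln usualF) => [|w t]; last exact: onePlus_gt0.
  by apply: (cadaptedD usualF) => //; exact: (cadapted_cst usualF).
apply: (cadaptedM usualF); first exact: (cadapted_cst usualF).
by apply: (cadapted_integral usualF FOm nOm).
Qed.

Let HH w : Om w -> forall t, 0 <= t -> 0 <= H t w <= 1.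
Proof. by move=> Omw t t0; exact: H01. Qed.

Let HH2 w : Om w -> forall t, 0 <= t -> 0 <= H t w ^+ 2 <= 1.
Proof.
move=> Omw t t0; have /andP[h0 h1] := H01 Omw t0.
by rewrite exprn_ge0//= exprn_ile1.
Qed.

Let log_const_ge0 (k : R) : 0 <= k -> 0 <= log_const k.
Proof.
move=> k0; have k1 : 0 <= 1 + k by rewrite addr_ge0.
by rewrite /log_const !addr_ge0 ?mulr_ge0 ?addr_ge0 ?mulr_ge0 ?mulr_ge0.
Qed.

Lemma I_local_martingale : local_martingale P F I.
Proof.
pose v t w := l t w + q t w.
(* [V1] and [V2] are the factors of [dm] and [dW] in [log_identity]. *)
pose V1 t w := H t w + H t w ^+ 2 * m t w.
pose V2 t w := - 2^-1 * H t w ^+ 2.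
have nW : cadapted W by apply: (cadaptedB usualF) => //; exact: (cadaptedX usualF).
have nv : cadapted v by exact: (cadaptedD usualF).
have nV1 : cadapted V1.
  by apply: (cadaptedD usualF); [exact: cadapted_H|exact: (cadaptedM usualF)].
have nV2 : cadapted V2 by apply: (cadaptedM usualF) => //; exact: (cadapted_cst usualF).
pose Xs := [:: Y; m; l; W; I; v; V1; V2].
have nXs i : (i < size Xs)%N -> cadapted (nth (fun _ _ => 0) Xs i).
  by case: i => [|[|[|[|[|[|[|[|]]]]]]]]// _; exact: cadapted_I.
have nS := cadapted_norm_sum usualF nOm nXs.
apply: (hat_local_martingale usualF FOm nOm nS.1 nS.2 cadapted_I.1) => n.
set rho := hitting_time _ _ _.
have rho_st : stopping_time F rho by exact: (hitting_time_stopping filtF FOm nS.1 nS.2).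
have rho0 w : (0 <= rho w)%E by case: rho_st.
have bound i w t : (i < size Xs)%N -> live Om rho w -> 0 <= t ->
    `|nth (fun _ _ => 0) Xs i (clamp t (rho w)) w| <= n%:R.
  exact: (stopped_le usualF nOm nXs).
have hat_bound i t w : (i < size Xs)%N -> 0 <= t ->
    `|hat Om rho (nth (fun _ _ => 0) Xs i) t w| <= n%:R.
  exact: (hat_le usualF nOm nXs).
pose k : R := n%:R.
have k0 : 0 <= k by [].
have c0 := log_const_ge0 k0.
have kK : k <= k + log_const k by rewrite lerDl.
have mhat : martingale P F (hat Om rho m).
  apply: (local_hat_martingale usualF FOm rho_st (K := k) mm nm.2) => t w t0.
  exact: (hat_bound 1%N t w isT t0).
have What : martingale P F (hat Om rho W).
  apply: (local_hat_martingale usualF FOm rho_st (K := k) mW nW.2) => t w t0.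
  exact: (hat_bound 3%N t w isT t0).
apply: (hat_criterion usualF FOm rho_st (K := k + log_const k) (m := m) (v := v)
  (e := fun s t w => (hat Om rho I t w - hat Om rho I s w) -
     (hat Om rho V1 s w * (hat Om rho m t w - hat Om rho m s w) +
      hat Om rho V2 s w * (hat Om rho W t w - hat Om rho W s w)))) => //.
- exact: cadapted_I.
- by move=> t w t0; apply: le_trans kK; exact: (hat_bound 1%N t w isT t0).
- by move=> t w t0; apply: le_trans kK; exact: (hat_bound 5%N t w isT t0).
- by move=> t w t0; apply: le_trans kK; exact: (hat_bound 4%N t w isT t0).
- by move=> w Omw s t s0 st; rewrite lerD ?l_nd ?q_nd.
- move=> s t s0 st.
  have C1 := centered_hat usualF FOm rho_st nV1 mhat (fun w => hat_bound 6%N s w isT s0) s0 st.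
  have C2 := centered_hat usualF FOm rho_st nV2 What (fun w => hat_bound 7%N s w isT s0) s0 st.
  have := centeredD (filt_measurable filtF s0) C1 C2.
  by congr (centered _ _ _); apply/funext => w; rewrite subKr.
- move=> w lw; have [Omw _] := lw; have r0 := rho0 w.
  have cl t : 0 <= t -> 0 <= clamp t (rho w) by move=> t0; have [] := clampP t0 r0.
  have cont X : cadapted X -> upath (fun t => X (clamp t (rho w)) w).
    by move=> [_ cX]; exact: (upath_stopped r0 (cX w Omw)).
  have := @log_error_small _ k (fun t => Y (clamp t (rho w)) w)
    (fun t => m (clamp t (rho w)) w) (fun t => l (clamp t (rho w)) w)
    (fun t => L (clamp t (rho w)) w) k0 (fun t t0 => Y_ge0 Omw (cl t t0))
    (fun t t0 => Yml Omw (cl t t0)) (cont _ nY) (cont _ nm) (cont _ nl)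
    (fun t t0 => bound 0%N w t isT lw t0) (fun t t0 => bound 1%N w t isT lw t0)
    (fun t t0 => bound 2%N w t isT lw t0) (stopped_nd r0 (l_nd Omw))
    (stopped_integral_small cadapted_H nl Omw (l_nd Omw) (HH Omw) r0)
    _ _ (stopped_nd r0 (q_nd Omw))
    (stopped_integral_small nH2 nq Omw (q_nd Omw) (HH2 Omw) r0).
  move=> sm; apply: (@eq_small _ _ _ _ _ (small_le sm c0 _ _)).
  + by rewrite lerDr.
  + move=> s t s0 st; rewrite /quadratic_clock /clock /incr lexx andbT.
    have vnd := stopped_nd r0 (l_nd Omw) s0 st; have qnd := stopped_nd r0 (q_nd Omw) s0 st.
    by rewrite addr_ge0 ?sqr_ge0// subr_ge0 lerD.
  + move=> s t s0 st; rewrite !hat_live// /log_error /log_path /incr /V1 /V2 /W.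
    exact: log_identity.
- by move=> s t w s0 st nlw; rewrite !hat_dead// !subrr !mulr0 addr0 subrr.
Qed.

(** * Brackets of the integral with a test local martingale *)

Section Bracket.
Variables (N A1 A2 : R -> T -> R).
Hypotheses (nN : cadapted N) (nA1 : cadapted A1) (nA2 : cadapted A2)
  (A1_nd : forall w, Om w -> ray_nondecreasing (A1 ^~ w))
  (A2_nd : forall w, Om w -> ray_nondecreasing (A2 ^~ w))
  (mN : local_martingale P F N).
Let U t w := m t w * N t w - (A1 t w - A2 t w).
Hypothesis mU : local_martingale P F U.
Let J1 := stieltjes_integral H A1.
Let J2 := stieltjes_integral H A2.
Let Z t w := I t w * N t w - (J1 t w - J2 t w).

Lemma bracket_local_martingale : local_martingale P F Z.
Proof.
have nI := cadapted_I; have nH := cadapted_H.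
have nJ1 : cadapted J1 by exact: (cadapted_integral usualF FOm nOm).
have nJ2 : cadapted J2 by exact: (cadapted_integral usualF FOm nOm).
pose v t w := l t w + q t w + A1 t w + A2 t w.
(* [V1] and [V2] are the factors of [dN] and [dm] in [product_identity]; those of [dI] and [dU] are
   [N] and [H]. *)
pose V1 t w := I t w - H t w * m t w.
pose V2 t w := - (H t w * N t w).
have nU : cadapted U by apply: (cadaptedB usualF); [exact: (cadaptedM usualF)|exact: (cadaptedB usualF)].
have nZ : cadapted Z by apply: (cadaptedB usualF); [exact: (cadaptedM usualF)|exact: (cadaptedB usualF)].
have nv : cadapted v by do 3 apply: (cadaptedD usualF) => //.
have nV1 : cadapted V1 by apply: (cadaptedB usualF) => //; exact: (cadaptedM usualF).
have nV2 : cadapted V2 by apply: (cadaptedN usualF); exact: (cadaptedM usualF).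
pose Xs := [:: Y; m; l; N; U; I; Z; v; V1; V2; H].
have nXs i : (i < size Xs)%N -> cadapted (nth (fun _ _ => 0) Xs i).
  by case: i => [|[|[|[|[|[|[|[|[|[|[|]]]]]]]]]]].
have nS := cadapted_norm_sum usualF nOm nXs.
apply: (hat_local_martingale usualF FOm nOm nS.1 nS.2 nZ.1) => n.
set rho := hitting_time _ _ _.
have rho_st : stopping_time F rho by exact: (hitting_time_stopping filtF FOm nS.1 nS.2).
have rho0 w : (0 <= rho w)%E by case: rho_st.
have bound i w t : (i < size Xs)%N -> live Om rho w -> 0 <= t ->
    `|nth (fun _ _ => 0) Xs i (clamp t (rho w)) w| <= n%:R.
  exact: (stopped_le usualF nOm nXs).
have hat_bound i t w : (i < size Xs)%N -> 0 <= t ->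
    `|hat Om rho (nth (fun _ _ => 0) Xs i) t w| <= n%:R.
  exact: (hat_le usualF nOm nXs).
pose k : R := n%:R.
have k0 : 0 <= k by [].
pose c := 2 * k * (log_const k + 1) + 1 + 1.
have c0 : 0 <= c.
  by rewrite !addr_ge0// mulr_ge0 ?mulr_ge0// addr_ge0// log_const_ge0.
have kK : k <= k + c by rewrite lerDl.
have hat_mart i X : (i < size Xs)%N -> X = nth (fun _ _ => 0) Xs i ->
    local_martingale P F X -> martingale P F (hat Om rho X).
  move=> iX XE mX.
  have cX : forall w, Om w -> upath (X ^~ w) by rewrite XE; exact: (nXs i iX).2.
  apply: (local_hat_martingale usualF FOm rho_st (K := k) mX cX) => t w t0.
  by rewrite XE; exact: hat_bound.
have mhat := hat_mart 1%N m isT erefl mm.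
have Nhat := hat_mart 3%N N isT erefl mN.
have Uhat := hat_mart 4%N U isT erefl mU.
have Ihat := hat_mart 5%N I isT erefl I_local_martingale.
apply: (hat_criterion usualF FOm rho_st (K := k + c) (m := m) (v := v)
  (e := fun s t w => (hat Om rho Z t w - hat Om rho Z s w) -
     (hat Om rho V1 s w * (hat Om rho N t w - hat Om rho N s w) +
      hat Om rho N s w * (hat Om rho I t w - hat Om rho I s w) +
      hat Om rho V2 s w * (hat Om rho m t w - hat Om rho m s w) +
      hat Om rho H s w * (hat Om rho U t w - hat Om rho U s w)))) => //.
- by move=> t w t0; apply: le_trans kK; exact: (hat_bound 1%N t w isT t0).
- by move=> t w t0; apply: le_trans kK; exact: (hat_bound 7%N t w isT t0).
- by move=> t w t0; apply: le_trans kK; exact: (hat_bound 6%N t w isT t0).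
- move=> w Omw s t s0 st.
  by rewrite /v !lerD ?l_nd ?q_nd ?A1_nd ?A2_nd.
- move=> s t s0 st; have FM := filt_measurable filtF s0.
  have C1 := centered_hat usualF FOm rho_st nV1 Nhat (fun w => hat_bound 8%N s w isT s0) s0 st.
  have C2 := centered_hat usualF FOm rho_st nN Ihat (fun w => hat_bound 3%N s w isT s0) s0 st.
  have C3 := centered_hat usualF FOm rho_st nV2 mhat (fun w => hat_bound 9%N s w isT s0) s0 st.
  have C4 := centered_hat usualF FOm rho_st nH Uhat (fun w => hat_bound 10%N s w isT s0) s0 st.
  have := centeredD FM (centeredD FM (centeredD FM C1 C2) C3) C4.
  by congr (centered _ _ _); apply/funext => w; rewrite subKr.
- move=> w lw; have [Omw _] := lw; have r0 := rho0 w.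
  have cl t : 0 <= t -> 0 <= clamp t (rho w) by move=> t0; have [] := clampP t0 r0.
  have cont X : cadapted X -> upath (fun t => X (clamp t (rho w)) w).
    by move=> [_ cX]; exact: (upath_stopped r0 (cX w Omw)).
  have := @product_expansion _ k (fun t => Y (clamp t (rho w)) w)
    (fun t => m (clamp t (rho w)) w) (fun t => l (clamp t (rho w)) w)
    (fun t => L (clamp t (rho w)) w) k0 (fun t t0 => Y_ge0 Omw (cl t t0))
    (fun t t0 => Yml Omw (cl t t0)) (cont _ nY) (cont _ nm) (cont _ nl)
    (fun t t0 => bound 0%N w t isT lw t0) (fun t t0 => bound 1%N w t isT lw t0)
    (fun t t0 => bound 2%N w t isT lw t0) (stopped_nd r0 (l_nd Omw))
    (stopped_integral_small cadapted_H nl Omw (l_nd Omw) (HH Omw) r0)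
    _ _ (stopped_nd r0 (q_nd Omw))
    (stopped_integral_small nH2 nq Omw (q_nd Omw) (HH2 Omw) r0)
    _ _ _ _ _ (cont _ nN) (fun t t0 => bound 3%N w t isT lw t0)
    (stopped_nd r0 (A1_nd Omw)) (stopped_nd r0 (A2_nd Omw))
    (stopped_integral_small nH nA1 Omw (A1_nd Omw) (HH Omw) r0)
    (stopped_integral_small nH nA2 Omw (A2_nd Omw) (HH Omw) r0).
  move=> sm; apply: (@eq_small _ _ _ _ _ (small_le sm c0 _ _)).
  + by rewrite lerDr.
  + move=> s t s0 st; rewrite /product_clock /clock /incr lexx andbT.
    have lnd := stopped_nd r0 (l_nd Omw) s0 st; have qnd := stopped_nd r0 (q_nd Omw) s0 st.
    have a1nd := stopped_nd r0 (A1_nd Omw) s0 st; have a2nd := stopped_nd r0 (A2_nd Omw) s0 st.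
    rewrite addr_ge0 ?sqr_ge0// subr_ge0 /v.
    by apply: lerD => //; apply: lerD => //; exact: lerD.
  + move=> s t s0 st; rewrite !hat_live// /log_path /incr /V1 /V2 /U /Z.
    exact: product_identity.
- by move=> s t w s0 st nlw; rewrite !hat_dead// !subrr !mulr0 !addr0 subrr.
Qed.

End Bracket.
End Logarithm.

(** * Uniqueness of the decomposition *)

Section Uniqueness.
Variables M' C : R -> T -> R.
Hypotheses (nM' : cadapted M') (nC : cadapted C) (mM' : local_martingale P F M')
  (C_nd : forall w, Om w -> ray_nondecreasing (C ^~ w))
  (C0 : forall w, Om w -> C 0 w = 1) (Y0 : forall w, Om w -> Y 0 w = 0)
  (YE : forall w t, Om w -> 0 <= t -> Y t w = M' t w * C t w - 1).
Let E t w := expR (L t w).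
Let Q t w := E t w / C t w.

Let C1 w t : Om w -> 0 <= t -> 1 <= C t w.
Proof. by move=> Omw t0; rewrite -(C0 Omw); apply: C_nd. Qed.

Let Cpos w t : Om w -> 0 <= t -> 0 < C t w.
Proof. by move=> Omw t0; apply: lt_le_trans (C1 Omw t0). Qed.

Let nE : cadapted E. Proof. by apply: (cadapted_expR usualF); exact: cadapted_L. Qed.

Let nQ : cadapted Q.
Proof. by apply: (cadaptedM usualF) => //; exact: (cadapted_inv usualF nOm). Qed.

Let E_nd w : Om w -> ray_nondecreasing (E ^~ w).
Proof.
move=> Omw s t s0 st; rewrite ler_expR.
have [_ cl] := nl; have [_ cH] := cadapted_H.
apply: (path_integral_nd (cl w Omw) (l_nd Omw) (cH w Omw)) => // u u0.
by have /andP[] := H01 Omw u0.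
Qed.

Let M'E w t : Om w -> 0 <= t -> M' t w = M t w * Q t w.
Proof.
move=> Omw t0; rewrite /M /Q /E expRN YE// subrK.
by field; rewrite !gt_eqF ?expR_gt0// Cpos.
Qed.

Let M_gt0 w t : Om w -> 0 <= t -> 0 < M t w.
Proof. by move=> Omw t0; rewrite /M mulr_gt0 ?expR_gt0// addrC onePlus_gt0. Qed.

Let L0 w : L 0 w = 0.
Proof. exact: path_integral0. Qed.

Let Z t w := M t w * Q t w ^+ 2.

Let v t w := E t w + C t w.
(** [V1] and [V2] are the factors of [dM'] and [dM] in [ratio_identity]. *)
Let V1 t w := 2 * Q t w.
Let V2 t w := - Q t w ^+ 2.
Let Xs := [:: M; M'; E; C; v; Z; V1; V2].
Let nXs i : (i < size Xs)%N -> cadapted (nth (fun _ _ => 0) Xs i).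
Proof.
have nv : cadapted v by exact: (cadaptedD usualF).
have nZ : cadapted Z by apply: (cadaptedM usualF); [exact: cadapted_M|exact: (cadaptedX usualF)].
have nV1 : cadapted V1 by apply: (cadaptedM usualF) => //; exact: (cadapted_cst usualF).
have nV2 : cadapted V2 by apply: (cadaptedN usualF); exact: (cadaptedX usualF).
by case: i => [|[|[|[|[|[|[|[|]]]]]]]]// _; exact: cadapted_M.
Qed.

Let nS := cadapted_norm_sum usualF nOm nXs.
Let level n := hitting_time Om (norm_sum Xs) n%:R.

Section Level.
Variable n : nat.
Let rho := level n.
Let rho_st : stopping_time F rho.
Proof. exact: (hitting_time_stopping filtF FOm nS.1 nS.2). Qed.
Let rho0 w : (0 <= rho w)%E. Proof. by case: rho_st. Qed.

Let bound i w t : (i < size Xs)%N -> live Om rho w -> 0 <= t ->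
  `|nth (fun _ _ => 0) Xs i (clamp t (rho w)) w| <= n%:R.
Proof. exact: (stopped_le usualF nOm nXs). Qed.

Let hat_bound i t w : (i < size Xs)%N -> 0 <= t ->
  `|hat Om rho (nth (fun _ _ => 0) Xs i) t w| <= n%:R.
Proof. exact: (hat_le usualF nOm nXs). Qed.

Let Mhat : martingale P F (hat Om rho M).
Proof.
apply: (local_hat_martingale usualF FOm rho_st (K := n%:R : R) M_local_martingale cadapted_M.2).
by move=> t w t0; exact: (@hat_bound 0%N t w isT t0).
Qed.

Let M'hat : martingale P F (hat Om rho M').
Proof.
apply: (local_hat_martingale usualF FOm rho_st (K := n%:R : R) mM' nM'.2).
by move=> t w t0; exact: (@hat_bound 1%N t w isT t0).
Qed.

Let Zhat : martingale P F (hat Om rho Z).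
Proof.
pose k : R := n%:R.
have k0 : 0 <= k by [].
pose c := k * (2 * k * (1 + k)).
have c0 : 0 <= c by rewrite !mulr_ge0// addr_ge0.
have kK : k <= k + c by rewrite lerDl.
have nZ : cadapted Z := @nXs 5%N isT.
apply: (hat_criterion usualF FOm rho_st (K := k + c) (m := M) (v := v)
  (e := fun s t w => (hat Om rho Z t w - hat Om rho Z s w) -
     (hat Om rho V1 s w * (hat Om rho M' t w - hat Om rho M' s w) +
      hat Om rho V2 s w * (hat Om rho M t w - hat Om rho M s w)))) => //.
- exact: cadapted_M.
- exact: (@nXs 4%N isT).
- exact: M_local_martingale.
- by move=> t w t0; apply: le_trans kK; exact: (@hat_bound 0%N t w isT t0).
- by move=> t w t0; apply: le_trans kK; exact: (@hat_bound 4%N t w isT t0).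
- by move=> t w t0; apply: le_trans kK; exact: (@hat_bound 5%N t w isT t0).
- by move=> w Omw s t s0 st; exact: lerD (E_nd Omw s0 st) (C_nd Omw s0 st).
- move=> s t s0 st.
  have D1 := centered_hat usualF FOm rho_st (@nXs 6%N isT) M'hat
    (fun w => @hat_bound 6%N s w isT s0) s0 st.
  have D2 := centered_hat usualF FOm rho_st (@nXs 7%N isT) Mhat
    (fun w => @hat_bound 7%N s w isT s0) s0 st.
  have := centeredD (filt_measurable filtF s0) D1 D2.
  by congr (centered _ _ _); apply/funext => w; rewrite subKr.
- move=> w lw; have [Omw _] := lw; have r0 := rho0 w.
  have cl t : 0 <= t -> 0 <= clamp t (rho w) by move=> t0; have [] := clampP t0 r0.
  have cont X : cadapted X -> upath (fun t => X (clamp t (rho w)) w).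
    by move=> [_ cX]; exact: (upath_stopped r0 (cX w Omw)).
  have := @ratio_sqr_small _ k (fun t => M (clamp t (rho w)) w)
    (fun t => E (clamp t (rho w)) w) (fun t => C (clamp t (rho w)) w) k0
    (cont _ nE) (cont _ nC)
    (fun t t0 => @bound 0%N w t isT lw t0) (fun t t0 => @bound 2%N w t isT lw t0)
    (stopped_nd r0 (E_nd Omw)) (stopped_nd r0 (C_nd Omw)) (fun t t0 => C1 Omw (cl t t0)).
  move=> sm; apply: (@eq_small _ _ _ _ _ (small_le sm c0 _ _)).
  + by rewrite lerDr.
  + move=> s t s0 st; rewrite /clock /incr /v.
    have vs := lerD (stopped_nd r0 (E_nd Omw) s0 st) (stopped_nd r0 (C_nd Omw) s0 st).
    by apply/andP; split; [rewrite subr_ge0; exact: vs|rewrite lerDr sqr_ge0].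
  + move=> s t s0 st; rewrite !hat_live// /incr /V1 /V2 /Z.
    by apply: ratio_identity; apply: M'E => //; apply: cl => //; exact: le_trans st.
- by move=> s t w s0 st nlw; rewrite !hat_dead// !subrr !mulr0 addr0 subrr.
Qed.

(** [D] combines three stopped martingales, so its expectation stays equal to that of [D 0 = 0]. Off
    [live] these martingales are 0 and say nothing about [Q], which explains the restriction to
    [live]. *)
Lemma stopped_ratio t : 0 <= t ->
  {ae P, forall w, live Om (level n) w -> Q (clamp t (level n w)) w = 1}.
Proof.
move=> t0; pose D u w := hat Om rho Z u w - 2 * hat Om rho M' u w + hat Om rho M u w.
have DE u w : 0 <= u -> live Om rho w ->
    D u w = M (clamp u (rho w)) w * (Q (clamp u (rho w)) w - 1) ^+ 2.
  move=> u0 lw; have [Omw _] := lw; have [c0 _ _] := clampP u0 (rho0 w).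
  by rewrite /D !hat_live// M'E// /Z; ring.
have D_ge0 u w : 0 <= u -> 0 <= D u w.
  move=> u0; have [lw|nlw] := pselect (live Om rho w); last first.
    by rewrite /D !hat_dead// mulr0 subr0 addr0.
  have [Omw _] := lw; have [c0 _ _] := clampP u0 (rho0 w).
  by rewrite DE// mulr_ge0 ?sqr_ge0// ltW// M_gt0.
have D0 w : D 0 w = 0.
  have [lw|nlw] := pselect (live Om rho w); last first.
    by rewrite /D !hat_dead// mulr0 subr0 addr0.
  have [Omw _] := lw.
  rewrite DE// clamp0// /Q /E L0 expR0 (C0 Omw) divr1 subrr expr0n mulr0//.
have ID u : 0 <= u -> integrable_rv P (D u).
  move=> u0; have /(martingaleP P filtF)[I1 _ _] := Mhat.
  have /(martingaleP P filtF)[I2 _ _] := M'hat.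
  have /(martingaleP P filtF)[I3 _ _] := Zhat.
  apply: integD; last exact: I1.
  apply: integB; first exact: I3.
  by apply: (@integM _ _ _ _ `|2|) => //; exact: I2.
have ED u : 0 <= u -> expect P (D u) = expect P (hat Om rho Z u) -
    2 * expect P (hat Om rho M' u) + expect P (hat Om rho M u).
  move=> u0; have /(martingaleP P filtF)[I1 _ _] := Mhat.
  have /(martingaleP P filtF)[I2 _ _] := M'hat.
  have /(martingaleP P filtF)[I3 _ _] := Zhat.
  have I2' : integrable_rv P (fun w => 2 * hat Om rho M' u w).
    by apply: (@integM _ _ _ _ `|2|) => //; exact: I2.
  rewrite /D expectD; [|by apply: integB => //; exact: I3|exact: I1].
  rewrite expectB; [|exact: I3|exact: I2'].
  by rewrite expectZ//; exact: I2.
have const X : martingale P F X -> expect P (X t) = expect P (X 0).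
  move=> /(martingaleP P filtF)[_ _ /(_ 0 t setT (lexx 0) t0)].
  move=> /(_ (sigma_setT (filt_sigma filtF (lexx 0)))).
  have drop1 f : expect P (fun w => f w * \1_[set: T] w) = expect P f.
    by apply: eq_expect => w; rewrite indicT mulr1.
  by rewrite !drop1 => ->.
have EDt : expect P (D t) = 0.
  rewrite (ED t t0) (const _ Zhat) (const _ M'hat) (const _ Mhat) -(ED 0 (lexx 0)).
  by rewrite -[RHS](expect_cst P 0); apply: eq_expect => w; exact: D0.
have := expect_eq0_ae (ID t t0) (fun w => D_ge0 t w t0) EDt.
apply: filterS => w + lw; have [Omw _] := lw; have [c0 _ _] := clampP t0 (rho0 w).
rewrite DE// => /eqP; rewrite mulf_eq0 gt_eqF ?M_gt0//= sqrf_eq0 subr_eq0.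
by move/eqP.
Qed.

End Level.

Lemma multiplicative_unique : indistinguishable P M' M /\ indistinguishable P C E.
Proof.
have Q1 t : 0 <= t -> {ae P, forall w, Q t w = 1}.
  move=> t0.
  have aeQ : {ae P, forall w n, live Om (level n) w -> Q (clamp t (level n w)) w = 1}.
    by apply: ae_foralln => n; exact: stopped_ratio.
  have HO : {ae P, forall w, Om w} by exact: (ae_on nOm).
  apply: filterS2 HO aeQ => w Omw Qn.
  (* A level beyond [t + 1] gives the strict inequality [t < level n w], so that the path is [live]
     and stopping has no effect at time [t]. *)
  have /cvgeyPge/(_ (t + 1)) lim := hitting_time_cvg nS.2 w.
  have [n tn] := filter_ex lim.
  have tn' : (t%:E < level n w)%E by apply: lt_le_trans tn; rewrite lte_fin ltrDl.
  have lw : live Om (level n) w by split=> //=; apply: le_lt_trans tn'; rewrite lee_fin.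
  by have := Qn n lw; rewrite clamp_id// ltW.
have QQ : indistinguishable P Q (fun _ _ => 1).
  by apply: (cadapted_indistinguishable nOm nQ) => //; exact: (cadapted_cst usualF).
have HO : {ae P, forall w, Om w} by exact: (ae_on nOm).
split; apply: filterS2 HO QQ => w Omw Qw t t0.
  by rewrite M'E// Qw// mulr1.
by have := Qw t t0; rewrite /Q => /divr1_eq.
Qed.

End Uniqueness.

End BaseProcesses.

(** * Sets of good paths *)

Section GoodSet.
Context {d : measure_display} {T : measurableType d} {R : realType}.
Variable P : probability T R.
Variable F : R -> set (set T).
Hypothesis usualF : usual_conditions P F.
Local Notation upath := uniformly_continuous_path.

(** Provides the set [Om] of the preceding sections: its complement is negligible, hence in [F 0] by
    the usual conditions. *)
Lemma full_set_F0 (Q : T -> Prop) : {ae P, forall w, Q w} ->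
  F 0 [set w | Q w] /\ P.-negligible (~` [set w | Q w]).
Proof.
have [filtF nF _] := usualF => aeQ.
have nQ : P.-negligible (~` [set w | Q w]) by exact: aeQ.
split=> //; rewrite -[X in F 0 X]setCK.
by apply: (sigma_setC (filt_sigma filtF (lexx 0))); exact: nF.
Qed.

Lemma ae_and (A B : T -> Prop) : {ae P, forall w, A w} -> {ae P, forall w, B w} ->
  {ae P, forall w, A w /\ B w}.
Proof. by move=> HA HB; apply: filterS2 HA HB => w Aw Bw. Qed.

Lemma path_continuous_upath X : path_continuous P X -> {ae P, forall w, upath (X ^~ w)}.
Proof. by apply: filterS => w /upathP. Qed.

Lemma cadapted_path_continuous Om X : P.-negligible (~` Om) -> cadapted F Om X -> path_continuous P X.
Proof.
move=> nOm [_ cX]; have HO : {ae P, forall w, Om w} by exact: (ae_on nOm).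
by apply: filterS HO => w Omw; apply/upathP; exact: cX.
Qed.

Lemma indistinguishable_refl X : indistinguishable P X X.
Proof. exact: aeW. Qed.

End GoodSet.

Theorem proposition2p1 (d : measure_display) (T : measurableType d)
    (R : realType) (P : probability T R) (F : R -> set (set T))
    (Y m ell : R -> T -> R)
    (usualF : usual_conditions P F)
    (contY : path_continuous P Y)
    (Y_ge0 : {ae P, forall w, forall t, 0 <= t -> 0 <= Y t w})
    (submartY : local_submartingale P F Y)
    (Y0 : starts_at P 0 Y)
    (doobY : doob_meyer P F Y m ell) :
  let H := fun t w => (1 + Y t w)^-1 in
  let L := stieltjes_integral H ell in
  exists M C : R -> T -> R,
    [/\ multiplicative_decomposition P F Y M C,
        forall M' C' : R -> T -> R,
          multiplicative_decomposition P F Y M' C' ->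
          indistinguishable P M' M /\ indistinguishable P C' C,
        indistinguishable P C (fun t w => expR (L t w)),
        indistinguishable P M (fun t w => (Y t w + 1) * expR (- L t w)) &
        forall qv : R -> T -> R, quadratic_variation P F m qv ->
          exists I : R -> T -> R, stochastic_integral P F H m I /\
            indistinguishable P M (fun t w =>
              expR (I t w -
                2^-1 * stieltjes_integral (fun s w => H s w ^+ 2) qv t w))].
Proof.
move=> H L.
have [[cm mm] m0 [aell cell nd_ell] ell0 Yml] := doobY.
have [aY _] := submartY; have [am _] := mm.
(* Good paths for the data of the theorem alone. Each further process shrinks this set, so the facts
   below are stated for an arbitrary [Om] included in [base]. *)
pose base w := [/\ uniformly_continuous_path (Y ^~ w), uniformly_continuous_path (m ^~ w),
  uniformly_continuous_path (ell ^~ w), ray_nondecreasing (ell ^~ w) &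
  [/\ forall t, 0 <= t -> 0 <= Y t w, forall t, 0 <= t -> Y t w = m t w + ell t w & Y 0 w = 0]].
have ae_base : {ae P, forall w, base w}.
  have aeI := ae_and (ae_and (path_continuous_upath contY) (path_continuous_upath cm))
    (ae_and (ae_and (path_continuous_upath cell) nd_ell) (ae_and (ae_and Y_ge0 Yml) Y0)).
  by apply: filterS aeI => w [[uY um] [[ul nl] [[y0 yml] y00]]].
exists (fun t w => (Y t w + 1) * expR (- L t w)), (fun t w => expR (L t w)).
have base_cadapted Om : Om `<=` base -> [/\ cadapted F Om Y, cadapted F Om m & cadapted F Om ell].
  by move=> sub; split; split=> // w /sub[].
have base_props Om : Om `<=` base ->
  [/\ forall w t, Om w -> 0 <= t -> 0 <= Y t w,
      forall w t, Om w -> 0 <= t -> Y t w = m t w + ell t w,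
      forall w, Om w -> ray_nondecreasing (ell ^~ w) &
      forall w, Om w -> Y 0 w = 0].
  by move=> sub; split=> [w t|w t|w|w] Omw;
    have [_ _ _ b4 [b5 b6 b7]] := sub w Omw; [exact: b5|exact: b6|exact: b4|exact: b7].
have L0 w : L 0 w = 0 := path_integral0 (ell ^~ w) (H ^~ w).
split.
- have [FOm nOm] := full_set_F0 usualF ae_base.
  have HO : {ae P, forall w, base w} := ae_base.
  have [nY nm nell] := base_cadapted _ (@subset_refl _ _).
  have [Yp Ys Yn Y00] := base_props _ (@subset_refl _ _).
  have nM := cadapted_M usualF FOm nOm nY nell Yp Yn.
  have nL := cadapted_L usualF FOm nOm nY nell Yp Yn.
  have nC := cadapted_expR usualF nL.
  have mM := M_local_martingale usualF FOm nOm nY nm nell Yp Ys Yn mm.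
  split; [split; [split|..]|split|..] => //.
  + exact: cadapted_path_continuous nOm nM.
  + apply: filterS HO => w bw.
    by rewrite L0 Y00// add0r oppr0 expR0 mulr1.
  + apply: filterS HO => w bw t t0.
    by rewrite mulr_gt0 ?expR_gt0// ltr_wpDl// Yp.
  + exact: nC.1.
  + exact: cadapted_path_continuous nOm nC.
  + apply: filterS HO => w bw s t s0 st; rewrite ler_expR.
    have nH := cadapted_H usualF nOm nY Yp.
    apply: (path_integral_nd (nell.2 w bw) (Yn w bw) (nH.2 w bw)) => // u u0.
    by have /andP[] := H01 Yp bw u0.
  + by apply: filterS HO => w bw; rewrite L0 expR0.
  + apply: filterS HO => w bw t t0.
    by rewrite -mulrA -expRD addNr expR0 mulr1 addrK.
- move=> M' C' [[[cM' mM'] M'0 M'pos] [aC' cC' nd_C'] C'0 YE].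
  pose good w := [/\ base w, uniformly_continuous_path (M' ^~ w),
    uniformly_continuous_path (C' ^~ w), ray_nondecreasing (C' ^~ w) &
    C' 0 w = 1 /\ forall t, 0 <= t -> Y t w = M' t w * C' t w - 1].
  have ae_good : {ae P, forall w, good w}.
    have aeI := ae_and (ae_and ae_base (path_continuous_upath cM'))
      (ae_and (ae_and (path_continuous_upath cC') nd_C') (ae_and C'0 YE)).
    by apply: filterS aeI => w [[bw uM'] [[uC' nC'] [c0 yE]]].
  have [FOm nOm] := full_set_F0 usualF ae_good.
  have sub : [set w | good w] `<=` base by move=> w [].
  have [nY nm nell] := base_cadapted _ sub.
  have [Yp Ys Yn Y00] := base_props _ sub.
  apply: (multiplicative_unique usualF FOm nOm nY nm nell Yp Ys Yn mm (M' := M') (C := C')) => //.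
  + by split; [case: mM'|move=> w []].
  + by split=> // w [].
  + by move=> w [].
  + by move=> w [_ _ _ _ []].
  + by move=> w t [_ _ _ _ [_ h]]; exact: h.
- exact: indistinguishable_refl.
- exact: indistinguishable_refl.
- move=> qv [[aqv cqv nd_qv] qv0 mW].
  (* With this choice [I - 2^-1 J = ln (1 + Y) - L], where [J] is the integral of [H^2] against
     [qv]; the exponential formula for [M] is then exact on good paths, and what has to be proved is
     that [I] is the stochastic integral. *)
  pose I t w := ln (1 + Y t w) - L t w +
    2^-1 * stieltjes_integral (fun s w => H s w ^+ 2) qv t w.
  pose good w := [/\ base w, uniformly_continuous_path (qv ^~ w) &
    ray_nondecreasing (qv ^~ w)].
  have ae_good : {ae P, forall w, good w}.
    have aeI := ae_and ae_base (ae_and (path_continuous_upath cqv) nd_qv).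
    by apply: filterS aeI => w [bw [uq nq]].
  have [FOm nOm] := full_set_F0 usualF ae_good.
  have sub : [set w | good w] `<=` base by move=> w [].
  have [nY nm nell] := base_cadapted _ sub.
  have [Yp Ys Yn Y00] := base_props _ sub.
  have nqv : cadapted F [set w | good w] qv by split=> // w [].
  have qvn : forall w, good w -> ray_nondecreasing (qv ^~ w) by move=> w [].
  exists I; split; last first.
    apply: filterS ae_good => w bw t t0.
    rewrite /I addrK expRD lnK ?[Y t w + 1]addrC// posrE.
    exact: (onePlus_gt0 Yp).
  split.
  + split.
      apply: (cadapted_path_continuous nOm).
      exact: (cadapted_I usualF FOm nOm nY nell Yp Yn nqv qvn).
    exact: (I_local_martingale usualF FOm nOm nY nm nell Yp Ys Yn mm nqv qvn mW).
  + apply: filterS ae_good => w bw; rewrite /I L0 (Y00 w bw) addr0 ln1.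
    have -> : stieltjes_integral (fun s w => H s w ^+ 2) qv 0 w = 0 := path_integral0 (qv ^~ w) (fun s => H s w ^+ 2).
    by rewrite mulr0 subr0 addr0.
  + move=> N A1 A2 [cN mN] [[[aA1 cA1 nd_A1] _] [[aA2 cA2 nd_A2] _] mU].
    (* The set depends on [N], [A1] and [A2], but [I] was fixed before them and does not. *)
    pose good' w := [/\ good w, uniformly_continuous_path (N ^~ w),
      uniformly_continuous_path (A1 ^~ w) /\ ray_nondecreasing (A1 ^~ w) &
      uniformly_continuous_path (A2 ^~ w) /\ ray_nondecreasing (A2 ^~ w)].
    have ae_good' : {ae P, forall w, good' w}.
      have aeI := ae_and (ae_and ae_good (path_continuous_upath cN))
        (ae_and (ae_and (path_continuous_upath cA1) nd_A1)
                 (ae_and (path_continuous_upath cA2) nd_A2)).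
      by apply: filterS aeI => w [[gw uN] [[u1 n1] [u2 n2]]].
    have [FOm' nOm'] := full_set_F0 usualF ae_good'.
    have sub' : [set w | good' w] `<=` base by move=> w [[]].
    have [nY' nm' nell'] := base_cadapted _ sub'.
    have [Yp' Ys' Yn' _] := base_props _ sub'.
    have nqv' : cadapted F [set w | good' w] qv by split=> // w [[]].
    have qvn' : forall w, good' w -> ray_nondecreasing (qv ^~ w) by move=> w [[]].
    apply: (bracket_local_martingale usualF FOm' nOm' nY' nm' nell' Yp' Ys' Yn' mm nqv' qvn' mW
      (N := N) (A1 := A1) (A2 := A2)) => //.
    * by split=> [|w []//]; case: mN.
    * by split=> // w [_ _ []].
    * by split=> // w [_ _ _ []].
    * by move=> w [_ _ []].
    * by move=> w [_ _ _ []].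
Qed.
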